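(* Let $d\ge 2$, let $\mathbb{F}_d$ be the free group on $d$ generators, let $2\leq p<\infty$, and let $\varphi:\mathbb{F}_d\to\mathbb{C}$ be a positive definite function. Then the following conditions are equivalent: (1) $\varphi$ can be extended to a positive linear functional on $C^*_{\ell_p}(\mathbb{F}_d)$. (2) $\sup_{k\ge 0}|\varphi\chi_k|_p\,(k+1)^{-1}<\infty$. (3) The function $s\mapsto\varphi(s)(1+|s|)^{-1-\frac{2}{p}}$ belongs to $\ell_p(\mathbb{F}_d)$. (4) For any $\alpha\in(0,1)$, the function $s\mapsto\varphi(s)\alpha^{|s|}$ belongs to $\ell_p(\mathbb{F}_d)$.
   Context: Let $\mathbb{F}_d$ have free generators $a_1,\dots,a_d$; $|s|$ denotes the word length of $s\in\mathbb{F}_d$ with respect to $\{a_1,a_1^{-1},\dots,a_d,a_d^{-1}\}$. For an integer $k\ge0$, $W_k=\{s\in\mathbb{F}_d:|s|=k\}$ and $\chi_k$ is the characteristic function of $W_k$. For a function $f$ on a countable discrete group $\Gamma$ and $p\in[1,\infty)$, $|f|_p=\left(\sum_{s\in\Gamma}|f(s)|^p\right)^{1/p}$. For a unitary representation $\pi$ of $\Gamma$ on a Hilbert space $\mathcal{H}$ and $\xi,\eta\in\mathcal{H}$, put $\pi_{\xi,\eta}(s)=\langle\pi(s)\xi,\eta\rangle$. Let $D$ be a non-zero translation invariant (under left and right translations by $\Gamma$) algebraic two-sided ideal of $\ell_\infty(\Gamma)$. A unitary representation $\pi$ on $\mathcal{H}$ is a $D$-representation if there is a dense subspace $\mathcal{H}_0\subset\mathcal{H}$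 with $\pi_{\xi,\eta}\in D$ for all $\xi,\eta\in\mathcal{H}_0$. $C_D^*(\Gamma)$ is the completion of the group ring $\mathbb{C}\Gamma$ in the norm $\|f\|_D=\sup\{\|\pi(f)\|:\pi\text{ is a }D\text{-representation}\}$, where $\pi(f)=\sum_{s}f(s)\pi(s)$; $C^*_{\ell_p}(\Gamma)$ is the case $D=\ell_p(\Gamma)$. The finitely supported functions $c_c(\Gamma)$ are identified with $\mathbb{C}\Gamma$. For a function $\varphi$ on $\Gamma$, $\omega_\varphi(f)=\sum_{s\in\Gamma}f(s)\varphi(s)$ for $f\in c_c(\Gamma)$. ''$\varphi$ can be extended to a positive linear functional on $C_D^*(\Gamma)$'' means that $\omega_\varphi$ extends to a positive linear functional on $C_D^*(\Gamma)$. *)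

(* Defs.v *)
From HB Require Import structures.
From mathcomp Require Import all_boot all_order all_algebra finmap.
From mathcomp Require Import all_classical all_reals all_analysis.
From mathcomp Require Import complex generic_quotient.

Set Implicit Arguments.
Unset Strict Implicit.
Unset Printing Implicit Defensive.

Import Order.TTheory GRing.Theory Num.Theory.
Import numFieldNormedType.Exports.

Local Open Scope classical_set_scope.
Local Open Scope ring_scope.
Local Open Scope complex_scope.
Local Open Scope quotient_scope.

Section FreeGroup.
Variable d : nat.

(* (i, false) stands for the generator a_i and (i, true) for its inverse *)
Definition letter := ('I_d * bool)%type.

Definition inv_letter (x : letter) : letter := (x.1, ~~ x.2).

Definition reduced (w : seq letter) : bool :=
  sorted (fun x y => y != inv_letter x) w.

Record free_group := FreeGroup {
  word_of :> seq letter;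
  word_of_reduced : reduced word_of }.

HB.instance Definition _ := [isSub for word_of].
HB.instance Definition _ := [Countable of free_group by <:].

Definition push (x : letter) (w : seq letter) : seq letter :=
  if w is y :: w' then if y == inv_letter x then w' else x :: w else [:: x].

Definition fg_mul_word (v w : seq letter) : seq letter := foldr push w v.

Definition fg_inv_word (w : seq letter) : seq letter := rev (map inv_letter w).

Lemma inv_letterK : involutive inv_letter.
Proof. by case=> i b; rewrite /inv_letter /= negbK. Qed.

Lemma reduced_push x w : reduced w -> reduced (push x w).
Proof.
case: w => [//|y w] /=; case: eqVneq => [_|yx].
  by case: w => [//|z w] /= /andP[].
by rewrite /reduced /= yx.
Qed.

Lemma push_cancel x w : reduced w -> push x (push (inv_letter x) w) = w.
Proof.
case: w => [|y w] /=; first by rewrite eqxx.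
rewrite inv_letterK; case: eqVneq => [->|yx] /=; last by rewrite eqxx.
case: w => [//|z w]; rewrite /reduced /= => /andP[/negPf zx _].
by rewrite zx.
Qed.

Lemma reduced_mul v w : reduced w -> reduced (fg_mul_word v w).
Proof. by move=> rw; elim: v => //= x v /(reduced_push x). Qed.

Lemma push_mul x v w : reduced v -> reduced w ->
  fg_mul_word (push x v) w = push x (fg_mul_word v w).
Proof.
move=> rv rw; case: v rv => [//|y v] rv /=; case: eqVneq => [yE|//].
by rewrite yE push_cancel // reduced_mul.
Qed.

Lemma fg_mul_wordA u v w : reduced v -> reduced w ->
  fg_mul_word u (fg_mul_word v w) = fg_mul_word (fg_mul_word u v) w.
Proof.
move=> rv rw; elim: u => //= x u ->.
by rewrite push_mul // reduced_mul.
Qed.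

Lemma fg_mul_word1 w : reduced w -> fg_mul_word w [::] = w.
Proof.
elim: w => //= x w IH; rewrite /reduced /= => xw.
rewrite IH; last by move: xw; case: (w) => //= y w' /andP[].
by case: w xw {IH} => //= y w /andP[/negPf ->].
Qed.

Lemma reduced_inv w : reduced w -> reduced (fg_inv_word w).
Proof.
rewrite /reduced /fg_inv_word rev_sorted sorted_map => rw.
apply: sub_sorted rw => x y /=; apply: contraNN => /eqP.
by rewrite /relpre /= inv_letterK => ->.
Qed.

Lemma fg_mul_word_cat u v w : fg_mul_word (u ++ v) w = fg_mul_word u (fg_mul_word v w).
Proof. exact: foldr_cat. Qed.

Lemma fg_mulVw w : fg_mul_word (fg_inv_word w) w = [::].
Proof.
rewrite /fg_inv_word; elim: w => //= x w IH.
by rewrite rev_cons -cats1 fg_mul_word_cat /= inv_letterK eqxx.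
Qed.

Definition fg_one : free_group := @FreeGroup [::] isT.
Definition fg_mul (s t : free_group) : free_group :=
  FreeGroup (reduced_mul s (word_of_reduced t)).
Definition fg_inv (s : free_group) : free_group :=
  FreeGroup (reduced_inv (word_of_reduced s)).

Lemma fg_mulA : associative fg_mul.
Proof. by move=> s t u; apply/val_inj/fg_mul_wordA; apply: word_of_reduced. Qed.

Lemma fg_mul1 : left_id fg_one fg_mul.
Proof. by move=> s; apply: val_inj. Qed.

Lemma fg_mulr1 : right_id fg_one fg_mul.
Proof. by move=> s; apply/val_inj/fg_mul_word1/word_of_reduced. Qed.

Lemma fg_mulV : left_inverse fg_one fg_inv fg_mul.
Proof. by move=> s; apply/val_inj/fg_mulVw. Qed.

Lemma fg_mulrV : right_inverse fg_one fg_inv fg_mul.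
Proof.
move=> s; rewrite -[LHS]fg_mul1 -{1}(fg_mulV (fg_inv s)) -!fg_mulA.
by rewrite [fg_mul (fg_inv s) (fg_mul _ _)]fg_mulA fg_mulV fg_mul1 fg_mulV.
Qed.

HB.instance Definition _ := isGroup.Build free_group
  fg_mulA fg_mul1 fg_mulr1 fg_mulV fg_mulrV.

Definition wlen (s : free_group) : nat := size (word_of s).

Definition fg_letter (x : letter) : free_group := @FreeGroup [:: x] isT.

Definition fg_gen (i : 'I_d) : free_group := fg_letter (i, false).

Lemma fg_letterV x : fg_letter (inv_letter x) = ((fg_letter x)^-1)%g.
Proof. exact: val_inj. Qed.

Lemma fg_word_prod (s : free_group) : s = (\prod_(x <- word_of s) fg_letter x)%g.
Proof.
apply: val_inj; rewrite /= -[LHS]fg_mul_word1 ?word_of_reduced //.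
elim: (word_of s) => [|x w IH]; first by rewrite big_nil.
by rewrite big_cons /= IH.
Qed.

(* wlen is the word length: the least number of letters with product s *)
Lemma wlen_min (s : free_group) (w : seq letter) :
  s = (\prod_(x <- w) fg_letter x)%g -> (wlen s <= size w)%N.
Proof.
move=> ->; elim: w => [|x w IH]; first by rewrite big_nil.
rewrite big_cons /= /wlen /=.
move: IH; rewrite /wlen; case: (word_of _) => [//|y v] /=.
case: ifP => _ //= lt_vw; exact: leq_trans (leq_trans (leqnSn _) lt_vw) (leqnSn _).
Qed.

End FreeGroup.

Section Functions.
Variables (R : realType) (G : groupType).
Local Notation C := R[i].

(* |f|_p, possibly +oo *)
Definition lpnorm (p : R) (f : G -> C) : \bar R :=
  ((\esum_(s in [set: G]) ((Normc.normc (f s)) `^ p)%:E) `^ p^-1)%E.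

Definition lp (p : R) : set (G -> C) := [set f | (lpnorm p f < +oo)%E].

Definition positive_definite (phi : G -> C) : Prop :=
  forall (n : nat) (s : 'I_n -> G) (c : 'I_n -> C),
    0 <= \sum_(i < n) \sum_(j < n)
           Num.conj (c i) * c j * phi ((s i)^-1 * s j)%g.

End Functions.

Section GroupAlgebra.
Variables (R : realType) (G : groupType).
Local Notation C := R[i].

Definition fin_supported : {pred G -> C} :=
  fun f => `[< finite_set [set s | f s != 0] >].

Record group_algebra := GroupAlgebra {
  ga_val :> G -> C;
  ga_valP : ga_val \in fin_supported }.

HB.instance Definition _ := [isSub for ga_val].
HB.instance Definition _ := [Choice of group_algebra by <:].

Lemma finsupp_submod : submod_closed fin_supported.
Proof.
split=> [|a f g /asboolP ff /asboolP fg]; apply/asboolP.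
  by rewrite (_ : [set s | _] = set0) // -subset0 => s /=; rewrite eqxx.
apply: (@sub_finite_set _ _ ([set s | f s != 0] `|` [set s | g s != 0])).
  move=> s /=; have [fs0|] := eqVneq (f s) 0; last by left.
  rewrite (_ : (a *: f + g) s = a * f s + g s) // fs0 mulr0 add0r.
  by right.
by rewrite finite_setU.
Qed.

HB.instance Definition _ := GRing.isSubmodClosed.Build C (G -> C) fin_supported
  (GRing.submod_closed_semi finsupp_submod).
HB.instance Definition _ := [SubChoice_isSubLmodule of group_algebra by <:].

Implicit Types f g h : group_algebra.

Lemma ga_fin f : finite_set [set s | f s != 0].
Proof. exact/asboolP/(ga_valP f). Qed.

Lemma gaP f g : (forall s, f s = g s) -> f = g.
Proof. by move=> fg; apply/val_inj/funext. Qed.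

Lemma ga_linE a f g s : (a *: f + g) s = a * f s + g s.
Proof. by []. Qed.

Lemma ga_addE f g s : (f + g) s = f s + g s.
Proof. by []. Qed.

Lemma ga_oppE f s : (- f) s = - f s.
Proof. by []. Qed.

Lemma ga_scaleE a f s : (a *: f) s = a * f s.
Proof. by []. Qed.

Lemma ga_0E s : (0 : group_algebra) s = 0.
Proof. by []. Qed.

Definition gsum (V : lmodType C) (f : group_algebra) (F : G -> V) : V :=
  \sum_(s \in [set: G]) f s *: F s.

Lemma gsumE (V : lmodType C) (A : {fset G}) f (F : G -> V) :
  [set s | f s != 0] `<=` [set` A] -> gsum f F = \sum_(s <- A) f s *: F s.
Proof.
move=> fA; transitivity (\sum_(s \in [set` A]) f s *: F s); last first.
  by apply/esym/fsbig_seq/fset_uniq.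
apply/esym/fsbig_widen => // s [_ /= /negP sA].
by have [->|/fA] := eqVneq (f s) 0; [rewrite scale0r | move=> /= /(negP sA)].
Qed.

Lemma gsum_supp f : exists A : {fset G}, [set s | f s != 0] `<=` [set` A].
Proof. by have /finite_fsetP[A ->] := ga_fin f; exists A. Qed.

Lemma gsum_linear (V : lmodType C) (F : G -> V) a f g :
  gsum (a *: f + g) F = a *: gsum f F + gsum g F.
Proof.
have [A fA] := gsum_supp f; have [B gB] := gsum_supp g.
have fAB : [set s | f s != 0] `<=` [set` (A `|` B)%fset].
  by move=> s /fA /= sA; rewrite inE sA.
have gAB : [set s | g s != 0] `<=` [set` (A `|` B)%fset].
  by move=> s /gB /= sB; rewrite inE sB orbT.
have fgAB : [set s | (a *: f + g) s != 0] `<=` [set` (A `|` B)%fset].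
  move=> s; rewrite /mkset (ga_linE _ f); have [fs0|/fAB//] := eqVneq (f s) 0.
  by rewrite fs0 mulr0 add0r => /gAB.
rewrite (gsumE F fAB) (gsumE F gAB) (gsumE F fgAB).
rewrite scaler_sumr -big_split; apply: eq_bigr => s _.
by rewrite (ga_linE _ f) scalerDl scalerA.
Qed.

Lemma gsum0 (V : lmodType C) (F : G -> V) : gsum 0 F = 0.
Proof.
by have := gsum_linear F (-1) 0 0; rewrite !scaleN1r !addNr.
Qed.

Lemma eq_gsum (V : lmodType C) f (F F' : G -> V) :
  F =1 F' -> gsum f F = gsum f F'.
Proof. by move=> /funext ->. Qed.

Lemma gsum_lin (V W : lmodType C) (L : {linear V -> W}) f (F : G -> V) :
  L (gsum f F) = gsum f (fun s => L (F s)).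
Proof.
have [A fA] := gsum_supp f; rewrite !(gsumE _ fA) linear_sum.
by apply: eq_bigr => s _ /=; rewrite linearZ_LR.
Qed.

Lemma gsumD (V : lmodType C) f (F F' : G -> V) a :
  gsum f (fun s => a *: F s + F' s) = a *: gsum f F + gsum f F'.
Proof.
have [A fA] := gsum_supp f; rewrite !(gsumE _ fA).
rewrite scaler_sumr -big_split; apply: eq_bigr => s _.
by rewrite scalerDr !scalerA [a * _]mulrC.
Qed.

Lemma delta_finsupp (s : G) : (fun t => (t == s)%:R : C) \in fin_supported.
Proof.
apply/asboolP; apply: (@sub_finite_set _ _ [set s]) => // t /=.
by case: (eqVneq t s) => // _; rewrite mulr0n eqxx.
Qed.

Definition delta (s : G) : group_algebra := GroupAlgebra (delta_finsupp s).

Lemma deltaE s t : delta s t = (t == s)%:R.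
Proof. by []. Qed.

Lemma gsum_delta (V : lmodType C) s (F : G -> V) : gsum (delta s) F = F s.
Proof.
have ds : [set t | delta s t != 0] `<=` [set` [fset s]%fset].
  by move=> t; rewrite /mkset deltaE inE; case: (t == s); rewrite ?mulr0n ?eqxx.
by rewrite (gsumE F ds) big_seq_fset1 deltaE eqxx scale1r.
Qed.

Lemma ga_sumE (I : Type) (r : seq I) (F : I -> group_algebra) s :
  (\sum_(i <- r) F i) s = \sum_(i <- r) F i s.
Proof. by elim/big_rec2: _ => // i x y _ <-. Qed.

Lemma ga_ind (P : group_algebra -> Prop) :
  (forall s, P (delta s)) -> P 0 ->
  (forall a f g, P f -> P g -> P (a *: f + g)) -> forall f, P f.
Proof.
move=> Pd P0 PD f; have [A fA] := gsum_supp f.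
suff -> : f = \sum_(s <- A) f s *: delta s.
  elim: (enum_fset A) => [|s r IH]; first by rewrite big_nil.
  by rewrite big_cons; apply: PD.
apply: gaP => t; rewrite ga_sumE.
under eq_bigr do rewrite (ga_scaleE _ (delta _)) deltaE.
have [tA|tA] := boolP (t \in A).
  rewrite (big_fsetD1 t tA) /= eqxx mulr1 big1_fset ?addr0 // => s.
  by rewrite !inE eq_sym => /andP[/negPf ->]; rewrite mulr0.
rewrite big1_fset => [|s sA _].
  by apply: contraNeq tA => /fA.
by case: eqP tA => [->|]; rewrite ?sA // mulr0.
Qed.

Lemma conv_finsupp f g :
  (fun s => \sum_(t \in [set: G]) f t * g (t^-1 * s)%g) \in fin_supported.
Proof.
have [A fA] := gsum_supp f; have [B gB] := gsum_supp g.
apply/asboolP; apply: (@sub_finite_set _ _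
  [set` ([fset (x * y)%g | x in A, y in B])%fset]) => // s /=.
apply: contraNT => sAB; apply/eqP.
apply: fsbig1 => t _; have [->|/fA tA] := eqVneq (f t) 0; first by rewrite mul0r.
have [->|/gB tB] := eqVneq (g (t^-1 * s)%g) 0; first by rewrite mulr0.
case/negP: sAB; apply/imfset2P; exists t => //; exists (t^-1 * s)%g => //.
by rewrite mulVKg.
Qed.

Definition conv f g : group_algebra := GroupAlgebra (conv_finsupp f g).

Lemma convE f g s : conv f g s = gsum f (fun t => g (t^-1 * s)%g : C^o).
Proof. by []. Qed.

Lemma conv_delta s t : conv (delta s) (delta t) = delta (s * t)%g.
Proof.
apply: gaP => u; rewrite convE gsum_delta !deltaE; congr (_%:R).
by rewrite -(inj_eq (mulgI s)) mulVKg.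
Qed.

Lemma conv_linl a f g h : conv (a *: f + g) h = a *: conv f h + conv g h.
Proof. by apply: gaP => s; rewrite (ga_linE _ (conv _ _)) !convE gsum_linear. Qed.

Lemma conv_linr a f g h : conv h (a *: f + g) = a *: conv h f + conv h g.
Proof.
apply: gaP => s; rewrite (ga_linE _ (conv _ _)) !convE -gsumD.
by apply: eq_gsum => t; rewrite (ga_linE _ f).
Qed.

Lemma conv0l h : conv 0 h = 0.
Proof. by apply: gaP => s; rewrite convE gsum0. Qed.

Lemma conv0r h : conv h 0 = 0.
Proof.
by have := conv_linr (-1) 0 0 h; rewrite !scaleN1r !addNr.
Qed.

Lemma gsum_conv (V : lmodType C) f g (F : G -> V) :
  gsum (conv f g) F = gsum f (fun s => gsum g (fun t => F (s * t)%g)).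
Proof.
elim/ga_ind: f => [s||a f f' IH IH']; last first.
- by rewrite conv_linl !gsum_linear IH IH'.
- by rewrite conv0l !gsum0.
rewrite gsum_delta; elim/ga_ind: g => [t||a g g' IH IH'].
- by rewrite conv_delta !gsum_delta.
- by rewrite conv0r !gsum0.
- by rewrite conv_linr !gsum_linear IH IH'.
Qed.

Lemma convA : associative conv.
Proof.
move=> f g h; apply: gaP => s; rewrite [RHS]convE gsum_conv [LHS]convE.
apply: eq_gsum => t; rewrite convE; apply: eq_gsum => u.
by rewrite invgM mulgA.
Qed.

Lemma conv1l : left_id (delta 1%g) conv.
Proof. by move=> f; apply: gaP => s; rewrite convE gsum_delta invg1 mul1g. Qed.

Lemma conv1r : right_id (delta 1%g) conv.
Proof.
elim/ga_ind => [s||a f g IH IH']; first by rewrite conv_delta mulg1.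
- by rewrite conv0l.
- by rewrite conv_linl IH IH'.
Qed.

Lemma convDl : left_distributive conv +%R.
Proof. by move=> f g h; have := conv_linl 1 f g h; rewrite !scale1r. Qed.

Lemma convDr : right_distributive conv +%R.
Proof. by move=> h f g; have := conv_linr 1 f g h; rewrite !scale1r. Qed.

Lemma ga1_neq0 : delta 1%g != 0.
Proof.
apply/eqP => /(congr1 (fun f : group_algebra => f 1%g)).
by rewrite deltaE eqxx ga_0E => /eqP; rewrite oner_eq0.
Qed.

HB.instance Definition _ := GRing.Zmodule_isNzRing.Build group_algebra
  convA conv1l conv1r convDl convDr ga1_neq0.

Lemma ga_scaleAl a f g : a *: (f * g) = (a *: f) * g.
Proof. by have := conv_linl a f 0 g; rewrite addr0 conv0l addr0. Qed.

Lemma ga_scaleAr a f g : a *: (f * g) = f * (a *: g).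
Proof. by have := conv_linr a g 0 f; rewrite addr0 conv0r addr0. Qed.

HB.instance Definition _ :=
  GRing.Lmodule_isLalgebra.Build C group_algebra ga_scaleAl.
HB.instance Definition _ :=
  GRing.Lalgebra_isAlgebra.Build C group_algebra ga_scaleAr.

Lemma ga_mulE f g s :
  (f * g) s = \sum_(t \in [set: G]) f t * g (t^-1 * s)%g.
Proof. by []. Qed.

Lemma ga_star_finsupp f : (fun s => Num.conj (f (s^-1)%g)) \in fin_supported.
Proof.
apply/asboolP; have := ga_fin f.
move/(finite_image (fun x : G => x^-1)%g); apply: sub_finite_set => s /=.
by rewrite conjC_eq0 => fs; exists (s^-1)%g => //; rewrite invgK.
Qed.

Definition ga_star f : group_algebra := GroupAlgebra (ga_star_finsupp f).

Lemma ga_starE f s : ga_star f s = Num.conj (f (s^-1)%g).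
Proof. by []. Qed.

Lemma ga_star_delta s : ga_star (delta s) = delta (s^-1)%g.
Proof.
apply: gaP => t; rewrite ga_starE !deltaE conjC_nat.
by rewrite -(inj_eq (can_inj (@invgK G))) invgK.
Qed.

Lemma ga_star_semilinear a f g :
  ga_star (a *: f + g) = Num.conj a *: ga_star f + ga_star g.
Proof.
by apply: gaP => s; rewrite (ga_linE _ (ga_star f)) !ga_starE (ga_linE _ f) rmorphD rmorphM.
Qed.

Lemma ga_starK : involutive ga_star.
Proof. by move=> f; apply: gaP => s; rewrite !ga_starE invgK conjCK. Qed.

Lemma ga_star0 : ga_star 0 = 0.
Proof. by apply: gaP => s; rewrite ga_starE ga_0E conjC0. Qed.

Lemma ga_starM f g : ga_star (f * g) = ga_star g * ga_star f.
Proof.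
elim/ga_ind: f => [s||a f f' IH IH']; last first.
- by rewrite mulrDl -scalerAl !ga_star_semilinear IH IH' mulrDr scalerAr.
- by rewrite mul0r ga_star0 mulr0.
elim/ga_ind: g => [t||a g g' IH IH'].
- rewrite [delta s * _]conv_delta !ga_star_delta [RHS]conv_delta.
  by rewrite invgM.
- by rewrite mulr0 ga_star0 mul0r.
- by rewrite mulrDr -scalerAr !ga_star_semilinear IH IH' mulrDl scalerAl.
Qed.

End GroupAlgebra.

Section Hilbert.
Variable R : realType.
Local Notation C := R[i].

(* inner is linear in its first argument and conjugate-linear in the second *)
Record hilbert_space := HilbertSpace {
  hcarrier :> completeNormedModType C;
  inner : {dot hcarrier for @Num.conj C};
  inner_norm : forall x : hcarrier, inner x x = `|x| ^+ 2 }.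

Definition hnorm (H : hilbert_space) (x : H) : R := complex.Re `|x|.

Definition opnorm (H : hilbert_space) (T : H -> H) : R :=
  sup [set hnorm (T x) | x in [set x : H | hnorm x <= 1]].

End Hilbert.
Arguments inner {R} H : rename.

Section Representations.
Variables (R : realType) (G : groupType).
Local Notation C := R[i].

Record unitary_rep (H : hilbert_space R) := UnitaryRep {
  rep_fun :> G -> {linear H -> H};
  rep1 : forall x : H, rep_fun 1%g x = x;
  repM : forall (s t : G) (x : H),
    rep_fun (s * t)%g x = rep_fun s (rep_fun t x);
  rep_unitary : forall (s : G) (x y : H),
    inner H (rep_fun s x) (rep_fun s y) = inner H x y }.

Definition rep_coef (H : hilbert_space R) (pi : unitary_rep H) (xi eta : H) :
  G -> C := fun s => inner H (pi s xi) eta.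

Definition D_representation (D : set (G -> C)) (H : hilbert_space R)
    (pi : unitary_rep H) : Prop :=
  exists H0 : {pred H},
    [/\ submod_closed H0, dense [set` H0] &
        forall xi eta : H, xi \in H0 -> eta \in H0 -> D (rep_coef pi xi eta)].

Definition rep_alg (H : hilbert_space R) (pi : unitary_rep H)
    (f : group_algebra R G) (x : H) : H :=
  \sum_(s \in [set: G]) f s *: pi s x.

(* [sup] is 0 on unbounded sets; by rep_alg_bounded below, these operator norms
   are bounded uniformly in the representation *)
Definition Dnorm (D : set (G -> C)) (f : group_algebra R G) : R :=
  sup [set r | exists (H : hilbert_space R) (pi : unitary_rep H),
                 D_representation D pi /\ r = opnorm (rep_alg pi f)].

End Representations.

Section OperatorNorm.
Variables (R : realType) (H : hilbert_space R).
Local Notation C := R[i].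
Implicit Types (x y : H) (T : H -> H).

Lemma normc_norm (z : C) : (Normc.normc z)%:C = `|z|.
Proof. by []. Qed.

Lemma hnormE x : (hnorm x)%:C = `|x|.
Proof. by rewrite /hnorm RRe_real; last exact/ger0_real/normr_ge0. Qed.

Lemma hnorm_ge0 x : 0 <= hnorm x.
Proof. by rewrite -ler0c hnormE normr_ge0. Qed.

Lemma hnormD x y : hnorm (x + y) <= hnorm x + hnorm y.
Proof. by rewrite -lecR rmorphD /= !hnormE ler_normD. Qed.

Lemma hnormZ (a : C) x : hnorm (a *: x) = Normc.normc a * hnorm x.
Proof.
apply: (@complexI R); rewrite rmorphM /= !hnormE normrZ; congr (_ * _).
Qed.

Lemma hnorm0 : hnorm (0 : H) = 0.
Proof. by rewrite /hnorm normr0. Qed.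

Lemma hnorm_eq0 x : hnorm x = 0 -> x = 0.
Proof. by move=> x0; apply/normr0_eq0; rewrite -hnormE x0. Qed.

Lemma inner_hnorm x : inner H x x = ((hnorm x) ^+ 2)%:C.
Proof. by rewrite inner_norm rmorphXn /= hnormE. Qed.

Lemma inner_Dl (a : C) x y z :
  inner H (a *: x + y) z = a * inner H x z + inner H y z.
Proof. by rewrite linearDl linearZl_LR. Qed.

Lemma inner_Dr (a : C) x y z :
  inner H z (a *: x + y) = Num.conj a * inner H z x + inner H z y.
Proof. by rewrite linearD /= linearZr_LR. Qed.

Lemma inner_conj x y : inner H x y = Num.conj (inner H y x).
Proof. by rewrite hermC expr0 mul1r. Qed.

Lemma cauchy_schwarz x y :
  Normc.normc (inner H x y) <= hnorm x * hnorm y.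
Proof.
have [->|y0] := eqVneq y 0.
  rewrite linear0r Normc.normc0 hnorm0 mulr0 //.
have ny0 : hnorm y ^+ 2 != 0.
  by rewrite expf_neq0 //; apply: contra y0 => /eqP /hnorm_eq0 ->.
set b := inner H x y; set n := (hnorm y ^+ 2).
pose z := (- (b / n%:C)) *: y + x.
have nC : n%:C != 0 :> C by rewrite (inj_eq (@complexI R) n 0).
have zE : inner H z z = ((hnorm x) ^+ 2 - Normc.normc b ^+ 2 / n)%:C.
  have zy : inner H z y = 0.
    by rewrite /z inner_Dl inner_hnorm -/b -/n mulNr divfK // addNr.
  rewrite {2}/z inner_Dr zy mulr0 add0r /z inner_Dl inner_hnorm addrC mulNr.
  rewrite rmorphB /=; congr (_ - _).
  rewrite inner_conj -/b.
  have -> (r m : R) : (r / m)%:C = r%:C / m%:C by rewrite rmorphM fmorphV.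
  rewrite mulrAC; congr (_ / _).
  rewrite rmorphXn /= normc_norm.
  exact/esym/sqr_normc.
have : 0 <= inner H z z by rewrite inner_norm exprn_ge0.
rewrite zE ler0c subr_ge0 ler_pdivrMr ?lt_neqAle 1?eq_sym ?ny0 ?sqr_ge0 //.
rewrite -exprMn ler_pXn2r // ?nnegrE ?mulr_ge0 ?hnorm_ge0 //.
by rewrite -ler0c normc_norm normr_ge0.
Qed.

Lemma opnorm_le T (K : R) : 0 <= K -> (forall x, hnorm (T x) <= K * hnorm x) ->
  opnorm T <= K.
Proof.
move=> K0 TK; apply: ge_sup.
  by exists (hnorm (T 0)), 0 => //=; rewrite hnorm0 ler01.
move=> _ [x /= x1 <-]; apply: (le_trans (TK x)).
by rewrite ler_piMr.
Qed.

Lemma opnorm_bound T (K : R) : (forall x, hnorm (T x) <= K * hnorm x) ->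
  (forall a x, T (a *: x) = a *: T x) ->
  forall x, hnorm (T x) <= opnorm T * hnorm x.
Proof.
move=> TK TZ x.
have K0 y : hnorm (T y) <= `|K| * hnorm y.
  by apply: le_trans (TK y) _; rewrite ler_wpM2r ?hnorm_ge0 ?ler_norm.
have [->|x0] := eqVneq x 0.
  have -> : T 0 = 0 by rewrite -(scale0r (0 : H)) TZ !scale0r.
  by rewrite !hnorm0 mulr0.
have nx : 0 < hnorm x.
  by rewrite lt_neqAle hnorm_ge0 andbT eq_sym; apply: contra x0 => /eqP /hnorm_eq0 ->.
rewrite -ler_pdivrMr // mulrC.
have normV : Normc.normc ((hnorm x)^-1)%:C = (hnorm x)^-1.
  apply: (@complexI R); rewrite normc_norm ger0_norm //.
  by rewrite ler0c invr_ge0 hnorm_ge0.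
have -> : (hnorm x)^-1 * hnorm (T x) = hnorm (T (((hnorm x)^-1)%:C *: x)).
  by rewrite TZ hnormZ normV.
apply: sup_upper_bound; last first.
  by exists (((hnorm x)^-1)%:C *: x) => //=; rewrite hnormZ normV mulVf ?gt_eqF.
split; first by exists (hnorm (T 0)), 0 => //=; rewrite hnorm0 ler01.
exists `|K| => _ [y /= y1 <-]; apply: le_trans (K0 y) _.
by rewrite ler_piMr.
Qed.

Lemma opnorm_ge0 T : 0 <= opnorm T.
Proof.
rewrite /opnorm; set S := (X in sup X).
have S0 : S (hnorm (T 0)) by exists 0 => //=; rewrite hnorm0 ler01.
have [bS|/asboolPn nbS] := pselect (has_sup S).
  by apply: le_trans (hnorm_ge0 (T 0)) _; exact: sup_upper_bound.
by rewrite sup_out //; apply/asboolPn.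
Qed.

End OperatorNorm.

Section DnormTheory.
Variables (R : realType) (G : groupType).
Local Notation C := R[i].
Implicit Types (f g : group_algebra R G) (s t : G).

Section OneRepresentation.
Variables (H : hilbert_space R) (pi : unitary_rep G H).

Lemma rep_algE f x : rep_alg pi f x = gsum f (fun s => pi s x).
Proof. by []. Qed.

Lemma rep_alg_linear f (a : C) (x y : H) :
  rep_alg pi f (a *: x + y) = a *: rep_alg pi f x + rep_alg pi f y.
Proof.
by rewrite !rep_algE -gsumD; apply: eq_gsum => s; rewrite linearP.
Qed.

Lemma rep_alg0 f : rep_alg pi f 0 = 0.
Proof.
have := rep_alg_linear f (-1) 0 0.
by rewrite !scaleN1r !addNr.
Qed.

Lemma rep_algZ f (a : C) (x : H) : rep_alg pi f (a *: x) = a *: rep_alg pi f x.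
Proof. by have := rep_alg_linear f a x 0; rewrite rep_alg0 !addr0. Qed.

Lemma rep_alg_semi (a : C) f g x :
  rep_alg pi (a *: f + g) x = a *: rep_alg pi f x + rep_alg pi g x.
Proof. by rewrite !rep_algE gsum_linear. Qed.

Lemma rep_algM f g x : rep_alg pi (f * g) x = rep_alg pi f (rep_alg pi g x).
Proof.
rewrite !rep_algE gsum_conv; apply: eq_gsum => s.
by rewrite gsum_lin; apply: eq_gsum => t; rewrite repM.
Qed.

Lemma rep_alg_star f x y :
  inner H (rep_alg pi (ga_star f) x) y = inner H x (rep_alg pi f y).
Proof.
elim/ga_ind: f => [s||a f g IH IH'].
- rewrite ga_star_delta !rep_algE !gsum_delta -(rep_unitary pi s).
  by rewrite -repM mulgV rep1.
- by rewrite ga_star0 !rep_algE !gsum0 linear0l linear0r.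
- by rewrite ga_star_semilinear !rep_alg_semi inner_Dl inner_Dr IH IH'.
Qed.

Lemma hnorm_rep s x : hnorm (pi s x) = hnorm x.
Proof.
have := rep_unitary pi s x x; rewrite !inner_hnorm => /(@complexI R) /eqP.
by rewrite eqrXn2 ?hnorm_ge0 // => /eqP.
Qed.

End OneRepresentation.

Lemma rep_alg_bounded f : exists K : R,
  forall (H : hilbert_space R) (pi : unitary_rep G H) x,
    hnorm (rep_alg pi f x) <= K * hnorm x.
Proof.
elim/ga_ind: f => [s||a f g [K IH] [L IH']].
- by exists 1 => H pi x; rewrite rep_algE gsum_delta hnorm_rep mul1r.
- by exists 0 => H pi x; rewrite rep_algE gsum0 hnorm0 mul0r.
- exists (Normc.normc a * K + L) => H pi x; rewrite rep_alg_semi.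
  apply: le_trans (hnormD _ _) _; rewrite hnormZ mulrDl lerD //.
  by rewrite -mulrA ler_wpM2l // -ler0c normc_norm normr_ge0.
Qed.

Lemma hnorm_rep_alg (H : hilbert_space R) (pi : unitary_rep G H) f x :
  hnorm (rep_alg pi f x) <= opnorm (rep_alg pi f) * hnorm x.
Proof.
have [K fK] := rep_alg_bounded f.
exact: (opnorm_bound (fK H pi) (rep_algZ pi f)).
Qed.

Variable D : set (G -> C).

Lemma Dnorm_le f (K : R) : 0 <= K ->
  (forall (H : hilbert_space R) (pi : unitary_rep G H),
     D_representation D pi -> opnorm (rep_alg pi f) <= K) ->
  Dnorm D f <= K.
Proof.
move=> K0 fK; rewrite /Dnorm; set S := (X in sup X).
have [[r Sr]|S0] := pselect (S !=set0); last first.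
  by rewrite sup_out // => -[].
by apply: ge_sup; [exists r | move=> _ [H [pi [Dpi ->]]]; apply: fK].
Qed.

Lemma opnorm_Dnorm (H : hilbert_space R) (pi : unitary_rep G H) f :
  D_representation D pi -> opnorm (rep_alg pi f) <= Dnorm D f.
Proof.
move=> Dpi; apply: sup_upper_bound; last by exists H, pi.
split; first by exists (opnorm (rep_alg pi f)), H, pi.
have [K fK] := rep_alg_bounded f.
exists `|K| => _ [H' [pi' [_ ->]]]; apply: opnorm_le => // x.
by apply: le_trans (fK _ _ _) _; rewrite ler_wpM2r ?hnorm_ge0 ?ler_norm.
Qed.

Lemma Dnorm_ge0 f : 0 <= Dnorm D f.
Proof.
rewrite /Dnorm; set S := (X in sup X).
have [[_ [H [pi [Dpi _]]]]|S0] := pselect (S !=set0); last first.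
  by rewrite sup_out // => -[].
by apply: le_trans (opnorm_Dnorm f Dpi); apply: opnorm_ge0.
Qed.

Lemma DnormD f g : Dnorm D (f + g) <= Dnorm D f + Dnorm D g.
Proof.
apply: Dnorm_le => [|H pi Dpi]; first by rewrite addr_ge0 ?Dnorm_ge0.
apply: opnorm_le => [|x]; first by rewrite addr_ge0 ?Dnorm_ge0.
rewrite -[f in f + g]scale1r rep_alg_semi scale1r.
apply: le_trans (hnormD _ _) _; rewrite mulrDl.
by apply: lerD; apply: le_trans (hnorm_rep_alg _ _ _) _;
  rewrite ler_wpM2r ?hnorm_ge0 ?opnorm_Dnorm.
Qed.

Lemma DnormZ_le (a : C) f : Dnorm D (a *: f) <= Normc.normc a * Dnorm D f.
Proof.
have na0 : 0 <= Normc.normc a by rewrite -ler0c normc_norm normr_ge0.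
apply: Dnorm_le => [|H pi Dpi]; first by rewrite mulr_ge0 ?Dnorm_ge0.
apply: opnorm_le => [|x]; first by rewrite mulr_ge0 ?Dnorm_ge0.
rewrite -[a *: f]addr0 rep_alg_semi [rep_alg pi 0 x]gsum0 addr0 hnormZ -mulrA.
rewrite ler_wpM2l //; apply: le_trans (hnorm_rep_alg _ _ _) _.
by rewrite ler_wpM2r ?hnorm_ge0 ?opnorm_Dnorm.
Qed.

Lemma DnormM f g : Dnorm D (f * g) <= Dnorm D f * Dnorm D g.
Proof.
apply: Dnorm_le => [|H pi Dpi]; first by rewrite mulr_ge0 ?Dnorm_ge0.
apply: opnorm_le => [|x]; first by rewrite mulr_ge0 ?Dnorm_ge0.
rewrite rep_algM; apply: le_trans (hnorm_rep_alg _ _ _) _; rewrite -mulrA.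
apply: ler_pM; rewrite ?opnorm_ge0 ?hnorm_ge0 ?opnorm_Dnorm //.
apply: le_trans (hnorm_rep_alg _ _ _) _.
by rewrite ler_wpM2r ?hnorm_ge0 ?opnorm_Dnorm.
Qed.

Lemma Dnorm_star_le f : Dnorm D (ga_star f) <= Dnorm D f.
Proof.
apply: Dnorm_le => [|H pi Dpi]; first exact: Dnorm_ge0.
apply: opnorm_le => [|x]; first exact: Dnorm_ge0.
set y := rep_alg pi (ga_star f) x.
have [->|ny] := eqVneq (hnorm y) 0.
  by rewrite mulr_ge0 ?Dnorm_ge0 ?hnorm_ge0.
have yy : hnorm y ^+ 2 <= hnorm x * (Dnorm D f * hnorm y).
  have := cauchy_schwarz x (rep_alg pi f y).
  rewrite -rep_alg_star -/y inner_hnorm -lecR normc_norm ger0_norm; last first.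
    by rewrite ler0c sqr_ge0.
  rewrite lecR => /le_trans; apply; rewrite ler_wpM2l ?hnorm_ge0 //.
  apply: le_trans (hnorm_rep_alg _ _ _) _.
  by rewrite ler_wpM2r ?hnorm_ge0 ?opnorm_Dnorm.
have ypos : 0 < hnorm y by rewrite lt_neqAle eq_sym ny hnorm_ge0.
by rewrite -(ler_pM2r ypos) -expr2 [X in X * _]mulrC -mulrA.
Qed.

Lemma Dnorm_star f : Dnorm D (ga_star f) = Dnorm D f.
Proof.
by apply/le_anti; rewrite Dnorm_star_le -{1}[f]ga_starK Dnorm_star_le.
Qed.

End DnormTheory.

Section StarSeminorm.
Variable R : realType.
Local Notation C := R[i].

Record star_seminorm (A : algType C) := StarSeminorm {
  snorm :> A -> R;
  sstar : A -> A;
  snormD : forall x y : A, snorm (x + y) <= snorm x + snorm y;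
  snormZ : forall (a : C) (x : A), snorm (a *: x) <= Normc.normc a * snorm x;
  snormM : forall x y : A, snorm (x * y) <= snorm x * snorm y;
  sstar_semilinear : forall (a : C) (x y : A),
    sstar (a *: x + y) = Num.conj a *: sstar x + sstar y;
  sstarM : forall x y : A, sstar (x * y) = sstar y * sstar x;
  sstarK : involutive sstar;
  snorm_star : forall x : A, snorm (sstar x) = snorm x }.

Variables (A : algType C) (q : star_seminorm A).

Lemma snorm0 : q 0 = 0.
Proof.
apply/le_anti/andP; split; last first.
  by have := snormD q 0 0; rewrite addr0 -{1}[q 0]addr0 lerD2l.
by have := snormZ q 0 0; rewrite scale0r Normc.normc0 mul0r.
Qed.

Lemma snormN x : q (- x) = q x.
Proof.
have N1 : Normc.normc (-1 : C) = 1.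
  by apply: (@complexI R); rewrite normc_norm normrN1.
apply/le_anti/andP; split.
  by have := snormZ q (-1) x; rewrite scaleN1r N1 mul1r.
by have := snormZ q (-1) (- x); rewrite scaleN1r opprK N1 mul1r.
Qed.

Lemma snorm_ge0 x : 0 <= q x.
Proof.
have := snormD q x (- x); rewrite subrr snorm0 snormN.
by rewrite -mulr2n pmulrn_lge0.
Qed.

Lemma snormB x y : q (x - y) <= q x + q y.
Proof. by rewrite -[q y]snormN snormD. Qed.

Lemma snorm_sub x y : q (x - y) = q (y - x).
Proof. by rewrite -snormN opprB. Qed.

Lemma snorm_tri y x z : q (x - z) <= q (x - y) + q (y - z).
Proof. by apply: le_trans (snormD _ _ _); rewrite addrA subrK. Qed.

Lemma sstarB x y : sstar q (x - y) = sstar q x - sstar q y.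
Proof.
have := sstar_semilinear q (-1) y x.
by rewrite !scaleN1r rmorphN1 scaleN1r addrC [in RHS]addrC.
Qed.

Definition cauchy_pred : {pred nat -> A} := fun u =>
  `[< forall e : R, 0 < e -> exists N, forall m n,
        (N <= m)%N -> (N <= n)%N -> q (u m - u n) < e >].

Record cauchy_seq := CauchySeq {
  cs_val :> nat -> A;
  cs_valP : cs_val \in cauchy_pred }.

HB.instance Definition _ := [isSub for cs_val].
HB.instance Definition _ := [Choice of cauchy_seq by <:].

Definition null_equiv (u v : cauchy_seq) : bool :=
  `[< forall e : R, 0 < e -> exists N, forall n,
        (N <= n)%N -> q (u n - v n) < e >].

Lemma null_equiv_refl : reflexive null_equiv.
Proof. by move=> u; apply/asboolP => e e0; exists 0%N => n _; rewrite subrr snorm0. Qed.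

Lemma null_equiv_sym : symmetric null_equiv.
Proof.
suff H u v : null_equiv u v -> null_equiv v u by move=> u v; apply/idP/idP; apply: H.
move=> /asboolP uv; apply/asboolP => e /uv[N uvN]; exists N => n Nn.
by rewrite snorm_sub uvN.
Qed.

Lemma null_equiv_trans : transitive null_equiv.
Proof.
move=> v u w /asboolP uv /asboolP vw; apply/asboolP => e e0.
have e2 : 0 < e / 2 by rewrite divr_gt0.
have [N uvN] := uv _ e2; have [M vwM] := vw _ e2.
exists (maxn N M) => n; rewrite geq_max => /andP[Nn Mn].
by rewrite (le_lt_trans (snorm_tri (v n) _ _)) // [e]splitr ltrD ?uvN ?vwM.
Qed.

Canonical null_equivR :=
  EquivRel null_equiv null_equiv_refl null_equiv_sym null_equiv_trans.

(* q is only a seminorm: the quotient also kills the elements x with q x = 0 *)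
Definition completion := {eq_quot null_equivR}.

HB.instance Definition _ := Choice.on completion.
HB.instance Definition _ := EqQuotient.on completion.

Lemma pi_null_equiv (u v : cauchy_seq) :
  (\pi_completion u = \pi_completion v) <-> null_equiv u v.
Proof. by split=> [/eqquotP | uv]; last exact/eqquotP. Qed.

Lemma cauchyP (u : cauchy_seq) (e : R) : 0 < e -> exists N, forall m n,
  (N <= m)%N -> (N <= n)%N -> q (u m - u n) < e.
Proof. by move: e; apply/asboolP/cs_valP. Qed.

Lemma cauchy_bounded (u : cauchy_seq) :
  exists2 K : R, 0 < K & exists N, forall n, (N <= n)%N -> q (u n) <= K.
Proof.
have [N uN] := cauchyP u ltr01; exists (1 + q (u N)).
  by rewrite ltr_pwDl // snorm_ge0.
exists N => n Nn; rewrite -[u n](subrK (u N)).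
by apply: le_trans (snormD _ _ _) _; rewrite lerD2r ltW // uN.
Qed.

Lemma const_cauchy (x : A) : (fun _ => x) \in cauchy_pred.
Proof. by apply/asboolP => e e0; exists 0%N => m n _ _; rewrite subrr snorm0. Qed.

Lemma lin_cauchy (a : C) (u v : cauchy_seq) :
  (fun n => a *: u n + v n) \in cauchy_pred.
Proof.
apply/asboolP => e e0.
have na0 : 0 <= Normc.normc a by rewrite -ler0c normc_norm normr_ge0.
have a1 : 0 < Normc.normc a + 1 by rewrite ltr_wpDl.
have [N uN] := @cauchyP u (e / 2 / (Normc.normc a + 1)) ltac:(by rewrite !divr_gt0).
have [M vM] := @cauchyP v (e / 2) ltac:(by rewrite divr_gt0).
exists (maxn N M) => m n; rewrite !geq_max => /andP[Nm Mm] /andP[Nn Mn].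
rewrite opprD addrACA -scalerBr; apply: le_lt_trans (snormD _ _ _) _.
rewrite [e]splitr ler_ltD ?vM //; apply: le_trans (snormZ _ _ _) _.
have := ltW (uN m n Nm Nn); rewrite ler_pdivlMr // => /(le_trans _); apply.
by rewrite mulrC ler_wpM2l ?snorm_ge0 // lerDl.
Qed.

Lemma mul_cauchy (u v : cauchy_seq) : (fun n => u n * v n) \in cauchy_pred.
Proof.
apply/asboolP => e e0.
have [K K0 [N0 uK]] := cauchy_bounded u; have [L L0 [M0 vL]] := cauchy_bounded v.
have [N uN] := @cauchyP u (e / 2 / L) ltac:(by rewrite !divr_gt0).
have [M vM] := @cauchyP v (e / 2 / K) ltac:(by rewrite !divr_gt0).
exists (maxn (maxn N0 M0) (maxn N M)) => m n.
rewrite !geq_max => /andP[/andP[N0m M0m] /andP[Nm Mm]].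
move=> /andP[/andP[N0n M0n] /andP[Nn Mn]].
have -> : u m * v m - u n * v n = (u m - u n) * v m + u n * (v m - v n).
  by rewrite mulrBl mulrBr addrA subrK.
apply: le_lt_trans (snormD _ _ _) _; rewrite [e]splitr ler_ltD //.
  apply: le_trans (snormM _ _ _) _.
  have := ltW (uN m n Nm Nn); rewrite ler_pdivlMr // => /(le_trans _); apply.
  by rewrite ler_wpM2l ?snorm_ge0 ?vL.
apply: le_lt_trans (snormM _ _ _) _.
have := vM m n Mm Mn; rewrite ltr_pdivlMr // mulrC => /(le_lt_trans _); apply.
by rewrite ler_wpM2r ?snorm_ge0 ?uK.
Qed.

Lemma star_cauchy (u : cauchy_seq) : (fun n => sstar q (u n)) \in cauchy_pred.
Proof.
apply/asboolP => e e0; have [N uN] := cauchyP u e0.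
by exists N => m n Nm Nn; rewrite -sstarB snorm_star uN.
Qed.

Definition cs_const x := CauchySeq (const_cauchy x).
Definition cs_lin a u v := CauchySeq (lin_cauchy a u v).
Definition cs_mul u v := CauchySeq (mul_cauchy u v).
Definition cs_star u := CauchySeq (star_cauchy u).

Lemma csP (u v : cauchy_seq) : (forall n, u n = v n) ->
  \pi_completion u = \pi_completion v.
Proof. by move=> uv; congr (\pi_ _ _); apply/val_inj/funext. Qed.

Lemma cs_lin_equiv a u u' v v' : null_equiv u u' -> null_equiv v v' ->
  null_equiv (cs_lin a u v) (cs_lin a u' v').
Proof.
move=> /asboolP uu /asboolP vv; apply/asboolP => e e0.
have na0 : 0 <= Normc.normc a by rewrite -ler0c normc_norm normr_ge0.
have a1 : 0 < Normc.normc a + 1 by rewrite ltr_wpDl.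
have [N uN] := uu (e / 2 / (Normc.normc a + 1)) ltac:(by rewrite !divr_gt0).
have [M vM] := vv (e / 2) ltac:(by rewrite divr_gt0).
exists (maxn N M) => n; rewrite geq_max => /andP[Nn Mn] /=.
rewrite opprD addrACA -scalerBr; apply: le_lt_trans (snormD _ _ _) _.
rewrite [e]splitr ler_ltD ?vM //; apply: le_trans (snormZ _ _ _) _.
have := ltW (uN n Nn); rewrite ler_pdivlMr // => /(le_trans _); apply.
by rewrite mulrC ler_wpM2l ?snorm_ge0 // lerDl.
Qed.

Lemma cs_mul_equiv u u' v v' : null_equiv u u' -> null_equiv v v' ->
  null_equiv (cs_mul u v) (cs_mul u' v').
Proof.
move=> /asboolP uu /asboolP vv; apply/asboolP => e e0.
have [K K0 [N0 uK]] := cauchy_bounded u'; have [L L0 [M0 vL]] := cauchy_bounded v.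
have [N uN] := uu (e / 2 / L) ltac:(by rewrite !divr_gt0).
have [M vM] := vv (e / 2 / K) ltac:(by rewrite !divr_gt0).
exists (maxn (maxn N0 M0) (maxn N M)) => n.
rewrite !geq_max => /andP[/andP[N0n M0n] /andP[Nn Mn]] /=.
have -> : u n * v n - u' n * v' n = (u n - u' n) * v n + u' n * (v n - v' n).
  by rewrite mulrBl mulrBr addrA subrK.
apply: le_lt_trans (snormD _ _ _) _; rewrite [e]splitr ler_ltD //.
  apply: le_trans (snormM _ _ _) _.
  have := ltW (uN n Nn); rewrite ler_pdivlMr // => /(le_trans _); apply.
  by rewrite ler_wpM2l ?snorm_ge0 ?vL.
apply: le_lt_trans (snormM _ _ _) _.
have := vM n Mn; rewrite ltr_pdivlMr // mulrC => /(le_lt_trans _); apply.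
by rewrite ler_wpM2r ?snorm_ge0 ?uK.
Qed.

Lemma cs_star_equiv u u' : null_equiv u u' -> null_equiv (cs_star u) (cs_star u').
Proof.
move=> /asboolP uu; apply/asboolP => e /uu[N uN]; exists N => n Nn /=.
by rewrite -sstarB snorm_star uN.
Qed.

Definition c_in (x : A) : completion := \pi_completion (cs_const x).
Definition c_lin (a : C) (x y : completion) : completion :=
  \pi_completion (cs_lin a (repr x) (repr y)).
Definition c_mul (x y : completion) : completion :=
  \pi_completion (cs_mul (repr x) (repr y)).
Definition c_star (x : completion) : completion := \pi_completion (cs_star (repr x)).

Lemma repr_equiv (u : cauchy_seq) : null_equiv (repr (\pi_completion u)) u.
Proof. by apply/pi_null_equiv; rewrite reprK. Qed.

Lemma c_lin_pi a u v :
  c_lin a (\pi_completion u) (\pi_completion v) = \pi_completion (cs_lin a u v).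
Proof. by apply/pi_null_equiv/cs_lin_equiv; apply: repr_equiv. Qed.

Lemma c_mul_pi u v : c_mul (\pi_completion u) (\pi_completion v) = \pi_completion (cs_mul u v).
Proof. by apply/pi_null_equiv/cs_mul_equiv; apply: repr_equiv. Qed.

Lemma c_star_pi u : c_star (\pi_completion u) = \pi_completion (cs_star u).
Proof. by apply/pi_null_equiv/cs_star_equiv; apply: repr_equiv. Qed.

Lemma completion_ind (P : completion -> Prop) :
  (forall u, P (\pi_completion u)) -> forall x, P x.
Proof. by move=> Pu x; rewrite -[x]reprK. Qed.

Definition c_zero := c_in 0.
Definition c_add (x y : completion) := c_lin 1 x y.
Definition c_opp (x : completion) := c_lin (-1) x c_zero.
Definition c_scale (a : C) (x : completion) := c_lin a x c_zero.

Let cE := (c_lin_pi, c_mul_pi, c_star_pi).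

Lemma c_addA : associative c_add.
Proof.
elim/completion_ind => u; elim/completion_ind => v; elim/completion_ind => w.
by rewrite /c_add !cE; apply: csP => n /=; rewrite !scale1r addrA.
Qed.

Lemma c_addC : commutative c_add.
Proof.
elim/completion_ind => u; elim/completion_ind => v.
by rewrite /c_add !cE; apply: csP => n /=; rewrite !scale1r addrC.
Qed.

Lemma c_add0 : left_id c_zero c_add.
Proof.
elim/completion_ind => u; rewrite /c_add /c_zero /c_in !cE.
by apply: csP => n /=; rewrite scale1r add0r.
Qed.

Lemma c_addN : left_inverse c_zero c_opp c_add.
Proof.
elim/completion_ind => u; rewrite /c_add /c_opp /c_zero /c_in !cE.
by apply: csP => n /=; rewrite scale1r scaleN1r addr0 addNr.
Qed.

HB.instance Definition _ :=
  GRing.isZmodule.Build completion c_addA c_addC c_add0 c_addN.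

Lemma c_addE (x y : completion) : x + y = c_add x y. Proof. by []. Qed.

Lemma c_scaleA a b x : c_scale a (c_scale b x) = c_scale (a * b) x.
Proof.
elim/completion_ind: x => u; rewrite /c_scale /c_zero /c_in !cE.
by apply: csP => n /=; rewrite !addr0 scalerA.
Qed.

Lemma c_scale1 : left_id 1 c_scale.
Proof.
elim/completion_ind => u; rewrite /c_scale /c_zero /c_in !cE.
by apply: csP => n /=; rewrite addr0 scale1r.
Qed.

Lemma c_scaleDr : right_distributive c_scale +%R.
Proof.
move=> a; elim/completion_ind => u; elim/completion_ind => v.
rewrite !c_addE /c_add /c_scale /c_zero /c_in !cE.
by apply: csP => n /=; rewrite !addr0 !scale1r scalerDr.
Qed.

Lemma c_scaleDl x : {morph c_scale^~ x : a b / a + b}.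
Proof.
move=> a b; elim/completion_ind: x => u.
rewrite !c_addE /c_add /c_scale /c_zero /c_in !cE.
by apply: csP => n /=; rewrite !addr0 scale1r scalerDl.
Qed.

HB.instance Definition _ := GRing.Zmodule_isLmodule.Build C completion
  c_scaleA c_scale1 c_scaleDr c_scaleDl.

Lemma c_mulA : associative c_mul.
Proof.
elim/completion_ind => u; elim/completion_ind => v; elim/completion_ind => w.
by rewrite !cE; apply: csP => n /=; rewrite mulrA.
Qed.

Lemma c_mul1l : left_id (c_in 1) c_mul.
Proof.
by elim/completion_ind => u; rewrite !cE; apply: csP => n /=; rewrite mul1r.
Qed.

Lemma c_mul1r : right_id (c_in 1) c_mul.
Proof.
by elim/completion_ind => u; rewrite !cE; apply: csP => n /=; rewrite mulr1.
Qed.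

Lemma c_mulDl : left_distributive c_mul +%R.
Proof.
elim/completion_ind => u; elim/completion_ind => v; elim/completion_ind => w.
rewrite !c_addE /c_add !cE.
by apply: csP => n /=; rewrite !scale1r mulrDl.
Qed.

Lemma c_mulDr : right_distributive c_mul +%R.
Proof.
elim/completion_ind => u; elim/completion_ind => v; elim/completion_ind => w.
rewrite !c_addE /c_add !cE.
by apply: csP => n /=; rewrite !scale1r mulrDr.
Qed.

HB.instance Definition _ := GRing.Zmodule_isPzRing.Build completion
  c_mulA c_mul1l c_mul1r c_mulDl c_mulDr.

Lemma c_linE (a : C) (x y : completion) : a *: x + y = c_lin a x y.
Proof.
elim/completion_ind: x => u; elim/completion_ind: y => v.
rewrite c_addE /c_add /GRing.scale /= /c_scale /c_zero /c_in !cE.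
by apply: csP => n /=; rewrite addr0 scale1r.
Qed.

Lemma c_scaleAl (a : C) (x y : completion) : a *: (x * y) = (a *: x) * y.
Proof.
elim/completion_ind: x => u; elim/completion_ind: y => v.
rewrite /GRing.scale /GRing.mul /= /c_scale /c_zero /c_in !cE.
by apply: csP => n /=; rewrite !addr0 scalerAl.
Qed.

Lemma c_scaleAr (a : C) (x y : completion) : a *: (x * y) = x * (a *: y).
Proof.
elim/completion_ind: x => u; elim/completion_ind: y => v.
rewrite /GRing.scale /GRing.mul /= /c_scale /c_zero /c_in !cE.
by apply: csP => n /=; rewrite !addr0 scalerAr.
Qed.

Lemma c_star_semilinear (a : C) (x y : completion) :
  c_star (a *: x + y) = Num.conj a *: c_star x + c_star y.
Proof.
elim/completion_ind: x => u; elim/completion_ind: y => v.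
rewrite !c_linE !cE.
by apply: csP => n /=; rewrite sstar_semilinear.
Qed.

Lemma c_starM (x y : completion) : c_star (x * y) = c_star y * c_star x.
Proof.
elim/completion_ind: x => u; elim/completion_ind: y => v.
by rewrite /GRing.mul /= !cE; apply: csP => n /=; rewrite sstarM.
Qed.

Lemma c_starK : involutive c_star.
Proof.
by elim/completion_ind => u; rewrite !cE; apply: csP => n /=; rewrite sstarK.
Qed.

Lemma c_in_linear (a : C) (x y : A) : c_in (a *: x + y) = a *: c_in x + c_in y.
Proof. by rewrite c_linE /c_in !cE; apply: csP. Qed.

Lemma c_inM (x y : A) : c_in (x * y) = c_in x * c_in y.
Proof. by rewrite /GRing.mul /= /c_in !cE; apply: csP. Qed.

Lemma c_in_star x : c_in (sstar q x) = c_star (c_in x).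
Proof. by rewrite /c_in !cE; apply: csP. Qed.

Definition positive_functional (omega : {scalar completion}) : Prop :=
  forall x : completion, 0 <= omega (c_star x * x).

End StarSeminorm.

Section GroupCstar.
Variables (R : realType) (G : groupType).
Local Notation C := R[i].

Definition Dnorm_seminorm (D : set (G -> C)) :
    star_seminorm (group_algebra R G) :=
  StarSeminorm (@DnormD R G D) (@DnormZ_le R G D) (@DnormM R G D)
    (@ga_star_semilinear R G) (@ga_starM R G) (@ga_starK R G)
    (@Dnorm_star R G D).

Definition Cstar_D (D : set (G -> C)) := completion (Dnorm_seminorm D).

HB.instance Definition _ D := GRing.Lmodule.on (Cstar_D D).
HB.instance Definition _ D := GRing.PzRing.on (Cstar_D D).

Definition omega_fun (phi : G -> C) (f : group_algebra R G) : C :=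
  \sum_(s \in [set: G]) f s * phi s.

Definition extends_to_positive (D : set (G -> C)) (phi : G -> C) : Prop :=
  exists omega : {scalar Cstar_D D},
    positive_functional omega /\
    forall f : group_algebra R G,
      omega (c_in (Dnorm_seminorm D) f) = omega_fun phi f.

End GroupCstar.

Section FreeGroupFunctions.
Variables (R : realType) (d : nat).
Local Notation C := R[i].

Definition W (k : nat) : set (free_group d) := [set s | wlen s = k].

Definition chi (k : nat) (s : free_group d) : C := (s \in W k)%:R.

End FreeGroupFunctions.

(* Main.v *)
Require Import Defs.
From HB Require Import structures.
From mathcomp Require Import all_boot all_order all_algebra finmap.
From mathcomp Require Import all_classical all_reals all_analysis.
From mathcomp Require Import complex generic_quotient.
From mathcomp Require Import ring lra.

(** Write [|f|_q] for the q-norm, [q] the exponent conjugate to [p], and [W_k]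
    for the sphere of radius [k].

    The passage from the functional to the growth condition rests on Haagerup's
    inequality in the l_p setting: if [f] is supported on [W_k], then
    [||pi f|| <= (k + 1) |f|_q] in each l_p-representation [pi]
    ([Dnorm_sphere_le]). For this, [|f * g|_q <= (k + 1) |f|_q |g|_q] for all [g]
    ([sums_le_sphere_conv]): a product [t u] with [|t| = k] cancels [j <= k]
    letters, and for each fixed [j] the corresponding part of the convolution is
    a sum over the cancelled word [c] of products [f (a c) g (c^-1 b)], which has
    q-norm at most [|f|_q |g|_q] because [q <= 2]. Hence the q-norm of
    [(f^* f)^n] is at most [((k + 1) |f|_q)^(2 n)], while the coefficients
    [<pi (h) x, x>] of the dense subspace are bounded by a constant times
    [|h|_q]; the Cauchy-Schwarz inequality, iterated along the powers [2^n],
    turns the growth rate of these moments into a bound on [||pi (f) x||]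
    ([hnorm_rep_alg_growth]). A positive functional on the completion is bounded
    ([positive_functional_bounded]), since [1 - x^* x] has a square root there
    when [|x| < 1]. Testing it on [conj phi |phi|^(p - 2)] restricted to [W_k]
    gives [|phi chi_k|_p <= phi(1) (k + 1)] ([bounded_sphere_bound]).

    The growth condition implies the weighted summability by summation over
    spheres, and the exponentials [alpha^|s|] decay faster than the weights.

    For the way back, [alpha^|s|] is positive definite in the strong sense that
    [alpha^|s^-1 t|] is a Gram matrix, with coordinates indexed by the common
    prefixes of [s] and [t] ([radial_gram]); so [phi alpha^|s|] is positive
    definite. It lies in l_p by hypothesis, so the representation that it
    defines is an l_p-representation ([gns_D_representation]) and the functional
    of [phi alpha^|s|] is bounded by [phi(1)] times the l_p-norm. Letting
    [alpha] tend to [1] gives the same bound for [phi] ([radial_bounded]), and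
    bounded positive functionals extend to the completion
    ([completion_ext_exists]).

    The Hilbert space of a positive semidefinite form, needed for that
    representation, is realised as a space of functionals on which the group
    acts by translation ([limit_functional]). *)

Set Implicit Arguments.
Unset Strict Implicit.
Unset Printing Implicit Defensive.

Import Order.TTheory GRing.Theory Num.Theory.
Import numFieldNormedType.Exports.

Local Open Scope classical_set_scope.
Local Open Scope ring_scope.
Local Open Scope complex_scope.

(** * Limits of complex sequences *)

Section ComplexLimits.
Variable R : realType.
Local Notation C := R[i].
Local Notation nc := (@Normc.normc R).
Implicit Types (u v : nat -> C) (l m : C).

Lemma normc_ge0 (z : C) : 0 <= nc z.
Proof. by rewrite -ler0c normc_norm. Qed.

Lemma normcR (r : R) : nc r%:C = `|r|.
Proof.
by apply: (@complexI R); rewrite normc_norm normc_def /= expr0n addr0 sqrtr_sqr.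
Qed.

Lemma normcM (x y : C) : nc (x * y) = nc x * nc y.
Proof. exact: Normc.normcM. Qed.

Lemma ler_normcD (x y : C) : nc (x + y) <= nc x + nc y.
Proof. by rewrite -lecR rmorphD /= !normc_norm ler_normD. Qed.

Lemma ler_normc_sum (I : Type) (r : seq I) (z : I -> C) :
  nc (\sum_(i <- r) z i) <= \sum_(i <- r) nc (z i).
Proof.
elim: r => [|i r IH]; first by rewrite !big_nil Normc.normc0.
by rewrite !big_cons; apply: le_trans (ler_normcD _ _) _; rewrite lerD2l.
Qed.

Lemma normc_conj (x : C) : nc (Num.conj x) = nc x.
Proof. by apply: (@complexI R); rewrite !normc_norm norm_conjC. Qed.

Lemma normc_eq0 (x : C) : nc x = 0 -> x = 0.
Proof. by move=> x0; apply/normr0_eq0; rewrite -normc_norm x0. Qed.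

Lemma normcN (x : C) : nc (- x) = nc x.
Proof. by apply: (@complexI R); rewrite !normc_norm normrN. Qed.

Lemma ler_Re_normc (z : C) : `|complex.Re z| <= nc z.
Proof.
by case: z => a b /=; rewrite -sqrtr_sqr ler_wsqrtr // lerDl sqr_ge0.
Qed.

Lemma ler_Im_normc (z : C) : `|complex.Im z| <= nc z.
Proof.
by case: z => a b /=; rewrite -sqrtr_sqr ler_wsqrtr // lerDr sqr_ge0.
Qed.


Lemma ReB (x y : C) : complex.Re (x - y) = complex.Re x - complex.Re y.
Proof. by case: x; case: y. Qed.

Lemma ImB (x y : C) : complex.Im (x - y) = complex.Im x - complex.Im y.
Proof. by case: x; case: y. Qed.

Lemma normc1 : nc 1 = 1.
Proof. by rewrite -[1]/(1%:C) normcR normr1. Qed.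

Lemma mulr_conjc (z : C) : z * Num.conj z = (nc z ^+ 2)%:C.
Proof. by rewrite -normCK -normc_norm rmorphXn. Qed.

Definition cvgc u l := forall e : R, 0 < e ->
  exists N, forall n, (N <= n)%N -> nc (u n - l) < e.

Definition cauchyc u := forall e : R, 0 < e ->
  exists N, forall i j, (N <= i)%N -> (N <= j)%N -> nc (u i - u j) < e.

Lemma cvgc_unique u l m : cvgc u l -> cvgc u m -> l = m.
Proof.
move=> ul um; apply/eqP; rewrite -subr_eq0; apply/eqP/normc_eq0/eqP.
rewrite eq_le normc_ge0 andbT leNgt; apply/negP => lm.
have e0 : 0 < nc (l - m) / 2 by rewrite divr_gt0.
have [N uN] := ul _ e0; have [M uM] := um _ e0.
have := ler_normcD (l - u (maxn N M)) (u (maxn N M) - m).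
rewrite addrA subrK leNgt => /negP; apply; rewrite [ltRHS]splitr ltrD ?uM ?leq_maxr //.
by rewrite -normcN opprB uN ?leq_maxl.
Qed.

Lemma cvgc_cst l : cvgc (fun=> l) l.
Proof. by move=> e e0; exists 0%N => n _; rewrite subrr Normc.normc0. Qed.

Lemma cvgc_lin a u v l m : cvgc u l -> cvgc v m ->
  cvgc (fun n => a * u n + v n) (a * l + m).
Proof.
move=> ul vm e e0; have a1 : 0 < nc a + 1 by rewrite ltr_wpDl ?normc_ge0.
have [N uN] := ul (e / 2 / (nc a + 1)) ltac:(by rewrite !divr_gt0).
have [M vM] := vm (e / 2) ltac:(by rewrite divr_gt0).
exists (maxn N M) => n; rewrite geq_max => /andP[Nn Mn].
rewrite opprD addrACA -mulrBr; apply: le_lt_trans (ler_normcD _ _) _.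
rewrite [e]splitr ler_ltD ?vM // normcM.
have := ltW (uN n Nn); rewrite ler_pdivlMr // => /(le_trans _); apply.
by rewrite mulrC ler_wpM2l ?normc_ge0 // lerDl.
Qed.

Lemma cvgc_sub0 u v l : cvgc u l -> cvgc (fun n => v n - u n) 0 -> cvgc v l.
Proof.
move=> ul uv; have := cvgc_lin 1 uv ul.
rewrite mul1r add0r; congr cvgc; apply/funext => n.
by rewrite mul1r subrK.
Qed.

Lemma cvgc_conj u l : cvgc u l -> cvgc (fun n => Num.conj (u n)) (Num.conj l).
Proof.
move=> ul e /ul[N uN]; exists N => n /uN.
by rewrite -rmorphB normc_conj.
Qed.

Lemma cvgc_le u l (K : R) : cvgc u l ->
  (exists N, forall n, (N <= n)%N -> nc (u n) <= K) -> nc l <= K.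
Proof.
move=> ul [M uK]; rewrite leNgt; apply/negP => Kl.
have [N uN] := ul (nc l - K) ltac:(by rewrite subr_gt0).
have := uN _ (leq_maxl N M); have := uK _ (leq_maxr N M).
set z := u _ => zK; rewrite ltNge => /negP; apply.
rewrite lerBlDr -[nc (z - l)]normcN opprB.
have := ler_normcD (l - z) z; rewrite subrK => /le_trans; apply.
by rewrite lerD2l.
Qed.

Lemma cvgc_ge0 u l : cvgc u l -> (forall n, 0 <= u n) -> 0 <= l.
Proof.
move=> ul u0; have [N _] := ul 1 ltr01.
have reIm (z : C) (e : R) : nc z < e -> `|complex.Re z| < e /\ `|complex.Im z| < e.
  by move=> ze; split; apply: le_lt_trans ze; rewrite ?ler_Re_normc ?ler_Im_normc.
have uE n : complex.Im (u n) = 0 /\ 0 <= complex.Re (u n).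
  by move: (u0 n); rewrite lecE /= => /andP[/eqP -> ->].
rewrite lecE /=; apply/andP; split.
  rewrite -normr_eq0 eq_le normr_ge0 andbT leNgt; apply/negP => /ul[M uM].
  have := (reIm _ _ (uM M (leqnn _))).2.
  by rewrite ImB (uE M).1 sub0r normrN ltxx.
rewrite leNgt; apply/negP => l0.
have /ul[M uM] : 0 < - complex.Re l by rewrite oppr_gt0.
have := (reIm _ _ (uM M (leqnn _))).1.
rewrite ReB ger0_norm; last by rewrite subr_ge0 (le_trans (ltW l0)) ?(uE M).2.
by rewrite gtrDr ltNge (uE M).2.
Qed.

Lemma real_cauchy_cvg (x : nat -> R) :
  (forall e : R, 0 < e -> exists N, forall i j,
     (N <= i)%N -> (N <= j)%N -> `|x i - x j| < e) ->
  exists a, forall e : R, 0 < e -> exists N, forall n, (N <= n)%N -> `|x n - a| < e.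
Proof.
move=> uC; have : cvg (x @ \oo).
  apply/cauchy_cvgP/cauchy_exP => e /uC[N uN]; exists (x N); exists N => // n /= Nn.
  by rewrite /ball /= uN.
move=> /cvg_ex[l /cvgrPdist_lt ul]; exists l => e /ul[N _ uN].
by exists N => n /uN; rewrite distrC.
Qed.

Lemma cauchyc_cvg u : cauchyc u -> exists l, cvgc u l.
Proof.
move=> uC; have [|a ua] := @real_cauchy_cvg (fun n => complex.Re (u n)).
  move=> e /uC[N uN]; exists N => m n Nm Nn; apply: le_lt_trans (uN m n Nm Nn).
  by rewrite -ReB ler_Re_normc.
have [|b ub] := @real_cauchy_cvg (fun n => complex.Im (u n)).
  move=> e /uC[N uN]; exists N => m n Nm Nn; apply: le_lt_trans (uN m n Nm Nn).
  by rewrite -ImB ler_Im_normc.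
exists (a +i* b) => e e0; have e2 : 0 < e / 2 by rewrite divr_gt0.
have [N uN] := ua _ e2; have [M uM] := ub _ e2.
exists (maxn N M) => n; rewrite geq_max => /andP[Nn Mn].
rewrite [u n - _]complexE; apply: le_lt_trans (ler_normcD _ _) _.
rewrite normcM !normcR ReB ImB /= expr0n /= add0r expr1n sqrtr1 mul1r.
by rewrite [e]splitr ltrD ?uN ?uM.
Qed.

End ComplexLimits.

(** * Positive semidefinite sesquilinear forms *)

Section PositiveForms.
Variable R : realType.
Local Notation C := R[i].
Local Notation nc := (@Normc.normc R).

Record psd_form (V : lmodType C) := PsdForm {
  psd_fun :> V -> V -> C;
  psdDl : forall (a : C) x y z, psd_fun (a *: x + y) z = a * psd_fun x z + psd_fun y z;
  psdDr : forall (a : C) x y z,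
    psd_fun z (a *: x + y) = Num.conj a * psd_fun z x + psd_fun z y;
  psd_ge0 : forall x, 0 <= psd_fun x x }.

Variables (V : lmodType C) (B : psd_form V).
Implicit Types (x y z : V) (a : C) (u v w : nat -> V).

Lemma psd0l x : B 0 x = 0.
Proof. by have := psdDl B (-1) 0 0 x; rewrite scaler0 addr0 mulN1r addNr. Qed.

Lemma psd0r x : B x 0 = 0.
Proof. by have := psdDr B (-1) 0 0 x; rewrite scaler0 addr0 rmorphN1 mulN1r addNr. Qed.

Lemma psdBl x y z : B (x - y) z = B x z - B y z.
Proof. by rewrite addrC -scaleN1r psdDl mulN1r addrC. Qed.

Lemma psdBr x y z : B z (x - y) = B z x - B z y.
Proof. by rewrite addrC -scaleN1r psdDr rmorphN1 mulN1r addrC. Qed.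

Lemma psdZl a x y : B (a *: x) y = a * B x y.
Proof. by have := psdDl B a x 0 y; rewrite !addr0 psd0l addr0. Qed.

Lemma psdZr a x y : B x (a *: y) = Num.conj a * B x y.
Proof. by have := psdDr B a y 0 x; rewrite !addr0 psd0r addr0. Qed.

Lemma psd_quad a x y :
  B (a *: x + y) (a *: x + y) =
  (nc a ^+ 2)%:C * B x x + (a * B x y + Num.conj a * B y x) + B y y.
Proof.
rewrite psdDl !psdDr mulrDr mulrA mulr_conjc -!addrA.
by congr (_ + _); rewrite addrCA addrA.
Qed.

(** Positivity alone forces the symmetry: [B (a x + y) (a x + y)] is real for
    [a = 1], which gives the imaginary parts, and for [a = 'i], which gives the
    real parts. *)
Lemma psd_conj x y : B x y = Num.conj (B y x).
Proof.
have Im0 (t : C) : 0 <= t -> complex.Im t = 0.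
  by case: t => c d; rewrite lecE /= => /andP[/eqP].
have ImD (s t : C) : complex.Im (s + t) = complex.Im s + complex.Im t.
  by case: s; case: t.
have cross a : complex.Im (a * B x y + Num.conj a * B y x) = 0.
  have := Im0 _ (psd_ge0 B (a *: x + y)); rewrite psd_quad !ImD.
  rewrite (Im0 ((nc a ^+ 2)%:C * _)) ?mulr_ge0 ?psd_ge0 ?ler0c ?sqr_ge0 //.
  by rewrite (Im0 (B y y)) ?psd_ge0 // add0r addr0.
have := cross 1; have := cross 'i; rewrite !ImD.
case: (B x y) (B y x) => [c d] [c' d'] /=.
rewrite !mul0r !mul1r !mulN1r !addr0 !add0r oppr0 !mul0r !addr0.
by move=> /eqP; rewrite subr_eq0 => /eqP -> /eqP; rewrite addr_eq0 => /eqP ->.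
Qed.

Lemma psd_Re x : (complex.Re (B x x))%:C = B x x.
Proof. by rewrite RRe_real // ger0_real // psd_ge0. Qed.

Lemma psd_Re_ge0 x : 0 <= complex.Re (B x x).
Proof. by rewrite -ler0c psd_Re psd_ge0. Qed.

Definition psd_norm x : R := Num.sqrt (complex.Re (B x x)).
Local Notation Q := psd_norm.

Lemma psd_norm_ge0 x : 0 <= Q x.
Proof. exact: sqrtr_ge0. Qed.

Lemma psd_normE x : B x x = (Q x ^+ 2)%:C.
Proof. by rewrite sqr_sqrtr ?psd_Re ?psd_Re_ge0. Qed.

(** The quadratic polynomial [B (t z + y) (t z + y)] in the real variable [t],
    with [z] the multiple of [x] by [- conj (B x y)], is nonnegative. *)
Lemma psd_cauchy_schwarz x y : nc (B x y) <= Q x * Q y.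
Proof.
set b := B x y; set X := Q x ^+ 2; set Y := Q y ^+ 2.
have quad (t : R) : 0 <= t ^+ 2 * nc b ^+ 2 * X - 2 * t * nc b ^+ 2 + Y.
  rewrite -ler0c; set a : C := - (t%:C * Num.conj b).
  have := psd_ge0 B (a *: x + y); rewrite psd_quad !psd_normE -/X -/Y -/b.
  rewrite (psd_conj y x) -/b; congr (_ <= _).
  have -> : nc a ^+ 2 = t ^+ 2 * nc b ^+ 2.
    by rewrite normcN normcM normc_conj normcR exprMn real_normK // num_real.
  have tC : Num.conj t%:C = t%:C by rewrite conj_Creal // complex_real.
  have -> : a * b + Num.conj a * Num.conj b = - (2 * t * nc b ^+ 2)%:C.
    have -> : Num.conj a = - (t%:C * b).
      by rewrite [in LHS]rmorphN [in LHS]rmorphM /= tC conjCK.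
    rewrite /a !mulNr -opprD; congr (- _).
    have -> : t%:C * Num.conj b * b + t%:C * b * Num.conj b = 2 * t%:C * (b * Num.conj b).
      ring.
    by rewrite mulr_conjc [in RHS]rmorphM [in RHS]rmorphM /= rmorph_nat.
  by rewrite -[_ * X%:C]rmorphM -rmorphB -rmorphD.
rewrite -(@ler_pXn2r _ 2) ?nnegrE ?normc_ge0 ?mulr_ge0 ?psd_norm_ge0 //.
rewrite exprMn -/X -/Y.
have [b0|b0] := eqVneq (nc b ^+ 2) 0; first by rewrite b0 mulr_ge0 ?sqr_ge0.
have bgt : 0 < nc b ^+ 2 by rewrite lt_def b0 sqr_ge0.
have [X0|X0] := eqVneq X 0.
  (* the polynomial is then affine; this [t] makes it equal to [- Y - 2] *)
  have := quad ((Y + 1) / nc b ^+ 2).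
  rewrite X0 mulr0 add0r -[2 * _ * _]mulrA divfK //.
  rewrite mulrDr mulr1 opprD -addrA => h; suff : 0 < (0 : R) by rewrite ltxx.
  apply: (le_lt_trans h); have : 0 <= Y := sqr_ge0 _; lra.
have Xgt : 0 < X by rewrite lt_def X0 sqr_ge0.
(* the minimum of the polynomial *)
have := quad X^-1; have -> : X^-1 ^+ 2 * nc b ^+ 2 * X = nc b ^+ 2 / X.
  by field.
have -> : 2 * X^-1 * nc b ^+ 2 = nc b ^+ 2 / X + nc b ^+ 2 / X by field.
rewrite opprD addrA subrr sub0r addrC subr_ge0 ler_pdivrMr // mulrC; done.
Qed.

Lemma psd_normZ a x : Q (a *: x) = nc a * Q x.
Proof.
apply/eqP; rewrite -(@eqrXn2 _ 2) ?mulr_ge0 ?psd_norm_ge0 ?normc_ge0 //.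
rewrite exprMn; apply/eqP/(@complexI R); rewrite -psd_normE psdZl psdZr mulrA.
by rewrite mulr_conjc psd_normE -rmorphM.
Qed.

Lemma psd_normD x y : Q (x + y) <= Q x + Q y.
Proof.
rewrite -(@ler_pXn2r _ 2) ?nnegrE ?addr_ge0 ?psd_norm_ge0 //.
have -> : Q (x + y) ^+ 2 = Q x ^+ 2 + complex.Re (B x y + B y x) + Q y ^+ 2.
  have ReD (s t : C) : complex.Re (s + t) = complex.Re s + complex.Re t.
    by case: s; case: t.
  have RV z : Q z ^+ 2 = complex.Re (B z z) by rewrite psd_normE.
  by rewrite !RV -[x in LHS]scale1r psd_quad !ReD rmorph1 !mul1r normc1 expr1n mul1r.
rewrite sqrrD lerD2r lerD2l; apply: le_trans (ler_norm _) _.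
apply: le_trans (ler_Re_normc _) _; apply: le_trans (ler_normcD _ _) _.
rewrite mulr2n lerD ?psd_cauchy_schwarz //.
by rewrite mulrC psd_cauchy_schwarz.
Qed.

Lemma psd_normN x : Q (- x) = Q x.
Proof. by rewrite -scaleN1r psd_normZ normcN normc1 mul1r. Qed.

Lemma psd_norm_tri y x z : Q (x - z) <= Q (x - y) + Q (y - z).
Proof. by apply: le_trans (psd_normD _ _); rewrite addrA subrK. Qed.

End PositiveForms.

(** * The Hilbert space of a positive semidefinite form *)

Section HilbertCompletion.
Variables (R : realType) (V : lmodType R[i]) (B : psd_form V).
Local Notation C := R[i].
Local Notation nc := (@Normc.normc R).
Local Notation Q := (psd_norm B).
Implicit Types (x y z : V) (a : C) (u v w : nat -> V) (xi eta : V -> C).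

Definition psd_cauchy u := forall e : R, 0 < e ->
  exists N, forall i j, (N <= i)%N -> (N <= j)%N -> Q (u i - u j) < e.

Lemma psd_cauchy_cst x : psd_cauchy (fun=> x).
Proof.
move=> e e0; exists 0%N => i j _ _.
by rewrite subrr -(scale0r (0 : V)) psd_normZ Normc.normc0 mul0r.
Qed.

Lemma psd_cauchy_lin a u v : psd_cauchy u -> psd_cauchy v ->
  psd_cauchy (fun n => a *: u n + v n).
Proof.
move=> uC vC e e0; have a1 : 0 < nc a + 1 by rewrite ltr_wpDl ?normc_ge0.
have [N uN] := uC (e / 2 / (nc a + 1)) ltac:(by rewrite !divr_gt0).
have [M vM] := vC (e / 2) ltac:(by rewrite divr_gt0).
exists (maxn N M) => i j; rewrite !geq_max => /andP[Ni Mi] /andP[Nj Mj].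
rewrite opprD addrACA -scalerBr; apply: le_lt_trans (psd_normD _ _ _) _.
rewrite [e]splitr ler_ltD ?vM // psd_normZ.
have := ltW (uN i j Ni Nj); rewrite ler_pdivlMr // => /(le_trans _); apply.
by rewrite mulrC ler_wpM2l ?psd_norm_ge0 // lerDl.
Qed.

Lemma psd_cauchy_bounded u : psd_cauchy u ->
  exists2 K : R, 0 < K & exists N, forall n, (N <= n)%N -> Q (u n) <= K.
Proof.
move=> uC; have [N uN] := uC 1 ltr01.
exists (1 + Q (u N)); first by rewrite ltr_pwDl // psd_norm_ge0.
exists N => n Nn; rewrite -[u n](subrK (u N)).
by apply: le_trans (psd_normD _ _ _) _; rewrite lerD2r ltW // uN.
Qed.

Lemma psd_form_cauchy u v : psd_cauchy u -> psd_cauchy v ->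
  cauchyc (fun n => B (u n) (v n)).
Proof.
move=> uC vC e e0.
have [K K0 [N0 uK]] := psd_cauchy_bounded uC.
have [L L0 [M0 vL]] := psd_cauchy_bounded vC.
have [N uN] := uC (e / 2 / L) ltac:(by rewrite !divr_gt0).
have [M vM] := vC (e / 2 / K) ltac:(by rewrite !divr_gt0).
exists (maxn (maxn N0 M0) (maxn N M)) => i j.
rewrite !geq_max => /andP[/andP[N0i M0i] /andP[Ni Mi]].
move=> /andP[/andP[N0j M0j] /andP[Nj Mj]].
have -> : B (u i) (v i) - B (u j) (v j) = B (u i - u j) (v i) + B (u j) (v i - v j).
  by rewrite psdBl psdBr addrA subrK.
apply: le_lt_trans (ler_normcD _ _) _; rewrite [e]splitr ler_ltD //.
  apply: le_trans (psd_cauchy_schwarz _ _ _) _.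
  have := ltW (uN i j Ni Nj); rewrite ler_pdivlMr // => /(le_trans _); apply.
  by rewrite ler_wpM2l ?psd_norm_ge0 ?vL.
apply: le_lt_trans (psd_cauchy_schwarz _ _ _) _.
have := vM i j Mi Mj; rewrite ltr_pdivlMr // mulrC => /(le_lt_trans _); apply.
by rewrite ler_wpM2r ?psd_norm_ge0 ?uK.
Qed.

Definition represents u xi :=
  psd_cauchy u /\ forall x, cvgc (fun n => B (u n) x) (xi x).

Lemma represents_lin a u v xi eta : represents u xi -> represents v eta ->
  represents (fun n => a *: u n + v n) (fun x => a * xi x + eta x).
Proof.
move=> [uC uxi] [vC veta]; split=> [|x]; first exact: psd_cauchy_lin.
have := cvgc_lin a (uxi x) (veta x); congr cvgc; apply/funext => n.
by rewrite psdDl.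
Qed.

Lemma represents_ex u : psd_cauchy u -> exists xi, represents u xi.
Proof.
move=> uC; have /choice[xi xiP] x : exists l, cvgc (fun n => B (u n) x) l.
  by apply/cauchyc_cvg/psd_form_cauchy => //; apply: psd_cauchy_cst.
by exists xi.
Qed.

(** By the Cauchy property [B (u n) (u n)] differs little from [B (u n) (u N)]
    for a fixed large [N], and the latter tends to [0] with [n]. *)
Lemma represents0 u : represents u (fun=> 0) ->
  forall e : R, 0 < e -> exists N, forall n, (N <= n)%N -> Q (u n) < e.
Proof.
move=> [uC u0] e e0; have [K K0 [N0 uK]] := psd_cauchy_bounded uC.
have d0 : 0 < e ^+ 2 / 2 by rewrite divr_gt0 ?exprn_gt0.
have [N uN] := uC (e ^+ 2 / 2 / K) ltac:(by rewrite divr_gt0).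
have [M uM] := u0 (u N) _ d0.
exists (maxn N0 (maxn N M)) => n; rewrite !geq_max => /and3P[N0n Nn Mn].
rewrite -(@ltr_pXn2r _ 2) ?nnegrE ?psd_norm_ge0 ?ltW // -ltcR -psd_normE.
rewrite -(@ger0_norm _ (B _ _)) ?psd_ge0 // -normc_norm ltcR.
have -> : B (u n) (u n) = B (u n) (u N) + B (u n) (u n - u N).
  by rewrite psdBr addrC subrK.
apply: le_lt_trans (ler_normcD _ _) _; rewrite [ltRHS]splitr ltr_leD //.
  by have := uM n Mn; rewrite subr0.
apply: le_trans (psd_cauchy_schwarz _ _ _) _.
have := ltW (uN n N Nn (leqnn _)); rewrite ler_pdivlMr // mulrC => /(le_trans _); apply.
by rewrite ler_wpM2r ?psd_norm_ge0 ?uK.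
Qed.

(** A vector of the completion is identified with the functional
    [x |-> <xi, x>] on [V]. Functionals need no quotient by the null vectors of
    [B], and their linear structure is the pointwise one. *)
Definition limit_functional : {pred V -> C} :=
  fun xi => `[< exists u, represents u xi >].

Lemma limit_functional_submod : submod_closed limit_functional.
Proof.
split=> [|a xi eta /asboolP[u uxi] /asboolP[v veta]]; apply/asboolP.
  exists (fun=> 0); split=> [|x]; first exact: psd_cauchy_cst.
  by under eq_fun do rewrite psd0l; apply: cvgc_cst.
by eexists; apply: (represents_lin a uxi veta).
Qed.

HB.instance Definition _ := GRing.isSubmodClosed.Build C (V -> C) limit_functional
  (GRing.submod_closed_semi limit_functional_submod).

Record hilbert_completion := HilbertCompletion {
  hc_val :> V -> C;
  hc_valP : hc_val \in limit_functional }.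

HB.instance Definition _ := [isSub for hc_val].
HB.instance Definition _ := [Choice of hilbert_completion by <:].
HB.instance Definition _ := [SubChoice_isSubLmodule of hilbert_completion by <:].

Local Notation H := hilbert_completion.
Implicit Types (f g h : H).

Lemma hcP f g : (forall x, f x = g x) -> f = g.
Proof. by move=> fg; apply/val_inj/funext. Qed.

Lemma hc_linE a f g x : (a *: f + g) x = a * f x + g x.
Proof. by []. Qed.

Lemma hc_seqP f : exists u, represents u f.
Proof. exact/asboolP/(hc_valP f). Qed.

Definition hc_seq f : nat -> V := projT1 (cid (hc_seqP f)).

Lemma hc_seq_repr f : represents (hc_seq f) f.
Proof. exact: projT2 (cid (hc_seqP f)). Qed.

Lemma hc_form_ex f g : exists l, cvgc (fun n => B (hc_seq f n) (hc_seq g n)) l.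
Proof. by apply/cauchyc_cvg/psd_form_cauchy; apply: (hc_seq_repr _).1. Qed.

Definition hc_dot f g : C := projT1 (cid (hc_form_ex f g)).

Lemma represents_sub u v xi : represents u xi -> represents v xi ->
  forall e : R, 0 < e -> exists N, forall n, (N <= n)%N -> Q (u n - v n) < e.
Proof.
move=> uxi vxi; apply: represents0.
have := represents_lin (-1) vxi uxi; congr represents; apply/funext => n.
  by rewrite scaleN1r addrC.
by rewrite mulN1r addNr.
Qed.

Lemma hc_dot_cvg f g u v : represents u f -> represents v g ->
  cvgc (fun n => B (u n) (v n)) (hc_dot f g).
Proof.
move=> uf vg; have fg := projT2 (cid (hc_form_ex f g)).
apply: (cvgc_sub0 fg) => e e0.
set u' := hc_seq f; set v' := hc_seq g.
have uf' : represents u' f := hc_seq_repr f.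
have vg' : represents v' g := hc_seq_repr g.
have [K K0 [N0 uK]] := psd_cauchy_bounded uf'.1.
have [L L0 [M0 vL]] := psd_cauchy_bounded vg.1.
have [N uN] := represents_sub uf uf' (e := e / 2 / L) ltac:(by rewrite !divr_gt0).
have [M vM] := represents_sub vg vg' (e := e / 2 / K) ltac:(by rewrite !divr_gt0).
exists (maxn (maxn N0 M0) (maxn N M)) => n.
rewrite !geq_max => /andP[/andP[N0n M0n] /andP[Nn Mn]]; rewrite subr0.
have -> : B (u n) (v n) - B (u' n) (v' n) = B (u n - u' n) (v n) + B (u' n) (v n - v' n).
  by rewrite psdBl psdBr addrA subrK.
apply: le_lt_trans (ler_normcD _ _) _; rewrite [e]splitr ler_ltD //.
  apply: le_trans (psd_cauchy_schwarz _ _ _) _.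
  have := ltW (uN n Nn); rewrite ler_pdivlMr // => /(le_trans _); apply.
  by rewrite ler_wpM2l ?psd_norm_ge0 ?vL.
apply: le_lt_trans (psd_cauchy_schwarz _ _ _) _.
have := vM n Mn; rewrite ltr_pdivlMr // mulrC => /(le_lt_trans _); apply.
by rewrite ler_wpM2r ?psd_norm_ge0 ?uK.
Qed.

Lemma hc_dotDl a f g h : hc_dot (a *: f + g) h = a * hc_dot f h + hc_dot g h.
Proof.
have [[ru rv] rw] := (hc_seq_repr f, hc_seq_repr g, hc_seq_repr h).
have ruv : represents _ (hc_val (a *: f + g)) := represents_lin a ru rv.
apply: (cvgc_unique (hc_dot_cvg ruv rw)).
under eq_fun do rewrite psdDl.
by apply: cvgc_lin; apply: hc_dot_cvg.
Qed.

Lemma hc_dot_conj f g : hc_dot f g = Num.conj (hc_dot g f).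
Proof.
have [ru rv] := (hc_seq_repr f, hc_seq_repr g).
apply: (cvgc_unique (hc_dot_cvg ru rv)).
under eq_fun do rewrite psd_conj.
by apply/cvgc_conj/hc_dot_cvg.
Qed.

Lemma hc_dotDr a f g h :
  hc_dot h (a *: f + g) = Num.conj a * hc_dot h f + hc_dot h g.
Proof.
rewrite (hc_dot_conj h (_ + _)) (hc_dot_conj h f) (hc_dot_conj h g) hc_dotDl.
by rewrite [LHS]rmorphD [in LHS]rmorphM.
Qed.

Lemma hc_dot_ge0 f : 0 <= hc_dot f f.
Proof.
have r := hc_seq_repr f.
by apply: (cvgc_ge0 (hc_dot_cvg r r)) => n; apply: psd_ge0.
Qed.

Definition hc_psd : psd_form H := PsdForm hc_dotDl hc_dotDr hc_dot_ge0.

Lemma hc_incl_subproof x : (fun y => B x y) \in limit_functional.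
Proof.
apply/asboolP; exists (fun=> x).
by split=> [|y]; [apply: psd_cauchy_cst | apply: cvgc_cst].
Qed.

Definition hc_incl x : H := HilbertCompletion (hc_incl_subproof x).

Lemma hc_incl_repr x : represents (fun=> x) (hc_incl x).
Proof. by split=> [|y]; [apply: psd_cauchy_cst | apply: cvgc_cst]. Qed.

Lemma hc_incl_linear a x y : hc_incl (a *: x + y) = a *: hc_incl x + hc_incl y.
Proof. by apply: hcP => z; rewrite hc_linE /= psdDl. Qed.

Lemma hc_incl0 : hc_incl 0 = 0.
Proof. by apply: hcP => x; rewrite [LHS]psd0l. Qed.

Lemma hc_dot_inclr f x : hc_dot f (hc_incl x) = f x.
Proof.
have r := hc_seq_repr f.
exact: (cvgc_unique (hc_dot_cvg r (hc_incl_repr x)) (r.2 x)).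
Qed.

Lemma hc_dot_incl x y : hc_dot (hc_incl x) (hc_incl y) = B x y.
Proof. by rewrite hc_dot_inclr. Qed.

Local Notation N := (psd_norm hc_psd).

Lemma hc_norm_incl x : N (hc_incl x) = Q x.
Proof. by rewrite /psd_norm /= hc_dot_incl. Qed.

Lemma hc_norm_eq0 f : N f = 0 -> f = 0.
Proof.
move=> f0; apply: hcP => x; apply: normc_eq0; apply/eqP.
rewrite eq_le normc_ge0 andbT -hc_dot_inclr.
by have := psd_cauchy_schwarz hc_psd f (hc_incl x); rewrite f0 mul0r.
Qed.

Lemma hc_norm_lim f u (e : R) : represents u f -> 0 <= e ->
  forall x, (exists M, forall n, (M <= n)%N -> Q (u n - x) <= e) ->
  N (f - hc_incl x) <= e.
Proof.
move=> uf e0 x [M uM]; rewrite -(@ler_pXn2r _ 2) ?nnegrE ?psd_norm_ge0 //.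
have := represents_lin (-1) (hc_incl_repr x) uf.
set w := fun n => _; rewrite -[fun y => _]/(hc_val (-1 *: hc_incl x + f)) => wf.
have -> : f - hc_incl x = -1 *: hc_incl x + f by rewrite scaleN1r addrC.
have := psd_ge0 hc_psd (-1 *: hc_incl x + f); rewrite psd_normE => h0.
rewrite -lecR -(ger0_norm h0) -psd_normE -normc_norm lecR.
apply: (cvgc_le (hc_dot_cvg wf wf)); exists M => n Mn.
rewrite psd_normE normcR ger0_norm ?sqr_ge0 // ler_pXn2r ?nnegrE ?psd_norm_ge0 //.
by rewrite /w scaleN1r addrC uM.
Qed.

Lemma hc_incl_dense f (e : R) : 0 < e -> exists x, N (f - hc_incl x) < e.
Proof.
move=> e0; have r := hc_seq_repr f.
have [M uM] := r.1 (e / 2) ltac:(by rewrite divr_gt0).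
exists (hc_seq f M); apply: (@le_lt_trans _ _ (e / 2)); last first.
  by rewrite ltr_pdivrMr // ltr_pMr // ltr1n.
apply: (hc_norm_lim r); first by rewrite ltW ?divr_gt0.
by exists M => n Mn; rewrite ltW // uM.
Qed.

Lemma hc_normD f g : (N (f + g))%:C <= (N f)%:C + (N g)%:C.
Proof. by rewrite -rmorphD lecR psd_normD. Qed.

Lemma hc_normZ a f : (N (a *: f))%:C = `|a| * (N f)%:C.
Proof. by rewrite psd_normZ rmorphM. Qed.

Lemma hc_norm_eq0C f : (N f)%:C = 0 -> f = 0.
Proof. by move=> /(@complexI R _ 0)/hc_norm_eq0. Qed.

HB.instance Definition _ := @Lmodule_isNormed.Build C H
  (fun f => (N f)%:C) hc_normD hc_normZ hc_norm_eq0C.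

Lemma hc_normE f : `|f| = (N f)%:C.
Proof. by []. Qed.

Lemma hc_ballE f g (e : R) : ball f e%:C g = (N (f - g) < e) :> Prop.
Proof. by rewrite -ball_normE /ball_ /= hc_normE ltcR. Qed.

Lemma hc_incl_range_dense : dense (range hc_incl).
Proof.
move=> O [f Of] Oo; have /nbhs_ballP[e /= e0 eO] : nbhs f O.
  by apply: open_nbhs_nbhs.
have [er eE] : exists er, e = er%:C by exists (complex.Re e); rewrite RRe_real // gtr0_real.
move: e0; rewrite eE ltcR => /(hc_incl_dense f)[x xf].
by exists (hc_incl x); split; [apply: eO; rewrite eE hc_ballE | exists x].
Qed.

(** Each ball of radius [2^-1 / (n + 1)] in the filter can be recentred at a
    vector of [V]; these centres form a Cauchy sequence for [B], whose limit
    functional is the limit of the filter. *)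
Lemma hc_complete (F : set_system H) : ProperFilter F -> cauchy F -> cvg F.
Proof.
move=> FF /cauchyP Fc.
have d0 n : 0 < n.+1%:R^-1 :> R by rewrite invr_gt0.
have /choice[x xF] n : exists x : V, F (ball (hc_incl x) (n.+1%:R^-1)%:C).
  have [|f Ff] := Fc ((n.+1%:R^-1 / 2)%:C); first by rewrite ltcR divr_gt0.
  have [x fx] := hc_incl_dense f (e := n.+1%:R^-1 / 2) ltac:(by rewrite divr_gt0).
  exists x; apply: filterS Ff => g; rewrite !hc_ballE => fg.
  apply: (le_lt_trans (psd_norm_tri hc_psd f _ _)).
  rewrite [ltRHS]splitr ltrD // -psd_normN opprB //.
have small (e : R) : 0 < e -> exists M, forall n, (M <= n)%N -> n.+1%:R^-1 < e.
  move=> e0; exists (Num.truncn e^-1) => n Mn; rewrite invf_plt ?posrE //.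
  apply: lt_le_trans (truncnS_gt _) _; by rewrite ler_nat.
have xC : psd_cauchy x.
  move=> e e0; have [M uM] := small (e / 2) ltac:(by rewrite divr_gt0).
  exists M => i j Mi Mj; rewrite -hc_norm_incl.
  have -> : hc_incl (x i - x j) = hc_incl (x i) - hc_incl (x j).
    by rewrite addrC -scaleN1r hc_incl_linear scaleN1r addrC.
  have [g] := filter_ex (filterI (xF i) (xF j)); rewrite /= !hc_ballE => -[ig jg].
  apply: (le_lt_trans (psd_norm_tri hc_psd g _ _)).
  rewrite [e]splitr ltrD //; first exact: lt_trans ig (uM i Mi).
  by rewrite -psd_normN opprB; apply: lt_trans jg (uM j Mj).
have [xi xxi] := represents_ex xC.
have xiP : xi \in limit_functional by apply/asboolP; exists x.
pose f : H := HilbertCompletion xiP.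
apply/cvg_ex; exists f; apply/cvg_ballP => e e0.
have [er eE] : exists er, e = er%:C by exists (complex.Re e); rewrite RRe_real // gtr0_real.
move: e0; rewrite eE ltcR => e0; have e3 : 0 < er / 2 / 2 by rewrite !divr_gt0.
have [M uM] := small _ e3; have [L xL] := xC _ e3.
have := xF (maxn M L); apply: filterS => g; rewrite !hc_ballE => xg.
apply: (le_lt_trans (psd_norm_tri hc_psd (hc_incl (x (maxn M L))) _ _)).
rewrite [er]splitr ler_ltD //.
  have rf : represents x f := xxi.
  apply: (hc_norm_lim rf); first by rewrite ltW ?divr_gt0.
  exists L => n Ln; apply/ltW/(lt_trans (xL _ _ Ln (leq_maxr _ _))).
  by rewrite ltr_pdivrMr // ltr_pMr ?divr_gt0 // ltr1n.
apply: lt_trans xg _; apply: (lt_trans (uM _ (leq_maxl _ _))).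
by rewrite ltr_pdivrMr // ltr_pMr ?divr_gt0 // ltr1n.
Qed.

HB.instance Definition _ := Uniform_isComplete.Build H hc_complete.

Lemma hc_dot_bilinear :
  bilinear_for (GRing.Scale.Law.clone _ _ ( *%R ) _)
    (GRing.Scale.Law.clone _ _ (@Num.conj C \; *%R) _) hc_dot.
Proof. by split=> f a g h /=; rewrite ?hc_dotDl ?hc_dotDr. Qed.

HB.instance Definition _ := bilinear_isBilinear.Build C H H C _ _ hc_dot hc_dot_bilinear.

Lemma hc_dot_hermitian f g : hc_dot f g = (-1) ^+ false * Num.conj (hc_dot g f).
Proof. by rewrite expr0 mul1r hc_dot_conj. Qed.

HB.instance Definition _ :=
  isHermitianSesquilinear.Build C H false (@Num.conj C) hc_dot hc_dot_hermitian.

Lemma hc_dot_gt0 f : f != 0 -> 0 < hc_dot f f.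
Proof.
move=> f0; rewrite lt_def hc_dot_ge0 andbT; apply: contra f0 => /eqP f0.
by apply/eqP/hc_norm_eq0; rewrite /psd_norm /= f0 sqrtr0.
Qed.

HB.instance Definition _ := isDotProduct.Build C H hc_dot hc_dot_gt0.

Lemma hc_dot_norm f : hc_dot f f = `|f| ^+ 2.
Proof. by rewrite hc_normE -rmorphXn; exact: (psd_normE hc_psd f). Qed.

Definition hc_hilbert : hilbert_space R := @HilbertSpace R H hc_dot hc_dot_norm.

End HilbertCompletion.

(** * Families with bounded finite sums *)

Section SumsOverFamilies.
Variable R : realType.

(** For nonnegative [F] this says that the series of [F] converges with sum at
    most [K]; in this form no summability has to be proved along the way. *)
Definition sums_le (T : eqType) (F : T -> R) (K : R) :=
  forall r : seq T, uniq r -> \sum_(s <- r) F s <= K.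

Lemma sums_le_leF (T : eqType) (F E : T -> R) K :
  (forall s, E s <= F s) -> sums_le F K -> sums_le E K.
Proof. by move=> EF FK r /FK; apply: le_trans; apply: ler_sum. Qed.

Lemma sums_le_inj (T U : eqType) (h : U -> T) (F : T -> R) K :
  injective h -> sums_le F K -> sums_le (F \o h) K.
Proof.
move=> hI FK r ur; rewrite -(big_map h xpredT F).
by apply: FK; rewrite map_inj_uniq.
Qed.

Lemma sums_leZ (T : eqType) (F : T -> R) c K : 0 <= c ->
  sums_le F K -> sums_le (fun s => c * F s) (c * K).
Proof. by move=> c0 FK r ur; rewrite -mulr_sumr ler_wpM2l ?FK. Qed.

Lemma sums_le_lin (T : eqType) (F E : T -> R) c K L : 0 <= c ->
  sums_le F K -> sums_le E L -> sums_le (fun s => c * F s + E s) (c * K + L).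
Proof.
move=> c0 FK EL r ur; rewrite big_split -mulr_sumr.
by rewrite lerD ?ler_wpM2l ?FK ?EL.
Qed.

Lemma ler_sum_uniq (T : eqType) (F : T -> R) (r1 r2 : seq T) :
  (forall x, 0 <= F x) -> uniq r1 -> uniq r2 -> {subset r1 <= r2} ->
  \sum_(x <- r1) F x <= \sum_(x <- r2) F x.
Proof.
move=> F0 u1 u2 r12; rewrite (perm_big [seq x <- r2 | x \in r1]) /=.
  by rewrite big_filter big_mkcond ler_sum // => x _; case: ifP.
apply: uniq_perm => // [|x]; first exact: filter_uniq.
by rewrite mem_filter; case: (boolP (x \in r1)) => // /r12 ->.
Qed.

Lemma sums_le_fibre (T U : eqType) (I : finType) (h : T -> I -> U) (F : U -> R) K :
  (forall t t' i i', h t i = h t' i' -> t = t' /\ i = i') ->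
  sums_le F K -> sums_le (fun t => \sum_i F (h t i)) K.
Proof.
move=> hI FK r ur; have := FK [seq h t i | t <- r, i <- enum I].
rewrite big_allpairs_dep => h1; apply: le_trans (h1 _).
  by apply: ler_sum => t _; rewrite big_enum.
by apply: allpairs_uniq; rewrite ?enum_uniq // => -[t i] [t' i'] _ _ /= /hI[-> ->].
Qed.

Lemma sums_le_prod (T U V : eqType) (h1 : T -> U) (h2 : T -> V)
    (F : U -> R) (E : V -> R) K L :
  (forall s t, h1 s = h1 t -> h2 s = h2 t -> s = t) ->
  (forall x, 0 <= F x) -> (forall y, 0 <= E y) ->
  sums_le F K -> sums_le E L -> sums_le (fun s => F (h1 s) * E (h2 s)) (K * L).
Proof.
move=> hI F0 E0 FK EL r ur.
set r1 := undup (map h1 r); set r2 := undup (map h2 r).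
apply: (@le_trans _ _ (\sum_(x <- r1) \sum_(y <- r2) F x * E y)).
  have <- : \sum_(z <- [seq (x, y) | x <- r1, y <- r2]) F z.1 * E z.2 =
      \sum_(x <- r1) \sum_(y <- r2) F x * E y by rewrite big_allpairs.
  rewrite -(big_map (fun s => (h1 s, h2 s)) xpredT (fun z => F z.1 * E z.2)).
  apply: ler_sum_uniq => [z|||z].
  - by rewrite mulr_ge0.
  - by rewrite map_inj_uniq // => s t [] /hI h /h.
  - by apply: allpairs_uniq; rewrite ?undup_uniq // => -[a b] [a' b'].
  - move=> /mapP[s sr ->]; apply: allpairs_f; rewrite mem_undup; exact: map_f.
under eq_bigr do rewrite -mulr_sumr; rewrite -mulr_suml.
apply: ler_pM; rewrite ?sumr_ge0 //; first exact: (FK _ (undup_uniq _)).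
exact: (EL _ (undup_uniq _)).
Qed.

Lemma sums_le_sum (T : eqType) (n : nat) (F : 'I_n -> T -> R) (K : 'I_n -> R) :
  (forall i, sums_le (F i) (K i)) -> sums_le (fun t => \sum_i F i t) (\sum_i K i).
Proof.
by move=> FK r ur; rewrite exchange_big; apply: ler_sum => i _; apply: FK.
Qed.

End SumsOverFamilies.

(** * The spaces l_p of a group *)

Section BoundedSums.
Variable R : realType.

Lemma esum_leP (T : choiceType) (F : T -> R) K :
  (\esum_(s in [set: T]) (F s)%:E <= K%:E)%E <-> sums_le F K.
Proof.
split=> [/ereal_supP FK r ur|FK].
  rewrite -lee_fin -sumEFin fsbig_seq //; apply: FK.
  by exists [set` r] => //; split=> //; apply: finite_seq.
apply: ge_ereal_sup => _ [A [fA _] <-].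
by rewrite fsbig_finite // sumEFin lee_fin FK // fset_uniq.
Qed.

Variables (G : groupType) (p : R).
Hypothesis p0 : 0 < p.
Local Notation C := R[i].
Local Notation nc := (@Normc.normc R).
Implicit Types f g : G -> C.

Lemma lpnorm_leP f K : 0 <= K ->
  (lpnorm p f <= K%:E)%E <-> sums_le (fun s => nc (f s) `^ p) (K `^ p).
Proof.
move=> K0; rewrite -esum_leP /lpnorm; set E := (\esum_(s in _) _)%E.
have E0 : (0 <= E)%E by apply: esum_ge0 => s _; rewrite lee_fin powR_ge0.
have in0y (x : \bar R) : (0 <= x)%E -> x \in `[0%E, +oo%E].
  by move=> x0; rewrite in_itv /= x0 leey.
have pV : p^-1 * p = 1 by rewrite mulVf ?gt_eqF.
have pV0 : 0 <= p^-1 by rewrite invr_ge0 ltW.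
have KE : ((K `^ p)%:E `^ p^-1)%E = K%:E.
  by rewrite poweR_EFin -powRrM mulfV ?gt_eqF // powRr1.
split=> [EK|EK].
  have := gt0_ler_poweR (ltW p0) (in0y _ (poweR_ge0 E p^-1)) _ EK.
  rewrite -poweRrM pV poweRe1 // poweR_EFin; apply.
  by rewrite in0y ?lee_fin.
by rewrite -KE; apply: gt0_ler_poweR; rewrite ?in0y ?lee_fin ?powR_ge0 ?(ltW p0).
Qed.

Lemma lpP f : lp p f <-> exists K, sums_le (fun s => nc (f s) `^ p) K.
Proof.
rewrite /lp /=; split=> [fp|[K fK]].
  have h : (lpnorm p f <= (fine (lpnorm p f))%:E)%E.
    by rewrite fineK // ge0_fin_numE // poweR_ge0.
  exists (fine (lpnorm p f) `^ p); apply/lpnorm_leP => //.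
  by rewrite fine_ge0 // poweR_ge0.
apply: poweR_lty; apply: le_lt_trans (ltry K).
exact/esum_leP.
Qed.

Lemma powRD_le (a b : R) : 0 <= a -> 0 <= b ->
  (a + b) `^ p <= 2 `^ p * (a `^ p + b `^ p).
Proof.
move=> a0 b0; wlog ab : a b a0 b0 / a <= b => [hw|].
  by case/orP: (le_total a b) => ab; [|rewrite addrC [X in _ * X]addrC]; apply: hw.
apply: (@le_trans _ _ ((2 * b) `^ p)).
  rewrite ge0_ler_powR ?nnegrE ?addr_ge0 ?mulr_ge0 ?(ltW p0) //.
  by rewrite mulr_natl mulr2n lerD2r.
by rewrite powRM // ler_wpM2l ?powR_ge0 // lerDr powR_ge0.
Qed.

Lemma lp_lin (a : C) f g : lp p f -> lp p g -> lp p (fun s => a * f s + g s).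
Proof.
move=> /lpP[K fK] /lpP[L gL]; apply/lpP.
exists (2 `^ p * nc a `^ p * K + 2 `^ p * L).
have gL' := sums_leZ (powR_ge0 2 p) gL.
have := sums_le_lin (mulr_ge0 (powR_ge0 2 p) (powR_ge0 (nc a) p)) fK gL'.
apply: sums_le_leF => s; rewrite -mulrA -mulrDr -powRM ?normc_ge0 // -normcM.
apply: le_trans (powRD_le (normc_ge0 _) (normc_ge0 _)).
by rewrite ge0_ler_powR ?nnegrE ?addr_ge0 ?normc_ge0 ?(ltW p0) ?ler_normcD.
Qed.

Lemma lp0 : lp p (fun _ : G => 0 : C).
Proof.
by apply/lpP; exists 0 => r _; rewrite big1 // => s _; rewrite Normc.normc0 powR0 ?gt_eqF.
Qed.

Lemma lp_inj (h : G -> G) f : injective h -> lp p f -> lp p (f \o h).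
Proof. by move=> hI /lpP[K /(sums_le_inj hI) fK]; apply/lpP; exists K. Qed.

End BoundedSums.

(** * The representation defined by a positive definite function *)

Section GNS.
Variables (R : realType) (G : groupType).
Local Notation C := R[i].
Local Notation nc := (@Normc.normc R).
Local Notation A := (group_algebra R G).
Implicit Types (f g : A) (s t : G).

Lemma omega_funE (psi : G -> C) f : omega_fun psi f = gsum f (psi : G -> C^o).
Proof. by []. Qed.

Lemma omega_lin (psi : G -> C) (a : C) f g :
  omega_fun psi (a *: f + g) = a * omega_fun psi f + omega_fun psi g.
Proof. by rewrite !omega_funE gsum_linear. Qed.

Lemma omega_delta (psi : G -> C) s : omega_fun psi (delta R s) = psi s.
Proof. by rewrite omega_funE gsum_delta. Qed.

Lemma gsum_starE (V : lmodType C) (E : {fset G}) f (F : G -> V) :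
  [set s | f s != 0] `<=` [set` E] ->
  gsum (ga_star f) F = \sum_(s <- E) Num.conj (f s) *: F (s^-1)%g.
Proof.
move=> fE; rewrite (@gsumE _ _ _ ([fset (x^-1)%g | x in E])%fset).
  rewrite big_imfset /=; last by move=> x y _ _; apply: invg_inj.
  by apply: eq_bigr => s _; rewrite invgK.
move=> s; rewrite /mkset ga_starE conjC_eq0 => /fE /= sE.
by apply/imfsetP; exists (s^-1)%g => //; rewrite invgK.
Qed.

Variable psi : G -> C.
Hypothesis psi_pd : positive_definite psi.

Lemma omega_star_ge0 f : 0 <= omega_fun psi (ga_star f * f).
Proof.
rewrite omega_funE gsum_conv; have [E fE] := gsum_supp f.
rewrite (gsum_starE _ fE).
under eq_bigr do rewrite (gsumE _ fE) scaler_sumr.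
rewrite big_tnth; under eq_bigr do rewrite big_tnth.
have := psi_pd (fun i => tnth (in_tuple E) i) (fun i => f (tnth (in_tuple E) i)).
congr (_ <= _); apply: eq_bigr => i _; apply: eq_bigr => j _.
by rewrite scalerA.
Qed.

(** The completion of this form is a space of functionals on the group
    algebra, on which the group acts by translation. *)
Definition gns_form : psd_form A.
Proof.
apply: (@PsdForm _ _ (fun f g => omega_fun psi (ga_star g * f))).
- by move=> a f g h; rewrite mulrDr -scalerAr omega_lin.
- by move=> a f g h; rewrite ga_star_semilinear mulrDl -scalerAl omega_lin.
- exact: omega_star_ge0.
Defined.

Lemma gns_formE f g : gns_form f g = omega_fun psi (ga_star g * f).
Proof. by []. Qed.

Lemma gns_translate s f g : gns_form (delta R s * f) g = gns_form f (delta R (s^-1)%g * g).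
Proof. by rewrite !gns_formE ga_starM ga_star_delta invgK mulrA. Qed.

Lemma delta1 : delta R (1 : G)%g = 1. Proof. by []. Qed.

Lemma deltaM s t : delta R (s * t)%g = delta R s * delta R t.
Proof. by rewrite [RHS]conv_delta. Qed.

Lemma gns_norm_translate s f :
  psd_norm gns_form (delta R s * f) = psd_norm gns_form f.
Proof. by rewrite /psd_norm gns_translate mulrA -deltaM mulVg delta1 mul1r. Qed.

Lemma gns_represents s u (xi : A -> C) : represents gns_form u xi ->
  represents gns_form (fun n => delta R s * u n) (fun x => xi (delta R (s^-1)%g * x)).
Proof.
move=> [uC uxi]; split=> [e /uC[N uN]|x].
  by exists N => i j Ni Nj; rewrite -mulrBr gns_norm_translate uN.
have := uxi (delta R (s^-1)%g * x); congr cvgc; apply/funext => n.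
by rewrite gns_translate.
Qed.

Local Notation H := (hc_hilbert gns_form).

Lemma gns_act_subproof s (xi : H) :
  (fun x => hc_val xi (delta R (s^-1)%g * x)) \in limit_functional gns_form.
Proof.
by apply/asboolP; have [u /(gns_represents s) ?] := hc_seqP xi; eexists; eassumption.
Qed.

Definition gns_act s (xi : H) : H := HilbertCompletion (gns_act_subproof s xi).

Lemma gns_act_linear s (a : C) (xi eta : H) :
  gns_act s (a *: xi + eta) = a *: gns_act s xi + gns_act s eta.
Proof. by apply: hcP. Qed.

HB.instance Definition _ s := GRing.isLinear.Build C H H *:%R (gns_act s) (gns_act_linear s).

Lemma gns_act1 (xi : H) : gns_act 1%g xi = xi.
Proof. by apply: hcP => x /=; rewrite invg1 delta1 mul1r. Qed.

Lemma gns_actM s t (xi : H) : gns_act (s * t)%g xi = gns_act s (gns_act t xi).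
Proof. by apply: hcP => x /=; rewrite invgM deltaM mulrA. Qed.

Lemma gns_act_unitary s (xi eta : H) :
  inner H (gns_act s xi) (gns_act s eta) = inner H xi eta.
Proof.
have [[u uxi] [v veta]] := (hc_seqP xi, hc_seqP eta).
have suxi : represents gns_form _ (gns_act s xi) := gns_represents s uxi.
have sveta : represents gns_form _ (gns_act s eta) := gns_represents s veta.
apply: (cvgc_unique (hc_dot_cvg suxi sveta)).
under eq_fun do rewrite gns_translate mulrA -deltaM mulVg delta1 mul1r.
exact: hc_dot_cvg.
Qed.

Definition gns_rep : unitary_rep G H :=
  UnitaryRep (rep_fun := fun s => gns_act s) gns_act1 gns_actM gns_act_unitary.

Definition gns_vec (f : A) : H := hc_incl gns_form f.

Lemma gns_act_vec s f : gns_act s (gns_vec f) = gns_vec (delta R s * f).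
Proof. by apply: hcP => x; rewrite -[RHS]/(gns_form (delta R s * f) x) gns_translate. Qed.

Lemma gns_alg_vec f g : rep_alg gns_rep f (gns_vec g) = gns_vec (f * g).
Proof.
elim/ga_ind: f => [s||a f h IH IH'].
- by rewrite rep_algE gsum_delta /= gns_act_vec.
- by rewrite rep_algE gsum0 mul0r /gns_vec hc_incl0.
- by rewrite rep_alg_semi IH IH' mulrDl -scalerAl /gns_vec hc_incl_linear.
Qed.

Lemma gns_coef s f g :
  rep_coef gns_rep (gns_vec f) (gns_vec g) s = omega_fun psi (ga_star g * (delta R s * f)).
Proof. by rewrite /rep_coef /= gns_act_vec; apply: hc_dot_incl. Qed.

(** The coefficients of vectors of the group algebra are finite linear
    combinations of two-sided translates of [psi]. *)
Lemma gns_lp_coef (p : R) f g : 0 < p -> lp p psi ->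
  lp p (rep_coef gns_rep (gns_vec f) (gns_vec g)).
Proof.
move=> p0 psip; rewrite (funext (fun s => gns_coef s f g)).
elim/ga_ind: f => [b||a f h IH IH']; last first.
- under eq_fun do rewrite mulrDr mulrDr -!scalerAr omega_lin.
  exact: (lp_lin p0 a IH IH').
- under eq_fun do rewrite !mulr0 omega_funE gsum0.
  exact: lp0.
elim/ga_ind: g => [c||a f h IH IH']; last first.
- under eq_fun do rewrite ga_star_semilinear mulrDl -!scalerAl omega_lin.
  exact: (lp_lin p0 (Num.conj a) IH IH').
- under eq_fun do rewrite ga_star0 mul0r omega_funE gsum0.
  exact: lp0.
under eq_fun do rewrite ga_star_delta -!deltaM omega_delta.
by apply: (lp_inj p0 (h := fun s => (c^-1 * (s * b))%g)) => // s t /mulgI/mulIg.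
Qed.

Lemma gns_D_representation (p : R) : 0 < p -> lp p psi ->
  D_representation (lp p) gns_rep.
Proof.
move=> p0 psip; exists (fun xi => `[< exists f, xi = gns_vec f >]); split.
- split=> [|a _ _ /asboolP[f ->] /asboolP[g ->]]; apply/asboolP.
    by exists 0; rewrite /gns_vec hc_incl0.
  by exists (a *: f + g); rewrite /gns_vec hc_incl_linear.
- move=> O O0 Oo.
  have [xi [Oxi [f _ fxi]]] := hc_incl_range_dense (B := gns_form) O0 Oo.
  by exists xi; split=> //; apply/asboolP; exists f.
- by move=> _ _ /asboolP[f ->] /asboolP[g ->]; apply: gns_lp_coef.
Qed.

(** The functional is the coefficient [<pi f 1, 1>] of the cyclic vector. *)
Lemma omega_le_Dnorm (p : R) f : 0 < p -> lp p psi ->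
  nc (omega_fun psi f) <= nc (psi 1%g) * Dnorm (lp p) f.
Proof.
move=> p0 psip; set K := Dnorm _ f.
have psi1 : gns_form 1 1 = psi 1%g by rewrite gns_formE mulr1 ga_star_delta invg1 omega_delta.
have -> : omega_fun psi f = inner H (rep_alg gns_rep f (gns_vec 1)) (gns_vec 1).
  rewrite gns_alg_vec mulr1 [RHS]hc_dot_incl gns_formE -delta1 ga_star_delta invg1.
  by rewrite delta1 mul1r.
apply: le_trans (cauchy_schwarz _ _) _.
have n1 : hnorm (gns_vec 1) ^+ 2 = nc (psi 1%g).
  apply: (@complexI R); rewrite -inner_hnorm [LHS]hc_dot_incl psi1.
  by rewrite normc_norm ger0_norm // -psi1 psd_ge0.
rewrite -n1 expr2 mulrC -mulrA ler_wpM2l ?hnorm_ge0 //.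
apply: le_trans (hnorm_rep_alg _ _ _) _; rewrite mulrC ler_wpM2l ?hnorm_ge0 //.
by apply/opnorm_Dnorm/gns_D_representation.
Qed.

End GNS.

(** * Cancellation in the free group *)

Section CommonPrefix.
Variable d : nat.
Local Notation word := (seq (letter d)).
Implicit Types (u v w : word) (x y : letter d) (s t : free_group d).

Fixpoint common_prefix u v : nat :=
  match u, v with
  | x :: u', y :: v' => if x == y then (common_prefix u' v').+1 else 0
  | _, _ => 0
  end.

Lemma leq_common_prefix j u v :
  (j <= common_prefix u v)%N =
  [&& (j <= size u)%N, (j <= size v)%N & take j u == take j v].
Proof.
elim: u v j => [|x u IH] [|y v] [|j] //=.
  by rewrite andbF.
case: eqVneq => [->|xy]; first by rewrite !ltnS IH eqseq_cons eqxx.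
by rewrite eqseq_cons (negPf xy) !andbF.
Qed.

Lemma mul_word_cat v w : reduced (v ++ w) -> fg_mul_word v w = v ++ w.
Proof.
elim: v => //= x v IH xvw; rewrite IH; last first.
  by move: xvw; rewrite /reduced; case: (v ++ w) => //= y z /andP[].
by move: xvw; rewrite /reduced /push; case: (v ++ w) => //= y z /andP[/negPf ->].
Qed.

Lemma reduced_inv_cat u v : reduced u -> reduced v ->
  (forall x y u' v', u = x :: u' -> v = y :: v' -> x != y) ->
  reduced (fg_inv_word u ++ v).
Proof.
case: u => [|x u] // ru rv uv; have := reduced_inv ru.
have xv : path (fun x y => y != inv_letter x) (inv_letter x) v.
  case: v rv uv => //= y v rv /(_ _ _ _ _ erefl erefl) xy.
  by rewrite inv_letterK eq_sym xy.
rewrite /fg_inv_word /= rev_cons cat_rcons /reduced; case: (rev _) => //= y w.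
by rewrite rcons_path cat_path /= => /andP[-> ->].
Qed.

(** Beyond the common prefix the first letters of [u] and [v] differ, so that
    nothing more cancels and the product is a concatenation. *)
Lemma mul_inv_word u v : reduced u -> reduced v ->
  fg_mul_word (fg_inv_word u) v =
  fg_inv_word (drop (common_prefix u v) u) ++ drop (common_prefix u v) v.
Proof.
elim: u v => [|x u IH] v ru rv; first by rewrite /= drop0.
case: v rv => [|y v] rv.
  by rewrite [common_prefix _ _]/= !drop0 cats0 fg_mul_word1 ?reduced_inv.
rewrite [common_prefix _ _]/=; case: eqVneq => [xy|xy].
  rewrite {1}/fg_inv_word /= rev_cons -cats1 fg_mul_word_cat /= inv_letterK xy eqxx.
  rewrite IH //; first by move: ru; rewrite /reduced /=; case: (u) => //= ? ? /andP[].
  by move: rv; rewrite /reduced /=; case: (v) => //= ? ? /andP[].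
rewrite !drop0 mul_word_cat // reduced_inv_cat // => x' y' u' v' [<- _] [<- _] //.
Qed.

Lemma word_of_divl s t :
  word_of (s^-1 * t)%g =
  fg_inv_word (drop (common_prefix s t) s) ++ drop (common_prefix s t) t.
Proof. by rewrite [LHS]mul_inv_word ?word_of_reduced. Qed.

Lemma size_inv_word u : size (fg_inv_word u) = size u.
Proof. by rewrite size_rev size_map. Qed.

Lemma common_prefix_size u v :
  (common_prefix u v <= size u)%N && (common_prefix u v <= size v)%N.
Proof. by have := leqnn (common_prefix u v); rewrite leq_common_prefix => /and3P[-> ->]. Qed.

Lemma wlen_divl s t :
  (wlen (s^-1 * t)%g + (common_prefix s t).*2 = wlen s + wlen t)%N.
Proof.
have /andP[hs ht] := common_prefix_size s t.
rewrite /wlen word_of_divl size_cat size_inv_word !size_drop -addnn addnACA.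
by rewrite !subnK.
Qed.

End CommonPrefix.

(** * The positive definite functions alpha^|s| *)

Section RadialKernel.
Variables (R : realType) (d : nat) (alpha : R).
Hypothesis alpha01 : 0 < alpha < 1.
Local Notation C := R[i].
Local Notation F := (free_group d).

Let a0 : 0 < alpha. Proof. by case/andP: alpha01. Qed.
Let b : R := alpha ^- 2.

(** The increments of the powers of [alpha^-2], so that the weights of the
    prefixes of a word of length [n] sum to [alpha^(- 2 n)]. *)
Definition prefix_weight (j : nat) : R := if j is j'.+1 then b ^+ j - b ^+ j' else 1.

Lemma prefix_weight_ge0 j : 0 <= prefix_weight j.
Proof.
case: j => [|j] /=; first exact: ler01.
have b1 : 1 <= b by rewrite invf_ge1 ?exprn_gt0 // exprn_ile1 ?ltW //; case/andP: alpha01.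
by rewrite subr_ge0 exprS ler_peMl // exprn_ge0 // (le_trans ler01).
Qed.

Lemma prefix_weight_sum n : \sum_(j < n.+1) prefix_weight j = b ^+ n.
Proof.
elim: n => [|n IH]; first by rewrite big_ord1 expr0.
by rewrite big_ord_recr IH /= addrC subrK.
Qed.

Definition prefix_coord j (w : j.-tuple (letter d)) (s : F) : R :=
  alpha ^+ wlen s * (take j s == w)%:R.

(** With [n] the length of the common prefix, [|s^-1 t| = |s| + |t| - 2 n], so
    the kernel is [alpha^|s| alpha^|t| b^n]; and [b^n] is the sum of the weights
    of all common prefixes of [s] and [t], that is of all words [w] that are a
    prefix of both. This is a Gram matrix with coordinates indexed by [w]. *)
Lemma radial_gram (M : nat) (s t : F) : (wlen s < M)%N ->
  alpha ^+ wlen (s^-1 * t)%g =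
  \sum_(j < M) \sum_(w : j.-tuple (letter d))
     prefix_weight j * (prefix_coord w s * prefix_coord w t).
Proof.
move=> sM; set n := common_prefix s t.
have nM : (n.+1 <= M)%N.
  by apply: leq_trans sM; rewrite ltnS; case/andP: (common_prefix_size s t).
have -> : alpha ^+ wlen (s^-1 * t)%g = alpha ^+ wlen s * alpha ^+ wlen t * b ^+ n.
  rewrite -exprD -wlen_divl exprD -/n -mulrA -mul2n exprM /b -exprVn -exprMn.
  by rewrite -[_ ^+ 2 * _]exprMn mulfV ?expr1n ?mulr1 // gt_eqF.
rewrite -prefix_weight_sum mulr_sumr (big_ord_widen _ (fun j => _ * prefix_weight j) nM).
rewrite big_mkcond; apply: eq_bigr => j _; rewrite ltnS.
have -> : \sum_(w : j.-tuple (letter d))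
     prefix_weight j * (prefix_coord w s * prefix_coord w t) =
   alpha ^+ wlen s * alpha ^+ wlen t * prefix_weight j *
     \sum_(w : j.-tuple (letter d)) ((take j s == w) && (take j t == w))%:R.
  rewrite mulr_sumr; apply: eq_bigr => w _.
  by rewrite -mulnb natrM /prefix_coord; ring.
rewrite leq_common_prefix; case: ifP => [/and3P[js jt /eqP st]|jst].
  have ws : size (take j s) == j by rewrite size_takel.
  rewrite (bigD1 (Tuple ws)) //= -st eqxx big1 ?addr0 ?mulr1 // => w.
  by rewrite -val_eqE /= eq_sym andbb => /negPf ->.
rewrite big1 ?mulr0 // => w _; case: eqP => // sw; case: eqP => // tw.
move: jst; rewrite sw tw eqxx andbT.
have -> : (j <= size s)%N by apply/minn_idPl; rewrite -size_take_min sw size_tuple.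
by have -> : (j <= size t)%N by apply/minn_idPl; rewrite -size_take_min tw size_tuple.
Qed.

Lemma radial_positive_definite (phi : F -> C) : positive_definite phi ->
  positive_definite (fun s => phi s * (alpha ^+ wlen s)%:C).
Proof.
move=> phi_pd n s c.
pose M := (\max_i wlen (s i)).+1.
have sM i : (wlen (s i) < M)%N by rewrite ltnS; apply: leq_bigmax.
pose e j (w : j.-tuple (letter d)) i := c i * (prefix_coord w (s i))%:C.
have -> : \sum_(i < n) \sum_(k < n) Num.conj (c i) * c k *
    (phi ((s i)^-1 * s k)%g * (alpha ^+ wlen ((s i)^-1 * s k)%g)%:C) =
  \sum_(j < M) \sum_(w : j.-tuple (letter d)) (prefix_weight j)%:C *
    \sum_(i < n) \sum_(k < n) Num.conj (e j w i) * e j w k * phi ((s i)^-1 * s k)%g.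
  under [RHS]eq_bigr do under eq_bigr do rewrite mulr_sumr.
  under [RHS]eq_bigr do rewrite exchange_big.
  rewrite [RHS]exchange_big; apply: eq_bigr => i _ /=.
  under [RHS]eq_bigr do under eq_bigr do rewrite mulr_sumr.
  under [RHS]eq_bigr do rewrite exchange_big.
  rewrite [RHS]exchange_big; apply: eq_bigr => k _ /=.
  rewrite (radial_gram _ (sM i)) rmorph_sum !mulr_sumr; apply: eq_bigr => j _.
  rewrite rmorph_sum !mulr_sumr; apply: eq_bigr => w _.
  have cR (r : R) : Num.conj r%:C = r%:C by rewrite conj_Creal // complex_real.
  rewrite /e !rmorphM /= cR; ring.
apply: sumr_ge0 => j _; apply: sumr_ge0 => w _.
by rewrite mulr_ge0 ?ler0c ?prefix_weight_ge0.
Qed.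

End RadialKernel.

(** * Inequalities for sums of real powers *)

Lemma powR_invl (R : realType) (x r : R) : 0 <= x -> x^-1 `^ r = (x `^ r)^-1.
Proof. by move=> x0; rewrite -powR_inv1 // powRAC powR_inv1 // powR_ge0. Qed.

Lemma powR_exprn (R : realType) (x r : R) n : 0 <= x -> (x ^+ n) `^ r = (x `^ r) ^+ n.
Proof.
move=> x0; elim: n => [|n IH]; first by rewrite !expr0 powR1.
by rewrite !exprS powRM ?exprn_ge0 // IH.
Qed.

Section PowerSums.
Variables (R : realType) (q : R).
Hypothesis q12 : 1 <= q <= 2.

Let q0 : 0 < q. Proof. by case/andP: q12 => /(lt_le_trans ltr01). Qed.

Lemma sqr_le_powR (z : R) : 0 <= z <= 1 -> z ^+ 2 <= z `^ q.
Proof.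
case/andP=> z0 z1; have [->|zn0] := eqVneq z 0; first by rewrite expr0n /= powR_ge0.
rewrite -powR_mulrn //; apply: ger_powR; first by rewrite lt_def zn0 z0 z1.
by case/andP: q12.
Qed.

Lemma sum_powR_eq0 (I : finType) (x : I -> R) : (forall i, 0 <= x i) ->
  \sum_i x i `^ q = 0 -> forall i, x i = 0.
Proof.
move=> x0 /eqP; rewrite psumr_eq0 => [/allP X i|i _]; last exact: powR_ge0.
by have /implyP/(_ isT)/eqP/powR_eq0_eq0 := X i (mem_index_enum i).
Qed.

(** After normalisation all entries are at most [1], where
    [x y <= (x^2 + y^2) / 2] and [x^2 <= x^q]. This replaces Hoelder's inequality
    followed by the comparison of the p-norm with the smaller exponent [q]. *)
Lemma sum_mul_powR (I : finType) (x y : I -> R) :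
  (forall i, 0 <= x i) -> (forall i, 0 <= y i) ->
  (\sum_i x i * y i) `^ q <= (\sum_i x i `^ q) * (\sum_i y i `^ q).
Proof.
move=> x0 y0; set X := \sum_i x i `^ q; set Y := \sum_i y i `^ q.
have X0 : 0 <= X by apply: sumr_ge0 => i _; apply: powR_ge0.
have Y0 : 0 <= Y by apply: sumr_ge0 => i _; apply: powR_ge0.
have [X00|Xn0] := eqVneq X 0.
  rewrite big1 ?powR0 ?gt_eqF ?mulr_ge0 // => i _.
  by rewrite (sum_powR_eq0 x0 X00) mul0r.
have [Y00|Yn0] := eqVneq Y 0.
  rewrite big1 ?powR0 ?gt_eqF ?mulr_ge0 // => i _.
  by rewrite (sum_powR_eq0 y0 Y00) mulr0.
have Xgt : 0 < X by rewrite lt_def Xn0.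
have Ygt : 0 < Y by rewrite lt_def Yn0.
have normed (z : I -> R) (Z : R) : (forall i, 0 <= z i) -> Z = \sum_i z i `^ q -> 0 < Z ->
  forall i, 0 <= z i / Z `^ q^-1 <= 1 /\ (z i / Z `^ q^-1) `^ q = z i `^ q / Z.
  move=> z0 ZE Zgt i; set w := Z `^ _.
  have wq : w `^ q = Z by rewrite -powRrM mulVf ?gt_eqF // powRr1 // ltW.
  have w0 : 0 < w by apply: powR_gt0.
  have pw : (z i / w) `^ q = z i `^ q / Z.
    by rewrite powRM ?invr_ge0 ?(ltW w0) // powR_invl ?(ltW w0) // wq.
  split=> //; rewrite divr_ge0 ?(ltW w0) //= ler_pdivrMr // mul1r leNgt; apply/negP => wz.
  have := gt0_ltr_powR q0 _ _ wz; rewrite !nnegrE (ltW w0) z0 wq => /(_ isT isT).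
  rewrite ltNge ZE (bigD1 i) //= lerDl; apply/negP; rewrite negbK.
  by apply: sumr_ge0 => j _; apply: powR_ge0.
have [a aE] : exists a, X `^ q^-1 = a by exists (X `^ q^-1).
have [b bE] : exists b, Y `^ q^-1 = b by exists (Y `^ q^-1).
have a0 : 0 < a by rewrite -aE powR_gt0.
have b0 : 0 < b by rewrite -bE powR_gt0.
have sab : \sum_i x i * y i <= a * b.
  suff : (\sum_i x i * y i) / (a * b) <= 1 by rewrite ler_pdivrMr ?mulr_gt0 // mul1r.
  rewrite [leLHS]mulr_suml.
  apply: (@le_trans _ _ (\sum_i (x i `^ q / X + y i `^ q / Y) / 2)).
    apply: ler_sum => i _.
    have [xa xaq] := normed x X x0 erefl Xgt i.
    have [yb ybq] := normed y Y y0 erefl Ygt i.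
    rewrite -xaq -ybq; rewrite aE in xa *; rewrite bE in yb *.
    apply: (@le_trans _ _ (((x i / a) ^+ 2 + (y i / b) ^+ 2) / 2)).
      have -> : x i * y i / (a * b) = (x i / a) * (y i / b).
        by rewrite invfM mulrACA.
      rewrite ler_pdivlMr // mulr_natr -subr_ge0.
      by rewrite addrAC -sqrrB sqr_ge0.
    by rewrite ler_pM2r ?invr_gt0 // lerD ?sqr_le_powR.
  rewrite -mulr_suml big_split /= -!mulr_suml -/X -/Y !divff //.
apply: le_trans (ge0_ler_powR (ltW q0) _ _ sab) _; rewrite ?nnegrE.
- by apply: sumr_ge0 => i _; rewrite mulr_ge0.
- by rewrite mulr_ge0 ?ltW.
have aq : a `^ q = X by rewrite -aE -powRrM mulVf ?(gt_eqF q0) // powRr1.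
have bq : b `^ q = Y by rewrite -bE -powRrM mulVf ?(gt_eqF q0) // powRr1.
by rewrite (powRM _ (ltW a0) (ltW b0)) aq bq.
Qed.

Lemma bernoulli_powR (z : R) : 0 <= z -> q * z <= z `^ q + (q - 1).
Proof.
move=> z0; have [q1|q1] := eqVneq q 1; first by rewrite q1 powRr1 // subrr addr0 mul1r.
have qgt1 : 1 < q by rewrite lt_def q1; case/andP: q12.
have qq : 0 < q / (q - 1) by rewrite divr_gt0 ?subr_gt0.
have := @conjugate_powR _ z 1 q (q / (q - 1)) z0 ler01 q0 qq.
rewrite powR1 mulr1 => /(_ _)/(ler_wpM2l (ltW q0)); rewrite mulrDr.
have -> : q * (z `^ q / q) = z `^ q by rewrite mulrC divfK // gt_eqF.
have -> : q * (1 / (q / (q - 1))) = q - 1 by rewrite mul1r invf_div mulrC divfK // gt_eqF.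
apply; rewrite invf_div; field; by rewrite gt_eqF.
Qed.

(** Jensen's inequality: the tangent line of [z^q] at the mean is below it. *)
Lemma sum_powR_convex n (x : 'I_n.+1 -> R) : (forall i, 0 <= x i) ->
  (\sum_i x i) `^ q <= n.+1%:R `^ (q - 1) * \sum_i x i `^ q.
Proof.
move=> x0; set S := \sum_i x i; set N : R := n.+1%:R.
have N0 : 0 < N by rewrite ltr0n.
have [S0|Sn0] := eqVneq S 0.
  by rewrite S0 powR0 ?gt_eqF // mulr_ge0 ?powR_ge0 ?sumr_ge0 // => i _; apply: powR_ge0.
have Sgt : 0 < S by rewrite lt_def Sn0 sumr_ge0.
set m := S / N; have m0 : 0 < m by rewrite divr_gt0.
have : \sum_i q * (x i / m) <= \sum_i ((x i / m) `^ q + (q - 1)).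
  by apply: ler_sum => i _; apply: bernoulli_powR; rewrite divr_ge0 ?(ltW m0).
rewrite -mulr_sumr -mulr_suml -/S big_split /= sumr_const card_ord -mulr_natr -/N.
have -> : S / m = N by rewrite /m invf_div mulrC divfK ?gt_eqF.
rewrite mulrBl mul1r addrCA lerDl subr_ge0.
under eq_bigr do rewrite powRM ?invr_ge0 ?(ltW m0) // powR_invl ?(ltW m0) //.
rewrite -mulr_suml ler_pdivlMr ?powR_gt0 // => NS.
apply: le_trans (ler_wpM2l (powR_ge0 N (q - 1)) NS).
rewrite mulrA [_ * N]mulrC mulr_powRB1 ?(ltW N0) // -powRM ?(ltW N0) ?(ltW m0) //.
by rewrite /m mulrC divfK ?gt_eqF.
Qed.

End PowerSums.

(** * Convolution with a function supported on a sphere *)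

Section SphereConvolution.
Variables (R : realType) (d : nat) (q : R).
Hypothesis q12 : 1 <= q <= 2.
Local Notation C := R[i].
Local Notation nc := (@Normc.normc R).
Local Notation F := (free_group d).
Local Notation word := (seq (letter d)).
Local Notation A := (group_algebra R F).
Implicit Types (f g : A) (s t : F) (w : word).

Let q0 : 0 < q. Proof. by case/andP: q12 => /(lt_le_trans ltr01). Qed.

(** Functions on the group are extended by [0] to all words, so that reduced
    products become plain concatenations. *)
Definition on_words (u : F -> R) w : R := oapp u 0 (insub w).

Lemma on_words_val (u : F -> R) s : on_words u (word_of s) = u s.
Proof. by rewrite /on_words valK. Qed.

Lemma on_words_ge0 (u : F -> R) w : (forall s, 0 <= u s) -> 0 <= on_words u w.
Proof. by move=> u0; rewrite /on_words; case: insubP => //= s _ _; apply: u0. Qed.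

Lemma on_words_powR (u : F -> R) w : on_words u w `^ q = on_words (fun s => u s `^ q) w.
Proof. by rewrite /on_words; case: insubP => //= _; rewrite powR0 ?gt_eqF. Qed.

Lemma sums_le_on_words (u : F -> R) K : sums_le u K -> sums_le (on_words u) K.
Proof.
move=> uK r ur; rewrite -(@big_pmap _ _ _ _ _ insub r u).
by apply/uK/pmap_sub_uniq.
Qed.

(** The part of the convolution of [u] and [v] at the word [w] that comes
    from the factorisations [w = (a c) (c^-1 b)] with [a] the prefix of [w] of
    length [i] and [c] of length [j]. *)
Definition cancel_conv (u v : F -> R) (i j : nat) w : R :=
  \sum_(c : j.-tuple (letter d))
    on_words u (take i w ++ c) * on_words v (fg_inv_word c ++ drop i w).

Lemma cancel_conv_ge0 (u v : F -> R) i j w :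
  (forall s, 0 <= u s) -> (forall s, 0 <= v s) -> 0 <= cancel_conv u v i j w.
Proof. by move=> u0 v0; apply: sumr_ge0 => c _; rewrite mulr_ge0 ?on_words_ge0. Qed.

Lemma fg_inv_word_inj : injective (@fg_inv_word d).
Proof.
apply: (can_inj (g := @fg_inv_word d)) => w.
by rewrite /fg_inv_word map_rev revK mapK //; apply: inv_letterK.
Qed.

(** The middle factor [c] has the fixed length [j], so [a ++ c] determines [a]
    and [c], and [c^-1 ++ b] determines [c] and [b]: the two factors that the
    pointwise inequality produces are summed independently. *)
Lemma sums_le_cancel_conv (u v : F -> R) K L i j :
  (forall s, 0 <= u s) -> (forall s, 0 <= v s) ->
  sums_le (fun s => u s `^ q) K -> sums_le (fun s => v s `^ q) L ->
  sums_le (fun w => cancel_conv u v i j w `^ q) (K * L).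
Proof.
move=> u0 v0 uK vL.
pose U a := \sum_(c : j.-tuple (letter d)) on_words (fun s => u s `^ q) (a ++ c).
pose V b := \sum_(c : j.-tuple (letter d)) on_words (fun s => v s `^ q) (fg_inv_word c ++ b).
have UK : sums_le U K.
  apply: (@sums_le_fibre _ _ _ _ (fun a (c : j.-tuple (letter d)) => a ++ c)).
    move=> a a' c c' acE; have := congr1 size acE.
    rewrite !size_cat !size_tuple => /addIn sa.
    by move/eqP: acE; rewrite eqseq_cat // => /andP[/eqP -> /eqP/val_inj ->].
  exact: sums_le_on_words.
have VL : sums_le V L.
  apply: (@sums_le_fibre _ _ _ _ (fun b (c : j.-tuple (letter d)) => fg_inv_word c ++ b)).
    move=> b b' c c' /eqP; rewrite eqseq_cat ?size_inv_word ?size_tuple //.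
    by move=> /andP[/eqP/fg_inv_word_inj/val_inj -> /eqP ->].
  exact: sums_le_on_words.
apply: (@sums_le_leF _ _ (fun w => U (take i w) * V (drop i w))).
  move=> w; rewrite /U /V.
  under eq_bigr do rewrite -on_words_powR.
  under [X in _ * X]eq_bigr do rewrite -on_words_powR.
  by apply: sum_mul_powR => // c; apply: on_words_ge0.
apply: sums_le_prod => // [s t st1 st2|a|b].
- by rewrite -(cat_take_drop i s) st1 st2 cat_take_drop.
- by apply: sumr_ge0 => c _; apply: on_words_ge0 => s; apply: powR_ge0.
- by apply: sumr_ge0 => c _; apply: on_words_ge0 => s; apply: powR_ge0.
Qed.

(** Sort the factorisations [s = t (t^-1 s)] with [|t| = k] by the number [j]
    of cancelled letters: [t] agrees with [s] on its first [k - j] letters. *)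
Lemma conv_le_cancel_conv k f g s : (forall t, f t != 0 -> wlen t = k) ->
  nc ((f * g) s) <=
  \sum_(j < k.+1) cancel_conv (fun t => nc (f t)) (fun t => nc (g t)) (k - j) j s.
Proof.
move=> fk; set u := fun t => nc (f t); set v := fun t => nc (g t).
have [E0 fE0] := gsum_supp f.
pose E := [seq t <- enum_fset E0 | f t != 0].
have -> : (f * g) s = \sum_(t <- E) f t * g (t^-1 * s)%g.
  rewrite [LHS](gsumE _ fE0) /E big_filter [RHS]big_mkcond /=.
  apply: eq_bigr => t _; case: eqP => //= ->; exact: scale0r.
have uE : uniq E by rewrite filter_uniq // fset_uniq.
pose y j (c : j.-tuple (letter d)) : R :=
  on_words u (take (k - j) s ++ c) * on_words v (fg_inv_word c ++ drop (k - j) s).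
have y0 j c : 0 <= @y j c.
  by rewrite mulr_ge0 ?on_words_ge0 // => t; apply: normc_ge0.
apply: (@le_trans _ _ (\sum_(t <- E) \sum_(j < k.+1) \sum_(c : j.-tuple (letter d))
    (word_of t == take (k - j) s ++ c)%:R * @y j c)).
  apply: le_trans (ler_normc_sum _ _) _; under eq_bigr do rewrite normcM.
  rewrite big_seq [leRHS]big_seq.
  apply: ler_sum => t; rewrite mem_filter => /andP[/fk tk _].
  set n := common_prefix t s.
  have /andP[nt ns] := common_prefix_size t s; rewrite -/n -/(wlen t) tk in nt.
  have jk : (k - n < k.+1)%N by rewrite ltnS leq_subr.
  have cP : size (drop n t) == Ordinal jk by rewrite size_drop -/(wlen t) tk.
  have kn : (k - (k - n) = n)%N by rewrite subKn.
  have tE : word_of t = take n s ++ drop n t.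
    have := leqnn n; rewrite {2}/n leq_common_prefix => /and3P[_ _ /eqP <-].
    by rewrite cat_take_drop.
  rewrite (bigD1 (Ordinal jk)) //= (bigD1 (Tuple cP)) //= kn -tE eqxx mul1r.
  rewrite /y /= kn -tE -word_of_divl !on_words_val -addrA lerDl.
  apply: addr_ge0; apply: sumr_ge0 => j _; last apply: sumr_ge0 => c _;
    by rewrite !mulr_ge0 ?on_words_ge0 // => t'; apply: normc_ge0.
rewrite exchange_big; apply: ler_sum => j _.
rewrite exchange_big; apply: ler_sum => c _.
have le1 : \sum_(t <- E) (word_of t == take (k - j) s ++ c)%:R <= 1 :> R.
  rewrite -natr_sum lern1.
  rewrite (_ : \sum_(t <- E) _ =
    count (pred1 (take (k - j) s ++ c)) (map (@word_of d) E))%N.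
    by rewrite count_uniq_mem ?leq_b1 // map_inj_uniq // => t t' /val_inj.
  by elim: (E) => [|t r IH]; rewrite ?big_nil // big_cons IH.
by rewrite -[leRHS]mul1r; apply: le_trans (ler_wpM2r (y0 j c) le1); rewrite mulr_suml.
Qed.

(** Each of the [k + 1] cancellation lengths contributes a function of q-norm
    at most [|f|_q |g|_q]. *)
Lemma sums_le_sphere_conv k f g K L : (forall t, f t != 0 -> wlen t = k) ->
  sums_le (fun s => nc (f s) `^ q) K -> sums_le (fun s => nc (g s) `^ q) L ->
  sums_le (fun s => nc ((f * g) s) `^ q) (k.+1%:R `^ q * K * L).
Proof.
move=> fk fK gL.
set P := fun (j : 'I_k.+1) (s : F) =>
  cancel_conv (fun t => nc (f t)) (fun t => nc (g t)) (k - j) j s.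
have P0 j s : 0 <= P j s by apply: cancel_conv_ge0 => t; apply: normc_ge0.
apply: (@sums_le_leF _ _ (fun s => k.+1%:R `^ (q - 1) * \sum_j P j s `^ q)).
  move=> s; apply: le_trans (sum_powR_convex q12 (P0^~ s)).
  by rewrite ge0_ler_powR ?nnegrE ?(ltW q0) ?normc_ge0 ?sumr_ge0 ?conv_le_cancel_conv.
have -> : k.+1%:R `^ q * K * L = k.+1%:R `^ (q - 1) * \sum_(j < k.+1) (K * L).
  rewrite sumr_const card_ord -[(K * L) *+ _]mulr_natr.
  by rewrite -(mulr_powRB1 (ler0n R k.+1) q0); ring.
apply: sums_leZ; first exact: powR_ge0.
apply: sums_le_sum => j.
have := @sums_le_cancel_conv (fun t => nc (f t)) (fun t => nc (g t)) K L (k - j) j.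
move=> /(_ (fun=> normc_ge0 _) (fun=> normc_ge0 _) fK gL).
by move/(sums_le_inj (h := @word_of d)); apply => s t /val_inj.
Qed.

End SphereConvolution.

(** * Operator norms from the growth of moments *)

Section SpectralRadius.
Variables (R : realType) (G : groupType).
Local Notation C := R[i].
Local Notation nc := (@Normc.normc R).
Local Notation A := (group_algebra R G).

Lemma expr2n_le1 (y K : R) : 0 <= y -> (forall n, y ^+ (2 ^ n) <= K) -> y <= 1.
Proof.
move=> y0 yK; rewrite leNgt; apply/negP => y1.
have bern n : 1 + (y - 1) *+ n <= y ^+ n.
  elim: n => [|n IH]; first by rewrite mulr0n addr0 expr0.
  rewrite exprSr; apply: le_trans (ler_wpM2r y0 IH).
  rewrite mulrDl mul1r mulrS addrA subrKC lerD2l -{1}[_ *+ n]mulr1.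
  by rewrite ler_wpM2l ?(ltW y1) // mulrn_wge0 // subr_ge0 ltW.
pose m := Num.truncn (K / (y - 1)).
have := yK m.+1; rewrite leNgt => /negP; apply.
have mm : (m.+1 <= 2 ^ m.+1)%N by apply: ltnW; apply: ltn_expl.
apply: (@lt_le_trans _ _ (y ^+ m.+1)); last by rewrite ler_weXn2l // ltW.
apply: lt_le_trans (bern _); apply: (@lt_trans _ _ ((y - 1) *+ m.+1)).
  by rewrite -mulr_natl -ltr_pdivrMr ?subr_gt0 // truncnS_gt.
by rewrite ltrDr ltr01.
Qed.

Variables (H : hilbert_space R) (pi : unitary_rep G H).

Lemma ga_star_expr (a : A) n : ga_star a = a -> ga_star (a ^+ n) = a ^+ n.
Proof.
move=> aa; elim: n => [|n IH]; first by rewrite !expr0 -delta1 ga_star_delta invg1.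
by rewrite {1}exprS ga_starM IH aa exprSr.
Qed.

(** Iterating [<a^N x, x>^2 <= <a^2N x, x> <x, x>] bounds [<a x, x>] by the
    exponential growth rate of the moments [<a^N x, x>]. *)
Lemma hnorm_rep_alg_growth (f : A) (x : H) (K D : R) : 0 < D ->
  (forall n, nc (inner H (rep_alg pi ((ga_star f * f) ^+ n) x) x) <= K * D ^+ n) ->
  hnorm (rep_alg pi f x) ^+ 2 <= D * hnorm x ^+ 2.
Proof.
move=> D0; set a := ga_star f * f => fK.
have aa : ga_star a = a by rewrite ga_starM ga_starK.
pose m n := nc (inner H (rep_alg pi (a ^+ n) x) x).
have hnE (y : H) : nc (inner H y y) = hnorm y ^+ 2.
  by rewrite inner_hnorm normcR ger0_norm ?sqr_ge0.
have m0E : m 0 = hnorm x ^+ 2.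
  by rewrite /m expr0 -delta1 rep_algE gsum_delta rep1 hnE.
have m1E : m 1 = hnorm (rep_alg pi f x) ^+ 2.
  by rewrite /m expr1 rep_algM rep_alg_star hnE.
have mm n : m n ^+ 2 <= m (n.*2)%N * m 0.
  have -> : m n.*2 = hnorm (rep_alg pi (a ^+ n) x) ^+ 2.
    rewrite /m -addnn exprD -{1}(ga_star_expr n aa) rep_algM rep_alg_star.
    by rewrite hnE.
  rewrite m0E -exprMn ler_pXn2r ?nnegrE ?normc_ge0 ?mulr_ge0 ?hnorm_ge0 //.
  exact: cauchy_schwarz.
have mge0 n : 0 <= m n by apply: normc_ge0.
rewrite -m1E -m0E; have [x0|x0] := eqVneq (m 0) 0.
  have := mm 1; rewrite x0 !mulr0.
  by rewrite exprn_even_le0 //= => /eqP ->.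
have mgt : 0 < m 0 by rewrite lt_def x0 mge0.
have iter n : m 1 ^+ (2 ^ n) * m 0 <= m 0 ^+ (2 ^ n) * m (2 ^ n)%N.
  elim: n => [|n IH]; first by rewrite !expr1 mulrC.
  rewrite -(ler_pM2r mgt) expnS mul2n -addnn !exprD.
  have := ler_pM _ _ IH IH; rewrite !mulr_ge0 ?exprn_ge0 ?mge0 // => /(_ isT isT) h.
  have -> : m 1 ^+ (2 ^ n) * m 1 ^+ (2 ^ n) * m 0 * m 0 =
    m 1 ^+ (2 ^ n) * m 0 * (m 1 ^+ (2 ^ n) * m 0) by ring.
  apply: le_trans h _; have := mm (2 ^ n)%N; rewrite -addnn => h.
  have -> : m 0 ^+ (2 ^ n) * m (2 ^ n)%N * (m 0 ^+ (2 ^ n) * m (2 ^ n)%N) =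
    m 0 ^+ (2 ^ n) * m 0 ^+ (2 ^ n) * m (2 ^ n)%N ^+ 2 by ring.
  by rewrite -[leRHS]mulrA ler_wpM2l ?mulr_ge0 ?exprn_ge0.
rewrite -ler_pdivrMr // -[leRHS]mul1r -ler_pdivrMr //.
apply: (@expr2n_le1 _ (K / m 0)); first by rewrite !divr_ge0 ?mge0 // ltW.
move=> n; rewrite !exprMn !exprVn ler_pdivrMr ?exprn_gt0 // ler_pdivrMr ?exprn_gt0 //.
rewrite -(ler_pM2r mgt); apply: le_trans (iter n) _.
rewrite mulrC; apply: le_trans (ler_wpM2r (exprn_ge0 _ (mge0 0%N)) (fK _)) _.
rewrite le_eqVlt; apply/orP; left; apply/eqP; field.
by rewrite gt_eqF.
Qed.

Lemma opnorm_le_dense (f : A) (S : set H) (K : R) : dense S -> 0 <= K ->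
  (forall x, S x -> hnorm (rep_alg pi f x) <= K * hnorm x) ->
  opnorm (rep_alg pi f) <= K.
Proof.
move=> Sd K0 SK; apply: opnorm_le => // x; have [L fL] := rep_alg_bounded f.
apply/ler_addgt0Pr => e e0.
pose c := K + `|L| + 1; have c0 : 0 < c by rewrite ltr_wpDl // addr_ge0.
have ec : 0 < e / c by rewrite divr_gt0.
have [|y [/= xy Sy]] := Sd (ball x (e / c)%:C) _ (ball_open _ _).
  by exists x; apply: ballxx; rewrite ltcR.
have {}xy : hnorm (x - y) < e / c.
  by move: xy; rewrite -ball_normE /ball_ /= -hnormE ltcR.
have -> : rep_alg pi f x = rep_alg pi f (x - y) + rep_alg pi f y.
  by have := rep_alg_linear pi f 1 (x - y) y; rewrite !scale1r subrK.
have h0 := Defs.hnormD (rep_alg pi f (x - y)) (rep_alg pi f y).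
have yx : hnorm y <= hnorm x + hnorm (x - y).
  rewrite -[y in leLHS](subKr x); apply: le_trans (Defs.hnormD _ _) _.
  by rewrite lerD2l -scaleN1r hnormZ normcN normc1 mul1r.
have h1 := fL H pi (x - y); have h2 := SK y Sy.
have h3 : L * hnorm (x - y) <= `|L| * hnorm (x - y).
  by rewrite ler_wpM2r ?hnorm_ge0 ?ler_norm.
have h4 : K * hnorm y <= K * (hnorm x + hnorm (x - y)) by rewrite ler_wpM2l.
have h5 : c * hnorm (x - y) <= e by rewrite mulrC -ler_pdivlMr // ltW.
have := hnorm_ge0 (x - y); move: h0 h1 h2 h3 h4 h5; rewrite /c; nra.
Qed.

End SpectralRadius.

(** * Haagerup's inequality in l_p-representations *)

Section LpRepresentations.
Variables (R : realType) (p : R).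
Hypothesis p2 : 2 <= p.
Local Notation C := R[i].
Local Notation nc := (@Normc.normc R).

Definition conj_exponent : R := p / (p - 1).
Local Notation q := conj_exponent.

Let p0 : 0 < p. Proof. exact: lt_le_trans p2. Qed.
Let p1 : 0 < p - 1. Proof. by rewrite subr_gt0 (lt_le_trans _ p2) // ltr1n. Qed.

Lemma conj_exponent_bounds : 1 <= q <= 2.
Proof.
rewrite /q ler_pdivlMr // ler_pdivrMr // mul1r gerBl ler01 /=.
by move: p2; lra.
Qed.

Lemma conj_exponentP : p^-1 + q^-1 = 1.
Proof. by rewrite /q; field; rewrite !gt_eqF. Qed.

Let q0 : 0 < q. Proof. by rewrite divr_gt0. Qed.

Lemma young_le (a b : R) : 0 <= a -> 0 <= b -> a * b <= a `^ q + b `^ p.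
Proof.
move=> a0 b0; rewrite mulrC addrC.
apply: le_trans (conjugate_powR b0 a0 p0 q0 conj_exponentP) _.
have [/andP[q1 _] p1'] := (conj_exponent_bounds, le_trans (ler1n R 2) p2).
by rewrite lerD // ler_piMr ?powR_ge0 // invf_le1 // (le_trans _ p2) // ler1n.
Qed.

(** Young's inequality, after division of [h] by [e]. The constant [K + L] is
    harmless, since it is lost when the growth of moments is compared. *)
Lemma norm_gsum_le (G : groupType) (h : group_algebra R G) (psi : G -> C) (K L e : R) :
  0 < e -> sums_le (fun s => nc (h s) `^ q) (e `^ q * K) ->
  sums_le (fun s => nc (psi s) `^ p) L ->
  nc (gsum h (psi : G -> C^o)) <= e * (K + L).
Proof.
move=> e0 hK psiL; have [E hE] := gsum_supp h; rewrite (gsumE _ hE).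
apply: le_trans (ler_normc_sum (enum_fset E) (fun t => h t * psi t)) _.
under eq_bigr do rewrite normcM.
rewrite mulrC -ler_pdivrMr // mulr_suml.
apply: (@le_trans _ _ (\sum_(t <- E) ((e `^ q)^-1 * nc (h t) `^ q + nc (psi t) `^ p))).
  apply: ler_sum => t _; have := @young_le (nc (h t) / e) (nc (psi t)) _ _.
  rewrite divr_ge0 ?normc_ge0 ?(ltW e0) // => /(_ isT isT).
  rewrite powRM ?normc_ge0 ?invr_ge0 ?(ltW e0) // powR_invl ?(ltW e0) //.
  by rewrite mulrAC [_ * (e `^ q)^-1]mulrC.
have eq0 : 0 <= (e `^ q)^-1 by rewrite invr_ge0 powR_ge0.
have hs := sums_le_lin eq0 hK psiL.
apply: le_trans (hs _ (fset_uniq E)) _.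
by rewrite mulrA mulVf ?mul1r // gt_eqF // powR_gt0.
Qed.

Variable d : nat.
Local Notation F := (free_group d).
Local Notation A := (group_algebra R F).

Lemma sums_le_star (f : A) K : sums_le (fun s => nc (f s) `^ q) K ->
  sums_le (fun s => nc (ga_star f s) `^ q) K.
Proof.
move=> /(sums_le_inj (@invg_inj F)); apply: sums_le_leF => s.
by rewrite ga_starE normc_conj.
Qed.

Lemma sums_le_moment k (f : A) K n : (forall s, f s != 0 -> wlen s = k) ->
  sums_le (fun s => nc (f s) `^ q) K ->
  sums_le (fun s => nc (((ga_star f * f) ^+ n) s) `^ q) ((k.+1%:R `^ q * K) ^+ 2 ^+ n).
Proof.
move=> fk fK; have fsk s : ga_star f s != 0 -> wlen s = k.
  rewrite ga_starE conjC_eq0 => /fk; rewrite /wlen /=.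
  by rewrite size_rev size_map.
elim: n => [|n IH].
  move=> r ur; rewrite !expr0; apply: (@le_trans _ _ (\sum_(s <- r) (s == 1%g)%:R)).
    apply: ler_sum => s _; rewrite -delta1 deltaE.
    by case: eqP => _; rewrite ?normc1 ?powR1 // Normc.normc0 powR0 ?gt_eqF.
  rewrite -natr_sum lern1 (_ : \sum_(s <- r) _ = count_mem 1%g r)%N.
    by rewrite count_uniq_mem ?leq_b1.
  by elim: (r) => [|t r' IH]; rewrite ?big_nil // big_cons IH.
rewrite exprS -mulrA.
have := sums_le_sphere_conv conj_exponent_bounds fsk (sums_le_star fK)
  (sums_le_sphere_conv conj_exponent_bounds fk fK IH).
by set N := _ * K; rewrite (_ : N * (N * _) = N ^+ 2 ^+ n.+1) // mulrA -expr2 -exprS.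
Qed.

Lemma gsum_rep_coef (H : hilbert_space R) (pi : unitary_rep F H) (h : A) (x y : H) :
  inner H (rep_alg pi h x) y = gsum h (rep_coef pi x y : F -> C^o).
Proof.
rewrite rep_algE; elim/ga_ind: h => [s||a h g IH IH'].
- by rewrite !gsum_delta.
- by rewrite !gsum0 linear0l.
- by rewrite !gsum_linear inner_Dl IH IH'.
Qed.

(** Haagerup's inequality for l_p: by the convolution estimate the moments
    of [f^* f] grow at most like the powers of [((k + 1) |f|_q)^2]. *)
Lemma Dnorm_sphere_le k (f : A) K : 0 < K -> (forall s, f s != 0 -> wlen s = k) ->
  sums_le (fun s => nc (f s) `^ q) K ->
  Dnorm (lp p) f <= k.+1%:R * K `^ q^-1.
Proof.
move=> K0 fk fK; set B := _ * _.
have Bq : B `^ q = k.+1%:R `^ q * K.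
  by rewrite powRM ?powR_ge0 // -powRrM mulVf ?gt_eqF // powRr1 // ltW.
have B0 : 0 < B by rewrite mulr_gt0 ?powR_gt0.
apply: Dnorm_le => [|H pi [S [_ Sd Slp]]]; first exact: ltW.
apply: opnorm_le_dense Sd (ltW B0) _ => x /= xS.
have /lpP[//|L psiL] := Slp x x xS xS.
rewrite -(@ler_pXn2r _ 2) ?nnegrE ?mulr_ge0 ?hnorm_ge0 ?powR_ge0 // exprMn.
apply: (hnorm_rep_alg_growth (K := 1 + L)) => [|n]; first by rewrite exprn_gt0.
rewrite gsum_rep_coef mulrC; apply: norm_gsum_le psiL; first by rewrite !exprn_gt0.
rewrite mulr1; have -> : (B ^+ 2 ^+ n) `^ q = (k.+1%:R `^ q * K) ^+ 2 ^+ n.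
  by rewrite -!exprM powR_exprn ?Bq // ltW.
exact: sums_le_moment.
Qed.

End LpRepresentations.

(** * Positive functionals on the completion are bounded *)

Section PositiveFunctionals.
Variables (R : realType) (A : algType R[i]) (q : star_seminorm A).
Local Notation C := R[i].
Local Notation nc := (@Normc.normc R).
Implicit Types (a x y : A) (t : R).

Lemma sstarD x y : sstar q (x + y) = sstar q x + sstar q y.
Proof. by have := sstar_semilinear q 1 x y; rewrite rmorph1 !scale1r. Qed.

Lemma sstar0 : sstar q 0 = 0.
Proof. by rewrite -[0 in LHS](subrr 0) sstarB subrr. Qed.

Lemma sstarZ (c : C) x : sstar q (c *: x) = Num.conj c *: sstar q x.
Proof. by have := sstar_semilinear q c x 0; rewrite sstar0 !addr0. Qed.

Lemma sstar1 : sstar q 1 = 1.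
Proof. by rewrite -[LHS]mulr1 -{2}[1](sstarK q) -sstarM mulr1 sstarK. Qed.

Definition sqrt_iter a (n : nat) : A :=
  iter n (fun b => (2^-1)%:C *: (a + b * b)) 0.

Lemma sqrt_iterS a n : sqrt_iter a n.+1 = (2^-1)%:C *: (a + sqrt_iter a n * sqrt_iter a n).
Proof. by []. Qed.

Lemma sqrt_iter_star a n : sstar q a = a -> sstar q (sqrt_iter a n) = sqrt_iter a n.
Proof.
move=> aa; elim: n => [|n IH]; first exact: sstar0.
rewrite sqrt_iterS sstarZ sstarD aa sstarM IH.
by rewrite conj_Creal // complex_real.
Qed.

Lemma snorm_half x : q ((2^-1)%:C *: x) <= 2^-1 * q x.
Proof.
by apply: le_trans (snormZ q _ _) _; rewrite normcR ger0_norm // invr_ge0.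
Qed.

Lemma sqrt_iter_bound a t : 0 <= t <= 1 -> q a <= t ->
  forall n, q (sqrt_iter a n) <= t.
Proof.
move=> /andP[t0 t1] at_; elim=> [|n IH]; first by rewrite snorm0.
rewrite sqrt_iterS; apply: le_trans (snorm_half _) _.
have h := snormD q a (sqrt_iter a n * sqrt_iter a n).
have h2 := snormM q (sqrt_iter a n) (sqrt_iter a n).
have h3 := ler_pM (snorm_ge0 q _) (snorm_ge0 q _) IH IH.
have h4 : t * t <= t by rewrite ler_piMr.
move: h h2 h3 h4 at_; lra.
Qed.

Lemma sqrt_iter_step a t : 0 <= t <= 1 -> q a <= t ->
  forall n, q (sqrt_iter a n.+1 - sqrt_iter a n) <= t ^+ n * t.
Proof.
move=> t01 at_ n; have bt := sqrt_iter_bound t01 at_; elim: n => [|n IH].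
  by rewrite expr0 mul1r subr0 bt.
set b1 := sqrt_iter a n.+1 in IH *; set b0 := sqrt_iter a n in IH *.
have -> : sqrt_iter a n.+2 - b1 = (2^-1)%:C *: (b1 * (b1 - b0) + (b1 - b0) * b0).
  rewrite sqrt_iterS -/b1 {2}/b1 sqrt_iterS -/b0 -scalerBr; congr (_ *: _).
  by rewrite opprD addrACA subrr add0r mulrBr mulrBl addrA subrK.
apply: le_trans (snorm_half _) _.
have h := snormD q (b1 * (b1 - b0)) ((b1 - b0) * b0).
have h1 := snormM q b1 (b1 - b0); have h2 := snormM q (b1 - b0) b0.
have g1 := ler_pM (snorm_ge0 q _) (snorm_ge0 q _) (bt n.+1) IH.
have g2 := ler_pM (snorm_ge0 q _) (snorm_ge0 q _) IH (bt n).
rewrite -/b1 in g1; rewrite -/b0 [leRHS]mulrC in g2.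
rewrite exprS -mulrA; move: h h1 h2 g1 g2; lra.
Qed.

Lemma geometric_cauchy (u : nat -> A) t : 0 <= t < 1 ->
  (forall n, q (u n.+1 - u n) <= t ^+ n * t) -> u \in cauchy_pred q.
Proof.
move=> /andP[t0 t1] ut; apply/asboolP => e e0.
have t1' : 0 < 1 - t by rewrite subr_gt0.
have tail m n : q (u (m + n)%N - u m) <= t ^+ m * (t / (1 - t)).
  have : q (u (m + n)%N - u m) <= t ^+ m * (t / (1 - t)) * (1 - t ^+ n).
    elim: n => [|n IH]; first by rewrite addn0 subrr expr0 subrr mulr0 snorm0.
    rewrite addnS; apply: le_trans (snorm_tri q (u (m + n)%N) _ _) _.
    apply: le_trans (lerD (ut _) IH) _.
    rewrite le_eqVlt; apply/orP; left; apply/eqP; rewrite exprD exprS; field.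
    by rewrite gt_eqF.
  move/le_trans; apply; rewrite ler_piMr //.
    by rewrite !mulr_ge0 ?exprn_ge0 ?invr_ge0 // ltW.
  by rewrite gerBl exprn_ge0.
have [M tM] : exists M, t ^+ M * (t / (1 - t)) < e / 2.
  have := @cvg_geometric R (t / (1 - t)) t; rewrite ger0_norm // => /(_ t1).
  move=> /cvgrPdist_lt/(_ (e / 2)) /(_ ltac:(by rewrite divr_gt0)) [M _ MP].
  exists M; have := MP M (leqnn M); rewrite /= sub0r normrN mulrC.
  by rewrite ger0_norm // mulr_ge0 ?exprn_ge0 ?mulr_ge0 ?invr_ge0 // ltW.
exists M => i j Mi Mj; rewrite [e]splitr.
apply: le_lt_trans (snorm_tri q (u M) _ _) _.
rewrite ltrD //; first by rewrite -(subnKC Mi) (le_lt_trans (tail _ _)).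
by rewrite (snorm_sub q) -(subnKC Mj) (le_lt_trans (tail _ _)).
Qed.

(** The iteration [b -> (a + b^2) / 2] maps the ball of radius [|a|] into itself
    and contracts it at the rate [|a|]; at its fixed point [b] the element
    [y = 1 - b] is self-adjoint with square [1 - a]. *)
Lemma completion_sqrt a : sstar q a = a -> q a < 1 ->
  exists y : completion q, c_star y * y = c_in q (1 - a).
Proof.
move=> aa a1; have a01 : 0 <= q a < 1 by rewrite snorm_ge0.
have a01' : 0 <= q a <= 1 by rewrite snorm_ge0 ltW.
have step := sqrt_iter_step a01' (lexx _).
pose u : cauchy_seq q := CauchySeq (geometric_cauchy a01 step).
exists (\pi_(completion q)%qT (cs_lin (-1) u (cs_const q 1))).
rewrite /GRing.mul /= c_star_pi c_mul_pi; apply/pi_null_equiv/asboolP => e e0.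
have e2 : 0 < e / 2 by rewrite divr_gt0.
have [M uM] := Defs.cauchyP u e2; exists M => n Mn /=.
have -> : sstar q (-1 *: sqrt_iter a n + 1) * (-1 *: sqrt_iter a n + 1) - (1 - a) =
    (2 : C) *: (sqrt_iter a n.+1 - sqrt_iter a n).
  rewrite sstarD sstar1 sstarZ sqrt_iter_star // rmorphN1 scaleN1r sqrt_iterS.
  have h2 : (2 : C) * (2^-1)%:C = 1 by rewrite fmorphV rmorph_nat mulfV // pnatr_eq0.
  rewrite scalerBr scalerA h2 scale1r scaler_nat mulr2n.
  rewrite mulrDr mulrDl !mulNr mulrN !mulr1 mul1r opprK opprB opprD.
  rewrite -addrA [_ + (a - 1)]addrACA subrr addr0 -addrA.
  by rewrite [a + _]addrC -[RHS]addrA; congr (_ + _); rewrite [RHS]addrC -addrA.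
apply: le_lt_trans (snormZ q _ _) _.
have -> : nc 2 = 2.
  by rewrite -(rmorph_nat (real_complex R)) normcR ger0_norm.
rewrite mulrC -ltr_pdivlMr //; exact: (uM n.+1 n (leqW Mn) Mn).
Qed.

Variable omega : {scalar completion q}.
Hypothesis omega_pos : positive_functional omega.

Definition functional_form : psd_form A.
Proof.
apply: (@PsdForm _ _ (fun x y => omega (c_in q (sstar q y * x)))).
- by move=> a x y z; rewrite mulrDr -scalerAr c_in_linear linearP.
- by move=> a x y z; rewrite sstar_semilinear mulrDl -scalerAl c_in_linear linearP.
- by move=> x; rewrite c_inM c_in_star omega_pos.
Defined.

Lemma positive_functional1_ge0 : 0 <= complex.Re (omega (c_in q 1)).
Proof. by have := psd_Re_ge0 functional_form 1; rewrite /= sstar1 mulr1. Qed.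

Lemma functional_contractive x : q x < 1 ->
  complex.Re (omega (c_in q (sstar q x * x))) <= complex.Re (omega (c_in q 1)).
Proof.
move=> x1; have [||y yE] := @completion_sqrt (sstar q x * x).
- by rewrite sstarM sstarK.
- apply: le_lt_trans (snormM q _ _) _; rewrite snorm_star.
  by rewrite mulr_ilt1 ?snorm_ge0.
have := omega_pos y; rewrite yE addrC -scaleN1r c_in_linear linearP /=.
rewrite lecE /= => /andP[_]; rewrite mulN1r.
have -> (z w : C) : complex.Re (- z + w) = complex.Re w - complex.Re z.
  by case: z; case: w => * /=; rewrite addrC.
by rewrite subr_ge0.
Qed.

(** After scaling [x] below norm [1], the element [1 - x^* x] is a square, so
    [omega (x^* x) <= omega 1], and the Cauchy-Schwarz inequality for the form
    [omega (y^* x)] bounds [omega x]. *)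
Lemma positive_functional_bounded x :
  nc (omega (c_in q x)) <= complex.Re (omega (c_in q 1)) * q x.
Proof.
set M := complex.Re _.
have Q1 : psd_norm functional_form 1 ^+ 2 = M.
  by rewrite sqr_sqrtr ?psd_Re_ge0 //= sstar1 mulr1.
have M0 : 0 <= M by rewrite -Q1 sqr_ge0.
have main y : q y < 1 -> nc (omega (c_in q y)) <= M.
  move=> y1; have := psd_cauchy_schwarz functional_form y 1.
  rewrite /= sstar1 mul1r => /le_trans; apply; rewrite -Q1 expr2.
  rewrite ler_wpM2r ?psd_norm_ge0 // /psd_norm ler_wsqrtr //=.
  by rewrite sstar1 mulr1 functional_contractive.
apply/ler_addgt0Pr => e e0.
pose r := q x + e / (M + 1).
have M1 : 0 < M + 1 by rewrite ltr_wpDl.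
have r0 : 0 < r by rewrite ltr_wpDl ?snorm_ge0 // divr_gt0.
have rinv : nc (r^-1)%:C = r^-1 by rewrite normcR ger0_norm // invr_ge0 ltW.
have xr : q ((r^-1)%:C *: x) < 1.
  apply: le_lt_trans (snormZ q _ _) _; rewrite rinv mulrC ltr_pdivrMr // mul1r.
  by rewrite ltrDl divr_gt0.
have c_inZ (c : C) : omega (c_in q (c *: x)) = c * omega (c_in q x).
  have c0 : c_in q 0 = 0 by [].
  by have := c_in_linear q c x 0; rewrite addr0 c0 addr0 => ->; rewrite linearZ.
have := main _ xr; rewrite c_inZ normcM rinv mulrC ler_pdivrMr // => /le_trans; apply.
rewrite mulrDr lerD2l mulrA ler_pdivrMr // mulrC ler_wpM2l ?(ltW e0) //.
by rewrite lerDl.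
Qed.

End PositiveFunctionals.

(** * Extension of bounded positive functionals *)

Section ExtendFunctional.
Variables (R : realType) (A : algType R[i]) (q : star_seminorm A).
Local Notation C := R[i].
Local Notation nc := (@Normc.normc R).
Variables (w : A -> C) (M : R).
Hypothesis w_lin : forall (a : C) x y, w (a *: x + y) = a * w x + w y.
Hypothesis w_bound : forall x, nc (w x) <= M * q x.
Hypothesis w_pos : forall x, 0 <= w (sstar q x * x).

Lemma functionalB x y : w (x - y) = w x - w y.
Proof. by rewrite addrC -scaleN1r w_lin mulN1r addrC. Qed.

Lemma functional_small (e : R) : 0 < e ->
  exists2 r, 0 < r & forall x, q x < r -> nc (w x) < e.
Proof.
move=> e0; have M1 : 0 < `|M| + 1 by rewrite ltr_wpDl.
exists (e / (`|M| + 1)) => [|x]; first by rewrite divr_gt0.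
rewrite ltr_pdivlMr // => h; apply: le_lt_trans h; apply: le_trans (w_bound x) _.
by rewrite mulrC ler_wpM2l ?snorm_ge0 // (le_trans (ler_norm M)) // lerDl.
Qed.

Lemma functional_cauchy (u : cauchy_seq q) : cauchyc (fun n => w (u n)).
Proof.
move=> e /functional_small[r r0 wr]; have [N uN] := Defs.cauchyP u r0.
by exists N => i j Ni Nj; rewrite -functionalB wr // uN.
Qed.

Definition completion_ext (X : completion q) : C :=
  projT1 (cid (cauchyc_cvg (functional_cauchy (repr X)))).

Lemma completion_ext_cvg (u : cauchy_seq q) :
  cvgc (fun n => w (u n)) (completion_ext (\pi_(completion q)%qT u)).
Proof.
set X := \pi_(_)%qT u; have Xl := projT2 (cid (cauchyc_cvg (functional_cauchy (repr X)))).
apply: (cvgc_sub0 Xl) => e /functional_small[r r0 wr].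
have /asboolP/(_ r r0)[N uN] := repr_equiv u.
by exists N => n Nn; rewrite subr0 -functionalB wr // snorm_sub uN.
Qed.

Lemma completion_ext_in x : completion_ext (c_in q x) = w x.
Proof. exact: (cvgc_unique (completion_ext_cvg (cs_const q x)) (@cvgc_cst _ (w x))). Qed.

Lemma completion_ext_linear (a : C) X Y :
  completion_ext (a *: X + Y) = a * completion_ext X + completion_ext Y.
Proof.
elim/completion_ind: X => u; elim/completion_ind: Y => v.
rewrite c_linE c_lin_pi; apply: (cvgc_unique (completion_ext_cvg _)).
have := cvgc_lin a (completion_ext_cvg u) (completion_ext_cvg v).
by congr cvgc; apply/funext => n; rewrite w_lin.
Qed.

HB.instance Definition _ := GRing.isLinear.Build C (completion q) C *%R
  completion_ext completion_ext_linear.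

Lemma completion_ext_pos : positive_functional (completion_ext : {scalar completion q}).
Proof.
move=> X; elim/completion_ind: X => u.
rewrite /GRing.mul /= c_star_pi c_mul_pi.
by apply: (cvgc_ge0 (completion_ext_cvg _)) => n; apply: w_pos.
Qed.

Lemma completion_ext_exists : exists omega : {scalar completion q},
  positive_functional omega /\ forall x, omega (c_in q x) = w x.
Proof.
exists completion_ext.
by split; [exact: completion_ext_pos | exact: completion_ext_in].
Qed.

End ExtendFunctional.

(** * Growth of positive definite functions on spheres *)

Section FreeGroupEstimates.
Variables (R : realType) (d : nat) (p : R).
Hypothesis p2 : 2 <= p.
Local Notation C := R[i].
Local Notation nc := (@Normc.normc R).
Local Notation F := (free_group d).
Local Notation A := (group_algebra R F).
Implicit Types (phi : F -> C) (s : F) (k : nat).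

Let p0 : 0 < p. Proof. exact: lt_le_trans p2. Qed.

Lemma normc_chi phi k s :
  nc (phi s * chi R k s) `^ p = if wlen s == k then nc (phi s) `^ p else 0.
Proof.
rewrite /chi (_ : (s \in W k) = (wlen s == k)); last by rewrite /W; apply/asboolP/eqP.
by case: eqP => _; rewrite ?mulr1 // mulr0 Normc.normc0 powR0 // gt_eqF.
Qed.

Lemma sum_by_length (r : seq F) (M : nat) (f : F -> R) :
  (forall s, s \in r -> (wlen s < M)%N) ->
  \sum_(s <- r) f s = \sum_(k < M) \sum_(s <- r | wlen s == k) f s.
Proof.
move=> rM; under [RHS]eq_bigr do rewrite big_mkcond.
rewrite exchange_big big_seq [RHS]big_seq; apply: eq_bigr => s sr.
by rewrite -big_mkcond (big_pred1 (Ordinal (rM s sr))).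
Qed.

Definition sphere_bound phi (M : R) :=
  forall k, sums_le (fun s => nc (phi s * chi R k s) `^ p) ((M * k.+1%:R) `^ p).

Lemma sphere_boundP phi :
  (ereal_sup [set lpnorm p (fun s => (phi s * chi R k s)%R) * (k.+1%:R^-1)%:E
             | k in [set: nat]] < +oo)%E <-> exists2 M, 0 <= M & sphere_bound phi M.
Proof.
set S := ereal_sup _; split=> [Soo|[M M0 phiM]]; last first.
  apply: le_lt_trans (ltry M); apply: ge_ereal_sup => _ [k _ <-].
  rewrite lee_pdivrMr // -EFinM; apply/lpnorm_leP => //.
  by rewrite mulr_ge0.
have S0 : (0 <= S)%E.
  apply: le_trans (ereal_sup_ubound _); last by exists 0%N.
  by rewrite mule_ge0 // ?poweR_ge0 // lee_fin invr_ge0.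
exists (fine S) => [|k]; first exact: fine_ge0.
apply/lpnorm_leP => //; first by rewrite mulr_ge0 ?fine_ge0.
rewrite EFinM -lee_pdivrMr // fineK ?ge0_fin_numE //.
by apply: ereal_sup_ubound; exists k.
Qed.

(** Duality on a sphere: testing the functional on
    [conj phi |phi|^(p-2)], whose q-norm is [|phi|_p^(p-1)]. *)
Lemma bounded_sphere_bound phi (M : R) : 0 <= M ->
  (forall f : A, nc (omega_fun phi f) <= M * Dnorm (lp p) f) -> sphere_bound phi M.
Proof.
move=> M0 phiM k r ur.
pose r' := [seq s <- r | wlen s == k].
have ur' : uniq r' by apply: filter_uniq.
have -> : \sum_(s <- r) nc (phi s * chi R k s) `^ p = \sum_(s <- r') nc (phi s) `^ p.
  by rewrite big_filter [RHS]big_mkcond; apply: eq_bigr => s _; rewrite normc_chi.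
set S := \sum_(s <- r') _; have S0 : 0 <= S by apply: sumr_ge0 => s _; apply: powR_ge0.
have [->|Sn0] := eqVneq S 0; first exact: powR_ge0.
have Sgt : 0 < S by rewrite lt_def Sn0.
pose c s : C := Num.conj (phi s) * (nc (phi s) `^ (p - 2))%:C.
pose f : A := \sum_(s <- r') c s *: delta R s.
have p1 : 0 < p - 1 by move: p2; lra.
have fE s : f s = if s \in r' then c s else 0.
  rewrite ga_sumE; under eq_bigr do rewrite (ga_scaleE _ (delta R _)) deltaE.
  case: ifP => sr; last first.
    rewrite big_seq big1 // => t tr; case: eqP sr => [->|_ _]; first by rewrite tr.
    by rewrite mulr0.
  rewrite (bigD1_seq s) //= eqxx mulr1 big1 ?addr0 // => t ts.
  by rewrite eq_sym (negPf ts) mulr0.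
have ncc s : nc (c s) = nc (phi s) `^ (p - 1).
  rewrite normcM normc_conj normcR ger0_norm ?powR_ge0 //.
  by rewrite -(mulr_powRB1 (normc_ge0 (phi s)) p1); congr (_ * _ `^ _); ring.
have ofE : omega_fun phi f = S%:C.
  rewrite /f; have -> : omega_fun phi (\sum_(s <- r') c s *: delta R s) =
      \sum_(s <- r') c s * phi s.
    elim: (r') => [|t t' IH]; first by rewrite !big_nil omega_funE gsum0.
    by rewrite !big_cons omega_lin omega_delta IH.
  rewrite rmorph_sum; apply: eq_bigr => s _; rewrite /c mulrAC [_ * phi s]mulrC mulr_conjc.
  rewrite -rmorphM; congr (_%:C).
  rewrite -(mulr_powRB1 (normc_ge0 (phi s)) p0) -(mulr_powRB1 (normc_ge0 (phi s)) p1).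
  by rewrite expr2 -mulrA; congr (_ * (_ * _ `^ _)); ring.
have fk s : f s != 0 -> wlen s = k.
  by rewrite fE; case: ifP => [|_]; rewrite ?eqxx // mem_filter => /andP[/eqP].
have fS : sums_le (fun s => nc (f s) `^ conj_exponent p) S.
  have q0 : 0 < conj_exponent p by rewrite divr_gt0.
  move=> t ut; rewrite (bigID (fun s => s \in r')) /=.
  rewrite [X in _ + X]big1 => [|s /negPf sr]; last by
    rewrite fE sr Normc.normc0 powR0 // gt_eqF.
  rewrite addr0 -big_filter.
  apply: (@le_trans _ _ (\sum_(s <- [seq s <- t | s \in r']) nc (phi s) `^ p)).
    rewrite big_seq [leRHS]big_seq; apply: ler_sum => s; rewrite mem_filter => /andP[sr _].
    rewrite fE sr ncc -powRrM /conj_exponent mulrC divfK ?gt_eqF //.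
  apply: ler_sum_uniq => // [s||s]; [exact: powR_ge0 | exact: filter_uniq |].
  by rewrite mem_filter => /andP[].
have := phiM f; rewrite ofE normcR ger0_norm // => SM.
have := Dnorm_sphere_le p2 Sgt fk fS => /(ler_wpM2l M0)/(le_trans SM).
set q := conj_exponent p => h.
(* the exponents are conjugate: divide the inequality by [S^(1/q)] *)
have SE : S = S `^ p^-1 * S `^ q^-1.
  by rewrite -powRD ?conj_exponentP ?powRr1 // ?Sn0 implybT.
have Sq : 0 < S `^ q^-1 by apply: powR_gt0.
have : S `^ p^-1 <= M * k.+1%:R by rewrite -(ler_pM2r Sq) -SE -mulrA.
move/(ge0_ler_powR (ltW p0)); rewrite !nnegrE powR_ge0 mulr_ge0 // => /(_ isT isT).
by rewrite -powRrM mulVf ?gt_eqF // powRr1.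
Qed.

(** [(k + 1)^(-2) <= k^(-1) - (k + 1)^(-1)], and the sum telescopes. *)
Lemma sum_inv_sqr (M : nat) : \sum_(k < M.+1) k.+1%:R ^- 2 <= 2 - M.+1%:R^-1 :> R.
Proof.
elim: M => [|M IH]; first by rewrite big_ord1 expr1n invr1; lra.
rewrite big_ord_recr /=; apply: le_trans (lerD IH (lexx _)) _.
rewrite -[M.+2%:R]natr1; set y : R := M.+1%:R; have y0 : 0 < y by rewrite ltr0n.
have y1 : 0 < y + 1 by rewrite ltr_wpDr.
rewrite -addrA lerD2l -lerBrDl opprK [leRHS]addrC.
have -> : y^-1 - (y + 1)^-1 = (y * (y + 1))^-1 by field; rewrite !gt_eqF.
by rewrite lef_pV2 ?posrE ?exprn_gt0 ?mulr_gt0 // expr2 ler_pM2r // lerDl.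
Qed.

(** On the sphere of radius [k] the weight to the power [p] is
    [(k + 1)^(- p - 2)], which leaves the summable bound [M^p (k + 1)^(-2)]. *)
Lemma sphere_bound_weighted phi (M : R) : 0 <= M -> sphere_bound phi M ->
  lp p (fun s => phi s * ((1 + (wlen s)%:R) `^ (- 1 - 2 / p))%:C).
Proof.
move=> M0 phiM; apply/lpP => //; exists (M `^ p * 2) => r ur.
pose L := (\max_(s <- r) wlen s).+1.
have rL s : s \in r -> (wlen s < L)%N by move=> sr; rewrite ltnS; apply: leq_bigmax_seq.
rewrite (sum_by_length _ rL).
apply: (@le_trans _ _ (\sum_(k < L) M `^ p * k.+1%:R ^- 2)); last first.
  rewrite -mulr_sumr ler_wpM2l ?powR_ge0 //; apply: le_trans (sum_inv_sqr _) _.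
  by rewrite gerBl invr_ge0.
apply: ler_sum => k _.
have k0 : 0 < k.+1%:R :> R by rewrite ltr0n.
apply: (@le_trans _ _ (k.+1%:R `^ (- p - 2) * \sum_(s <- r) nc (phi s * chi R k s) `^ p)).
  rewrite mulr_sumr big_mkcond; apply: ler_sum => s _; rewrite normc_chi.
  case: eqP => [sk|_]; last by rewrite mulr0.
  rewrite normcM normcR ger0_norm ?powR_ge0 // powRM ?normc_ge0 ?powR_ge0 //.
  rewrite sk -powRrM mulrC [1 + _]addrC natr1.
  by have -> : (- 1 - 2 / p) * p = - p - 2 by field; rewrite gt_eqF.
apply: le_trans (ler_wpM2l (powR_ge0 _ _) (phiM k r ur)) _.
rewrite powRM ?(ltW k0) // mulrCA ler_wpM2l ?powR_ge0 //.
rewrite -powRD; last by rewrite (gt_eqF k0) implybT.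
rewrite (_ : - p - 2 + p = - 2); last by ring.
by rewrite powRN powR_mulrn // ltW.
Qed.

(** Both sides are compared with [(1 + b + ... + b^n) (1 - b) = 1 - b^(n + 1)]. *)
Lemma geometric_decay (b : R) n : 0 <= b <= 1 -> n.+1%:R * b ^+ n * (1 - b) <= 1.
Proof.
move=> /andP[b0 b1]; have b1' : 0 <= 1 - b by rewrite subr_ge0.
suff : n.+1%:R * b ^+ n * (1 - b) <= 1 - b ^+ n.+1.
  by move/le_trans; apply; rewrite gerBl exprn_ge0.
elim: n => [|n IH]; first by rewrite expr0 expr1 mulr1 mul1r.
have h1 := ler_wpM2l b0 IH.
have h2 : 0 <= (1 - b) * (1 - b ^+ n.+1) by rewrite mulr_ge0 // subr_ge0 exprn_ile1.
have -> : n.+2%:R * b ^+ n.+1 * (1 - b) =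
    b * (n.+1%:R * b ^+ n * (1 - b)) + b ^+ n.+1 * (1 - b).
  by rewrite -[n.+2%:R]natr1 exprS; ring.
apply: le_trans (lerD h1 (lexx _)) _; rewrite -subr_ge0.
by apply: le_trans h2 _; rewrite le_eqVlt; apply/orP; left; apply/eqP; rewrite !exprS; ring.
Qed.

(** [alpha^n] is at most a multiple of [(1 + n)^(-2)], because
    [(1 + n) b^n <= (1 - b)^(-1)] for [b] the square root of [alpha]; and
    [1 + 2 / p <= 2]. *)
Lemma weighted_radial phi (alpha : R) : 0 < alpha < 1 ->
  lp p (fun s => phi s * ((1 + (wlen s)%:R) `^ (- 1 - 2 / p))%:C) ->
  lp p (fun s => phi s * (alpha ^+ wlen s)%:C).
Proof.
move=> /andP[a0 a1] /lpP[//|K phiK]; apply/lpP => //.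
set b := Num.sqrt alpha.
have b0 : 0 <= b by apply: sqrtr_ge0.
have b1 : b < 1 by rewrite -sqrtr1 ltr_sqrt // ltr01.
have b1' : 0 < 1 - b by rewrite subr_gt0.
pose c := (1 - b) ^- 2; have c0 : 0 <= c by rewrite invr_ge0 sqr_ge0.
have decay n : alpha ^+ n <= c * (1 + n%:R) `^ (- 1 - 2 / p).
  have n0 : 0 < 1 + n%:R :> R by rewrite ltr_wpDr.
  have h : n.+1%:R * b ^+ n <= (1 - b)^-1.
    by rewrite -[leRHS]mul1r ler_pdivlMr // geometric_decay // b0 ltW.
  have h2 : (1 + n%:R) ^+ 2 * alpha ^+ n <= c.
    have -> : alpha = b ^+ 2 by rewrite sqr_sqrtr // ltW.
    rewrite -exprM mulnC exprM -exprMn /c -exprVn ler_pXn2r ?nnegrE ?mulr_ge0 //;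
      rewrite ?exprn_ge0 ?invr_ge0 ?(ltW n0) ?(ltW b1') //.
    by rewrite addrC natr1.
  apply: (@le_trans _ _ (c * (1 + n%:R) ^- 2)).
    by rewrite ler_pdivlMr ?exprn_gt0 // mulrC.
  rewrite ler_wpM2l // -powR_mulrn ?(ltW n0) // -powRN ler_powR ?lerDl //.
  have : 2 / p <= 1 by rewrite ler_pdivrMr // mul1r.
  lra.
have cK := sums_leZ (powR_ge0 c p) phiK.
exists (c `^ p * K); apply: sums_le_leF cK => s.
rewrite !normcM !normcR !ger0_norm ?powR_ge0 ?exprn_ge0 ?(ltW a0) //.
rewrite -powRM ?mulr_ge0 ?normc_ge0 ?powR_ge0 // mulrCA.
rewrite ge0_ler_powR ?nnegrE ?(ltW p0) ?mulr_ge0 ?normc_ge0 ?powR_ge0 //;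
  rewrite ?exprn_ge0 ?(ltW a0) //.
by rewrite ler_wpM2l ?normc_ge0.
Qed.

Lemma one_sub_exprn_le (a : R) n : 0 <= a <= 1 -> 1 - a ^+ n <= n%:R * (1 - a).
Proof.
move=> /andP[a0 a1]; elim: n => [|n IH]; first by rewrite expr0 subrr mul0r.
have -> : 1 - a ^+ n.+1 = (1 - a ^+ n) + a ^+ n * (1 - a) by rewrite exprS; ring.
rewrite -natr1 mulrDl mul1r lerD // ler_piMl ?subr_ge0 //; exact: exprn_ile1.
Qed.

(** The functions [phi alpha^|s|] are positive definite and lie in l_p, hence
    satisfy the bound; on a fixed element of the group algebra they converge to
    [phi] as [alpha] tends to [1]. *)
Lemma radial_bounded phi : positive_definite phi ->
  (forall alpha : R, 0 < alpha < 1 -> lp p (fun s => phi s * (alpha ^+ wlen s)%:C)) ->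
  forall f : A, nc (omega_fun phi f) <= nc (phi 1%g) * Dnorm (lp p) f.
Proof.
move=> phi_pd phi_lp f; have [E fE] := gsum_supp f.
pose L := \sum_(s <- E) nc (f s) * nc (phi s) * (wlen s)%:R.
have L0 : 0 <= L by apply: sumr_ge0 => s _; rewrite !mulr_ge0 ?normc_ge0.
apply/ler_addgt0Pr => e e0.
have L1 : 0 < L + 1 by rewrite ltr_wpDl.
(* with [alpha = 1 - dl] the error is at most [dl L <= e] *)
pose dl := Num.min 2^-1 (e / (L + 1)).
have dl0 : 0 < dl by rewrite lt_min invr_gt0 ltr0n divr_gt0.
have dl1 : dl <= 2^-1 by rewrite ge_min lexx.
have dlL : dl * L <= e.
  have : dl <= e / (L + 1) by rewrite ge_min lexx orbT.
  rewrite ler_pdivlMr // => /(le_trans _); apply.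
  by rewrite ler_wpM2l ?(ltW dl0) // lerDl.
pose alpha := 1 - dl; have a01 : 0 < alpha < 1 by rewrite /alpha; move: dl0 dl1; lra.
have a01' : 0 <= alpha <= 1 by case/andP: a01 => /ltW -> /ltW.
set psi := fun s => phi s * (alpha ^+ wlen s)%:C.
have psi1 : psi 1%g = phi 1%g by rewrite /psi /= expr0 mulr1.
have hpsi : nc (omega_fun psi f) <= nc (phi 1%g) * Dnorm (lp p) f.
  rewrite -psi1; apply: omega_le_Dnorm p0 (phi_lp _ a01).
  exact: radial_positive_definite.
have -> : omega_fun phi f = omega_fun psi f + (omega_fun phi f - omega_fun psi f).
  by rewrite addrC subrK.
apply: le_trans (ler_normcD _ _) _; apply: lerD => //.
apply: le_trans dlL; rewrite !omega_funE !(gsumE _ fE) -sumrB.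
have -> : \sum_(s <- E) (f s *: (phi s : C^o) - f s *: (psi s : C^o)) =
    \sum_(s <- E) f s * phi s * (1 - alpha ^+ wlen s)%:C.
  apply: eq_bigr => s _; rewrite rmorphB rmorph1 mulrBr mulr1 /psi.
  by rewrite -[f s *: _]/(f s * _) -[f s *: _]/(f s * _) mulrA.
apply: le_trans (ler_normc_sum _ _) _; rewrite mulr_sumr; apply: ler_sum => s _.
have h := one_sub_exprn_le (wlen s) a01'; rewrite {2}/alpha subKr in h.
rewrite !normcM normcR ger0_norm; last first.
  by case/andP: a01' => ? ?; rewrite subr_ge0 exprn_ile1.
by rewrite mulrCA ler_wpM2l ?mulr_ge0 ?normc_ge0 // mulrC.
Qed.

End FreeGroupEstimates.

Theorem theorem3p4 (R : realType) (d : nat) (hd : (2 <= d)%N)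
    (p : R) (hp : 2 <= p)
    (phi : free_group d -> R[i]) (hphi : positive_definite phi) :
  [<-> extends_to_positive (lp p) phi;
       (ereal_sup [set lpnorm p (fun s => (phi s * chi R k s)%R) * (k.+1%:R^-1)%:E
                  | k in [set: nat]] < +oo)%E;
       lp p (fun s => phi s * ((1 + (wlen s)%:R) `^ (- 1 - 2 / p))%:C);
       forall alpha : R, 0 < alpha < 1 ->
         lp p (fun s => phi s * (alpha ^+ wlen s)%:C)].
Proof.
have p0 : 0 < p by apply: lt_le_trans hp.
tfae.
- move=> [omega [omega_pos omegaE]]; apply/(sphere_boundP hp).
  have bound := positive_functional_bounded omega_pos.
  have M0 := positive_functional1_ge0 omega_pos.
  exists (complex.Re (omega (c_in (Dnorm_seminorm (lp p)) 1))) => //.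
  by apply: bounded_sphere_bound => // f; rewrite -omegaE bound.
- by move=> /(sphere_boundP hp)[M M0 phiM]; apply: sphere_bound_weighted phiM.
- by move=> phi_lp alpha a01; apply: weighted_radial phi_lp.
- move=> phi_lp.
  have bound := radial_bounded hp hphi phi_lp.
  have lin (a : R[i]) (f g : group_algebra R (free_group d)) :
    omega_fun phi (a *: f + g) = a * omega_fun phi f + omega_fun phi g.
    exact: omega_lin.
  exact: (@completion_ext_exists _ _ (Dnorm_seminorm (lp p)) _ _ lin bound
            (omega_star_ge0 hphi)).
Qed.
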